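(* For every $n\ge 3$, $$\underline{\lambda}_3(n)\ \le\ 1\cdot 2^{(n-3)\bmod 15}\cdot 11552^{\lfloor (n-3)/15\rfloor}.$$ Hence $\underline{\lambda}_3(n)$ grows at most as $\bigl(\sqrt[15]{11552}\bigr)^n\approx 1.86571^n$.
   Context: A graph $G=(V,E)$ is minimally $3$-rigid if it is generically rigid in $\mathbb{R}^3$ and deleting any edge destroys this. For such $G$, $\lambda_3(G)$ is the number of complex realizations $\rho\colon V\to\mathbb{C}^3$ with $\sum_{i=1}^3(\rho(u)_i-\rho(v)_i)^2=\ell_{uv}$ for all $uv\in E$, for generic values $\ell_{uv}$, counted modulo translations and $SO(3,\mathbb{C})$ (reflections counted as distinct). $\underline{\lambda}_3(n)$ is the minimum of $\lambda_3(G)$ over all minimally $3$-rigid graphs with $n$ vertices. *)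

(* Defs.v *)
From HB Require Import structures.
From mathcomp Require Import all_boot all_order all_algebra.
From mathcomp Require Import complex.
From mathcomp Require Import reals.
From mathcomp Require Import -(notations) mpoly.

Set Implicit Arguments.
Unset Strict Implicit.
Unset Printing Implicit Defensive.

Import Order.TTheory GRing.Theory Num.Theory.

Local Open Scope ring_scope.

(* [Q] holds for all points of the affine space K^I outside the zero set of
   some nonzero polynomial, i.e. on a nonempty Zariski-open set when K is
   infinite. *)
Definition generically (K : fieldType) (I : finType) (Q : (I -> K) -> Prop)
    : Prop :=
  exists P : mpoly #|I| K,
    P != 0 /\
    forall x : I -> K, meval (fun i => x (enum_val i)) P != 0 -> Q x.

Section Realizations.
Variables (K : fieldType) (V : finType).

(* No conjugation, also over the complex numbers. *)
Definition sqdist (x y : 'rV[K]_3) : K := \sum_(i < 3) (x 0 i - y 0 i) ^+ 2.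

Definition realization_of (x : V * 'I_3 -> K) : V -> 'rV[K]_3 :=
  fun v => \row_i x (v, i).

Definition directly_congruent (rho rho' : V -> 'rV[K]_3) : Prop :=
  exists (A : 'M[K]_3) (t : 'rV[K]_3),
    [/\ A *m A^T = 1%:M, \det A = 1 & forall v, rho' v = rho v *m A + t].

End Realizations.

(* A graph with vertex set V is given by its edge set, a set of 2-subsets. *)
Definition simple_graph (V : finType) (E : {set {set V}}) : Prop :=
  forall e, e \in E -> #|e| = 2%N.

Definition edge (V : finType) (E : {set {set V}}) : finType :=
  {e : {set V} | e \in E}.

Section Rigidity.
Variables (R : realType) (V : finType).
Implicit Types (E : {set {set V}}) (p q : V -> 'rV[R]_3).

Definition equivalent E p q : Prop :=
  forall u v, [set u; v] \in E -> sqdist (q u) (q v) = sqdist (p u) (p v).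

Definition congruent p q : Prop :=
  forall u v, sqdist (q u) (q v) = sqdist (p u) (p v).

(* Local rigidity in the sense of Gluck and Asimow-Roth. *)
Definition rigid_framework E p : Prop :=
  exists eps : R, 0 < eps /\
    forall q, equivalent E p q -> (forall v, sqdist (p v) (q v) < eps) ->
      congruent p q.

Definition generically_rigid E : Prop :=
  generically (fun x : V * 'I_3 -> R => rigid_framework E (realization_of x)).

Definition minimally_rigid E : Prop :=
  [/\ simple_graph E, generically_rigid E &
      forall e, e \in E -> ~ generically_rigid (E :\ e)].

End Rigidity.

Section Counting.
Variables (R : realType) (V : finType) (E : {set {set V}}).

Definition compatible (l : edge E -> R[i]) (rho : V -> 'rV[R[i]]_3) : Prop :=
  forall (e : edge E) u v, val e = [set u; v] ->
    sqdist (rho u) (rho v) = l e.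

(* There are exactly k classes, with representatives [rep i]. *)
Definition realization_count (l : edge E -> R[i]) (k : nat) : Prop :=
  exists rep : 'I_k -> V -> 'rV[R[i]]_3,
    [/\ forall i, compatible l (rep i),
        forall i j, directly_congruent (rep i) (rep j) -> i = j &
        forall rho, compatible l rho ->
          exists i, directly_congruent (rep i) rho].

Definition is_lambda3 (k : nat) : Prop :=
  generically (fun l : edge E -> R[i] => realization_count l k).

End Counting.

(* Every graph with n vertices is isomorphic to one with vertex set 'I_n. *)
Definition is_min_lambda3 (R : realType) (n m : nat) : Prop :=
  (exists E : {set {set 'I_n}}, minimally_rigid R E /\ is_lambda3 R E m) /\
  (forall (E : {set {set 'I_n}}) (k : nat),
     minimally_rigid R E -> is_lambda3 R E k -> (m <= k)%N).

(* Main.v *)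
From Stdlib Require Import ZArith.
Require Import Defs.
From HB Require Import structures.
From mathcomp Require Import all_boot all_order all_algebra closed_field complex ssrZ ring lra.
From mathcomp Require Import -(notations) mpoly.
From mathcomp Require Import boolp reals exp.
From mathcomp Require mathcomp_extra classical_sets functions interval_inference topology normedtype sequences.

Set Implicit Arguments.
Unset Strict Implicit.
Unset Printing Implicit Defensive.

Import Order.TTheory GRing.Theory Num.Theory.

Local Open Scope ring_scope.

(** The bound comes from graphs whose pieces all share one triangle. Gluing two graphs along a
    triangle multiplies the numbers of realizations, because direct isometries that agree on a
    nondegenerate triangle coincide ([triangle_glue_covers]), while only the vertices outside the
    triangle add up. A tetrahedron adds one vertex and a factor 2. The other piece consists of two
    copies of K_{4,6} hinged along a common edge xy, with a bar between the two copies of another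
    neighbour c of x. It has 18 vertices, contains the triangle on x and the two copies of c, and
    generically has at most 2 * 76 * 76 = 11552 realizations: the copies can only rotate about the
    hinge, and the bar leaves two positions ([hinge_glue_covers]). With (n-3) mod 15 tetrahedra and
    the integer part of (n-3)/15 large pieces one gets the required graph ([rooted_book]).

    The core is the bound 76 for K_{4,6}, that is 38 up to reflection ([K46_covers]). Take the three
    vectors from the first of the four points to the others, let p be the vector of their squared
    lengths and H the inverse of their Gram matrix. The 24 given lengths make H an affine function
    of the four unknowns t = (Hp, p^T H p) through six linear equations ([quadric_equation]), while
    p is also the diagonal of the inverse of H. This yields a polynomial system for t
    ([polar_solves]), and t determines the realization up to an orthogonal map and a translation
    ([orthogonally_congruent]). If a certain determinant is nonzero, 172 multiples of the equations
    express all 210 monomials of degree at most 6 through 38 of them. Multiplication by a linear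
    form then becomes a 38 by 38 matrix with the values of the form at the solutions among its
    eigenvalues, so there are at most 38 solutions ([solutions_bounded]). The determinant is an
    integral polynomial in the lengths; it is generically nonzero because it is nonzero modulo 23 at
    one integer point ([rank_checkP]).

    Only upper bounds are computed; two general facts turn them into statements about the generic
    count. Having exactly k classes is a first-order condition on the lengths, so by quantifier
    elimination it either holds generically or fails generically, and a generic upper bound N yields
    a generic value at most N ([lambda3_of_covers]). If moreover the derivative of the length map is
    generically onto ([independent]), then generic real frameworks have generic lengths
    ([generic_lengths]), a finite count forces rigidity, and one length can be varied with the
    others fixed, so no edge can be deleted ([minimally_rigid_of_count]). Both gluings preserve
    [independent]. *)

(** * Polynomial functions and generic points *)

Section PolyFun.
Variable K : numFieldType.

(** Working with functions instead of polynomials makes closure under composition and reindexing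
    free of bookkeeping about variables. *)
Definition polyfun (I : finType) (f : (I -> K) -> K) : Prop :=
  exists P : mpoly #|I| K, forall x, f x = meval (fun i => x (enum_val i)) P.

Section Closure.
Variable I : finType.
Implicit Types f g : (I -> K) -> K.

Lemma polyfun_ext f g : f =1 g -> polyfun f -> polyfun g.
Proof. by move=> fg [P hP]; exists P => x; rewrite -fg. Qed.

Lemma polyfun_const c : polyfun (fun _ : I -> K => c).
Proof. by exists (mpolyC _ c) => x; rewrite mevalC. Qed.

Lemma polyfun_coord i : polyfun (fun x : I -> K => x i).
Proof. by exists (mpolyX _ (mnm1 (enum_rank i))) => x; rewrite mevalXU enum_rankK. Qed.

Lemma polyfunD f g : polyfun f -> polyfun g -> polyfun (fun x => f x + g x).
Proof. by move=> [P hP] [Q hQ]; exists (P + Q) => x; rewrite mevalD hP hQ. Qed.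

Lemma polyfunN f : polyfun f -> polyfun (fun x => - f x).
Proof. by move=> [P hP]; exists (- P) => x; rewrite mevalN hP. Qed.

Lemma polyfunB f g : polyfun f -> polyfun g -> polyfun (fun x => f x - g x).
Proof. by move=> hf hg; apply: polyfunD => //; apply: polyfunN. Qed.

Lemma polyfunM f g : polyfun f -> polyfun g -> polyfun (fun x => f x * g x).
Proof. by move=> [P hP] [Q hQ]; exists (P * Q) => x; rewrite mevalM hP hQ. Qed.

Lemma polyfunX f n : polyfun f -> polyfun (fun x => f x ^+ n).
Proof.
move=> hf; elim: n => [|n IHn].
  by apply: polyfun_ext (polyfun_const 1) => x; rewrite expr0.
by apply: polyfun_ext (polyfunM hf IHn) => x; rewrite exprS.
Qed.

Lemma polyfun_sum (J : Type) (r : seq J) (P : pred J) (F : J -> (I -> K) -> K) :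
  (forall j, polyfun (F j)) -> polyfun (fun x => \sum_(j <- r | P j) F j x).
Proof.
move=> hF; elim: r => [|j r IHr].
  by apply: polyfun_ext (polyfun_const 0) => x; rewrite big_nil.
case Pj: (P j); last by apply: polyfun_ext IHr => x; rewrite big_cons Pj.
by apply: polyfun_ext (polyfunD (hF j) IHr) => x; rewrite big_cons Pj.
Qed.

Lemma polyfun_prod (J : Type) (r : seq J) (P : pred J) (F : J -> (I -> K) -> K) :
  (forall j, polyfun (F j)) -> polyfun (fun x => \prod_(j <- r | P j) F j x).
Proof.
move=> hF; elim: r => [|j r IHr].
  by apply: polyfun_ext (polyfun_const 1) => x; rewrite big_nil.
case Pj: (P j); last by apply: polyfun_ext IHr => x; rewrite big_cons Pj.
by apply: polyfun_ext (polyfunM (hF j) IHr) => x; rewrite big_cons Pj.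
Qed.

Lemma polyfun_det n (A : (I -> K) -> 'M[K]_n) :
  (forall i j, polyfun (fun x => A x i j)) -> polyfun (fun x => \det (A x)).
Proof.
move=> hA; rewrite /determinant; apply: polyfun_sum => s; apply: polyfunM.
  exact: polyfun_const.
by apply: polyfun_prod => i.
Qed.

Lemma polyfun_meval n (P : mpoly n K) (F : 'I_n -> (I -> K) -> K) :
  (forall i, polyfun (F i)) -> polyfun (fun x => meval (fun i => F i x) P).
Proof.
move=> hF; apply: polyfun_ext (_ : polyfun (fun x =>
   \sum_(m <- msupp P) mcoeff m P * \prod_i F i x ^+ (fun_of_multinom m i))).
  by move=> x; rewrite mevalE.
apply: polyfun_sum => m; apply: polyfunM; first exact: polyfun_const.
by apply: polyfun_prod => i; apply: polyfunX.
Qed.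

(** Restriction to a line reduces questions of nonvanishing to polynomials in one variable, which
    have finitely many roots. *)
Lemma polyfun_line f (a b : I -> K) : polyfun f ->
  exists q : {poly K}, forall y, f (fun i => a i + y * b i) = q.[y].
Proof.
case=> P hP.
exists (\sum_(m <- msupp P) (mcoeff m P)%:P *
   \prod_i ((a (enum_val i))%:P + 'X * (b (enum_val i))%:P) ^+ (fun_of_multinom m i)).
move=> y; rewrite hP mevalE horner_sum; apply: eq_bigr => m _.
rewrite hornerM hornerC horner_prod; congr (_ * _); apply: eq_bigr => i _.
by rewrite horner_exp !hornerE.
Qed.

End Closure.

Lemma polyfun_comp (I J : finType) (f : (I -> K) -> K) (F : I -> (J -> K) -> K) :
  polyfun f -> (forall i, polyfun (F i)) ->
  polyfun (fun y => f (fun i => F i y)).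
Proof.
move=> [P hP] hF; apply: polyfun_ext (_ : polyfun (fun y =>
  meval (fun i => F (enum_val i) y) P)); first by move=> y; rewrite hP.
exact: polyfun_meval.
Qed.

Lemma poly_nonroot (q : {poly K}) : q != 0 -> exists n : nat, q.[n%:R] != 0.
Proof.
move=> q0; have [/hasP [y /mapP [n _ ->] yq]|/hasPn h] :=
  boolP (has (fun y => q.[y] != 0) [seq (i%:R : K) | i <- iota 0 (size q)]).
  by exists n.
have: (size [seq (i%:R : K) | i <- iota 0 (size q)] < size q)%N.
  apply: max_poly_roots => //.
    by apply/allP => y /h; rewrite negbK.
  by rewrite map_inj_uniq ?iota_uniq //; apply: mulrIn; rewrite oner_eq0.
by rewrite size_map size_iota ltnn.
Qed.

Lemma pow_digits_inj n (B : nat) (m m' : 'I_n -> nat) :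
  (forall i, m i < B)%N -> (forall i, m' i < B)%N ->
  (\sum_(i < n) m i * B ^ i = \sum_(i < n) m' i * B ^ i)%N -> m =1 m'.
Proof.
elim: n m m' => [|n IHn] m m' hm hm' e i; first by case: i.
have e1 : (m ord0 + (\sum_(i < n) m (lift ord0 i) * B ^ i) * B =
           m' ord0 + (\sum_(i < n) m' (lift ord0 i) * B ^ i) * B)%N.
  move: e; rewrite !big_ord_recl /= !expn0 !muln1 => e.
  rewrite !big_distrl /=.
  under eq_bigr do rewrite -mulnA -expnSr.
  by rewrite e; congr addn; apply: eq_bigr => j _; rewrite -mulnA -expnSr.
have B0 : (0 < B)%N by apply: leq_ltn_trans (hm ord0).
have e0 : m ord0 = m' ord0.
  by have := congr1 (modn^~ B) e1; rewrite ![(_ + _ * B)%N]addnC !modnMDl !modn_small.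
have e2 : (\sum_(i < n) m (lift ord0 i) * B ^ i =
           \sum_(i < n) m' (lift ord0 i) * B ^ i)%N.
  by apply/eqP; rewrite -(eqn_pmul2r B0); apply/eqP; move: e1; rewrite e0 => /addnI.
case: (unliftP ord0 i) => [j ->|->] //.
exact: (IHn (fun j => m (lift ord0 j)) (fun j => m' (lift ord0 j))).
Qed.

(* Kronecker substitution: x_i := y ^ (B ^ i) sends distinct monomials with
   exponents < B to distinct powers of y. *)
Lemma mpoly_nonroot n (P : mpoly n K) : P != 0 ->
  exists x : 'I_n -> nat, meval (fun i => (x i)%:R) P != 0.
Proof.
move=> P0.
pose B := (\max_(m <- msupp P) \max_(i < n) fun_of_multinom m i).+1.
have hB m i : m \in msupp P -> (fun_of_multinom m i < B)%N.
  move=> mP; rewrite ltnS.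
  apply: leq_trans (leq_bigmax_seq _ mP _) => //.
  exact: (leq_bigmax_cond i).
pose e (m : multinom n) := (\sum_(i < n) fun_of_multinom m i * B ^ i)%N.
pose q : {poly K} := \sum_(m <- msupp P) mcoeff m P *: 'X^(e m).
have [m0 m0P] : exists m0, m0 \in msupp P.
  case E : (msupp P) => [|m0 s]; last by exists m0; rewrite inE eqxx.
  by move: P0; rewrite -msupp_eq0 E.
have q0 : q != 0.
  apply/negP => /eqP /(congr1 (fun p : {poly K} => p`_(e m0))).
  rewrite coef0 /q coef_sum (bigD1_seq m0) ?msupp_uniq //= big_seq_cond big1 => [|m].
    by rewrite coefZ coefXn eqxx mulr1 addr0 => /eqP; rewrite mcoeff_eq0 m0P.
  case/andP => mP mm0; rewrite coefZ coefXn; case: eqP => [em|]; last by rewrite mulr0.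
  case/eqP: mm0; apply/mnmP; apply: (@pow_digits_inj n B) => //.
  - by move=> i; apply: hB.
  - by move=> i; apply: hB.
have [y hy] := poly_nonroot q0.
exists (fun i : 'I_n => (y ^ (B ^ i))%N); rewrite mevalE.
move: hy; rewrite horner_sum; congr (_ != 0); apply: eq_bigr => m _.
rewrite !hornerE; congr (_ * _); rewrite /e.
by rewrite -prodrXr; apply: eq_bigr => i _; rewrite natrX -exprM mulnC.
Qed.

Section Generic.
Variable I : finType.
Implicit Types (Q : (I -> K) -> Prop).

Lemma generically_polyfun Q (f : (I -> K) -> K) x0 :
  polyfun f -> f x0 != 0 -> (forall x, f x != 0 -> Q x) -> generically Q.
Proof.
move=> [P hP] f0 fQ; exists P; split; last by move=> x hx; apply: fQ; rewrite hP.
by apply: contraNneq f0 => P0; rewrite hP P0 meval0.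
Qed.

(** The witness has natural coordinates, so a point found over the complex numbers can also be read
    as a real point. *)
Lemma generic_polyfun Q : generically Q ->
  exists f (x0 : I -> nat), [/\ polyfun f, f (fun i => (x0 i)%:R) != 0
    & forall x, f x != 0 -> Q x].
Proof.
case=> P [/mpoly_nonroot [x0 hx0] hP].
exists (fun x => meval (fun i => x (enum_val i)) P), (fun i => x0 (enum_rank i)).
split=> //; first by exists P.
by move: hx0; congr (_ != 0); apply: meval_eq => i; rewrite enum_valK.
Qed.

(** On the line through the two witnesses both functions restrict to nonzero polynomials, whose
    product has a nonroot. *)
Lemma polyfun_common (f g : (I -> K) -> K) x y : polyfun f -> polyfun g ->
  f x != 0 -> g y != 0 -> exists z, f z != 0 /\ g z != 0.
Proof.
move=> hf hg fx gy.
have [p hp] := polyfun_line x (fun i => y i - x i) hf.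
have [q hq] := polyfun_line x (fun i => y i - x i) hg.
have p0 : p != 0.
  apply: contraNneq fx => p0; have := hp 0; rewrite p0 horner0 => <-.
  by apply/eqP; case: hf => P hP; rewrite !hP; apply: meval_eq => i; rewrite mul0r addr0.
have q0 : q != 0.
  apply: contraNneq gy => q0; have := hq 1; rewrite q0 horner0 => <-.
  by apply/eqP; case: hg => P hP; rewrite !hP; apply: meval_eq => i; rewrite mul1r subrKC.
have [t] := poly_nonroot (mulf_neq0 p0 q0).
rewrite hornerM mulf_eq0 negb_or -hp -hq => /andP [ht1 ht2].
by eexists; split; [exact: ht1 | exact: ht2].
Qed.

Lemma generic_and Q Q' : generically Q -> generically Q' ->
  generically (fun x => Q x /\ Q' x).
Proof.
move=> /generic_polyfun [f [x [hf fx fQ]]] /generic_polyfun [g [y [hg gy gQ]]].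
have [z [fz gz]] := polyfun_common hf hg fx gy.
apply: (generically_polyfun (polyfunM hf hg) (mulf_neq0 fz gz)) => t.
by rewrite mulf_eq0 negb_or => /andP [? ?]; split; [apply: fQ | apply: gQ].
Qed.

Lemma generic_mono Q Q' : (forall x, Q x -> Q' x) ->
  generically Q -> generically Q'.
Proof. by move=> QQ' [P [P0 hP]]; exists P; split=> // x /hP /QQ'. Qed.

Lemma generic_ex Q : generically Q -> exists x, Q x.
Proof. by move=> /generic_polyfun [f [x [_ fx fQ]]]; eexists; apply: fQ fx. Qed.

Lemma generic_all n (Q : 'I_n -> (I -> K) -> Prop) :
  (forall i, generically (Q i)) -> generically (fun x => forall i, Q i x).
Proof.
elim: n Q => [|n IHn] Q hQ.
  apply: (generically_polyfun (polyfun_const _ 1) (x0 := fun _ => 0)); rewrite ?oner_eq0 //.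
  by move=> x _ [].
apply: generic_mono (generic_and (hQ ord0) (IHn _ (fun i => hQ (lift ord0 i)))).
by move=> x [h0 h1] i; case: (unliftP ord0 i) => [j ->|->].
Qed.

End Generic.

(** A witness on I is transported along g and extended by zero outside its image. *)
Lemma generic_pull (I J : finType) (g : I -> J) (Q : (I -> K) -> Prop) :
  injective g -> generically Q -> generically (fun y : J -> K => Q (y \o g)).
Proof.
move=> g_inj /generic_polyfun [f [x [hf fx fQ]]].
pose y j : K := if [pick i | g i == j] is Some i then (x i)%:R else 0.
have hy : y \o g =1 (fun i => (x i)%:R).
  move=> i; rewrite /= /y; case: pickP => [i' /eqP /g_inj -> //|/(_ i)].
  by rewrite eqxx.
apply: (@generically_polyfun J _ (fun y => f (y \o g)) y).
- by apply: (polyfun_comp hf) => i; apply: polyfun_coord.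
- move: fx; congr (_ != 0); case: hf => P hP; rewrite !hP.
  by apply: meval_eq => i; rewrite hy.
- by move=> z; apply: fQ.
Qed.

End PolyFun.

(** * First-order definable sets and the generic dichotomy *)

Section Definable.
Variable K : numClosedFieldType.

Definition definable (I : finType) (Q : (I -> K) -> Prop) : Prop :=
  exists f : GRing.formula K, forall x, GRing.holds (codom x) f <-> Q x.

Section Closure.
Variable I : finType.
Implicit Types Q : (I -> K) -> Prop.

Lemma definable_ext Q Q' : (forall x, Q x <-> Q' x) -> definable Q -> definable Q'.
Proof. by move=> QQ' [f hf]; exists f => x; rewrite hf. Qed.

Lemma nth_codom_rank (x : I -> K) i : (codom x)`_(enum_rank i) = x i.
Proof. by rewrite (nth_map i) -?cardE ?ltn_ord // nth_enum_rank. Qed.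

Lemma term_polyfun (f : (I -> K) -> K) : polyfun f ->
  exists t : GRing.term K, forall x, GRing.eval (codom x) t = f x.
Proof.
case=> P hP.
pose tm (m : multinom #|I|) : GRing.term K :=
  foldr (fun (i : 'I_#|I|) t => GRing.Mul (GRing.Exp (GRing.Var K i) (fun_of_multinom m i)) t)
    (GRing.Const 1) (enum 'I_#|I|).
exists (foldr (fun m t => GRing.Add (GRing.Mul (GRing.Const (mcoeff m P)) (tm m)) t)
    (GRing.Const 0) (msupp P)) => x.
rewrite hP mevalE; elim: (msupp P) => [|m s IHs] /=; first by rewrite big_nil.
rewrite big_cons -IHs; congr (_ * _ + _); rewrite /tm -[RHS]big_enum /=.
elim: (enum 'I_#|I|) => [|i s' IH] /=; first by rewrite big_nil.
rewrite big_cons -IH; congr (_ ^+ _ * _).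
by rewrite -[in LHS](enum_valK i) nth_codom_rank.
Qed.

Lemma definable_eq f g : polyfun f -> polyfun g -> definable (fun x : I -> K => f x = g x).
Proof.
move=> /term_polyfun [t ht] /term_polyfun [u hu].
by exists (GRing.Equal t u) => x /=; rewrite ht hu.
Qed.

Lemma definable_bool (b : bool) : definable (fun _ : I -> K => b).
Proof. by exists (GRing.Bool b). Qed.

Lemma definable_and Q Q' : definable Q -> definable Q' -> definable (fun x => Q x /\ Q' x).
Proof. by move=> [f hf] [g hg]; exists (GRing.And f g) => x /=; rewrite hf hg. Qed.

Lemma definable_or Q Q' : definable Q -> definable Q' -> definable (fun x => Q x \/ Q' x).
Proof. by move=> [f hf] [g hg]; exists (GRing.Or f g) => x /=; rewrite hf hg. Qed.

Lemma definable_imp Q Q' : definable Q -> definable Q' -> definable (fun x => Q x -> Q' x).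
Proof. by move=> [f hf] [g hg]; exists (GRing.Implies f g) => x /=; rewrite hf hg. Qed.

Lemma definable_not Q : definable Q -> definable (fun x => ~ Q x).
Proof. by move=> [f hf]; exists (GRing.Not f) => x /=; rewrite hf. Qed.

Lemma definable_forall (T : finType) (Q : T -> (I -> K) -> Prop) :
  (forall t, definable (Q t)) -> definable (fun x => forall t, Q t x).
Proof.
move=> hQ; apply: definable_ext (_ : definable (fun x => forall t, t \in enum T -> Q t x)).
  by move=> x; split=> h t; [apply: h; rewrite mem_enum|move=> _; apply: h].
elim: (enum T) => [|t s IHs]; first by apply: definable_ext (definable_bool true) => x; split.
apply: definable_ext (definable_and (hQ t) IHs) => x; split.
  by case=> h1 h2 t'; rewrite inE => /orP[/eqP ->|/h2].
by move=> h; split=> [|t' ht']; apply: h; rewrite inE ?eqxx // ht' orbT.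
Qed.

Lemma definable_exists_fin (T : finType) (Q : T -> (I -> K) -> Prop) :
  (forall t, definable (Q t)) -> definable (fun x => exists t, Q t x).
Proof.
move=> hQ; apply: definable_ext (definable_not (definable_forall (fun t => definable_not (hQ t)))).
by move=> x; split=> [/existsNP [t /contrapT ht]|[t ht] h]; [exists t | apply: (h t)].
Qed.

End Closure.

Definition sum_case (I J : Type) (x : I -> K) (y : J -> K) (s : I + J) : K :=
  match s with inl i => x i | inr j => y j end.

Lemma codom_sum (I J : finType) (x : I -> K) (y : J -> K) :
  codom (sum_case x y) = codom x ++ codom y.
Proof. by rewrite !codomE !enumT [in LHS]unlock /= map_cat -!map_comp. Qed.

(** The quantified variables are numbered right after the free ones. This fits [codom_sum], where
    the coordinates from the right summand follow those from the left. *)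
Lemma holds_exists_block (f : GRing.formula K) m (e : seq K) :
  GRing.holds e (foldr (fun i g => GRing.Exists i g) f (iota (size e) m)) <->
  exists y : seq K, size y = m /\ GRing.holds (e ++ y) f.
Proof.
elim: m e => [|m IHm] e /=.
  split=> [he|[y [/size0nil ->]]]; last by rewrite cats0.
  by exists [::]; rewrite cats0.
have h x : set_nth 0 e (size e) x = rcons e x by elim: e => //= a e ->.
split=> [[x]|[[|x y] [sy hy]]] //.
  rewrite h; have := IHm (rcons e x); rewrite size_rcons => -> [y [sy hy]].
  by exists (x :: y); split; rewrite /= ?sy // -cat_rcons.
case: sy => sy; exists x; rewrite h; have := IHm (rcons e x); rewrite size_rcons => ->.
by exists y; rewrite cat_rcons.
Qed.

Lemma definable_exists (I J : finType) (Q : (I -> K) -> (J -> K) -> Prop) :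
  definable (fun z : I + J -> K => Q (z \o inl) (z \o inr)) ->
  definable (fun x => exists y, Q x y).
Proof.
move=> [f hf]; exists (foldr (fun i g => GRing.Exists i g) f (iota #|I| #|J|)) => x.
rewrite -(size_codom x) holds_exists_block; split=> [[y [sy hy]]|[y hy]].
  exists (fun j => y`_(enum_rank j)).
  have /hf : GRing.holds (codom (sum_case x (fun j : J => y`_(enum_rank j)))) f.
    rewrite codom_sum; suff -> : codom (fun j : J => y`_(enum_rank j)) = y by [].
    apply: (@eq_from_nth _ 0); first by rewrite size_codom sy.
    move=> k; rewrite size_codom => hk.
    by rewrite -[k]/(nat_of_ord (Ordinal hk)) -(enum_valK (Ordinal hk)) nth_codom_rank.
  by congr Q.
exists (codom y); split; first by rewrite size_codom.
by rewrite -codom_sum; apply/hf; move: hy; congr Q.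
Qed.

Lemma definable_forall_fun (I J : finType) (Q : (I -> K) -> (J -> K) -> Prop) :
  definable (fun z : I + J -> K => Q (z \o inl) (z \o inr)) ->
  definable (fun x => forall y, Q x y).
Proof.
move=> /definable_not hQ.
have {}hQ := definable_not (definable_exists (Q := fun x y => ~ Q x y) hQ).
apply: definable_ext hQ => x; split=> [h y|h [y hy]]; last by case: hy.
by apply: contrapT => hy; apply: h; exists y.
Qed.

Lemma eval_polyfun (I : finType) (t : GRing.term K) : GRing.rterm t ->
  polyfun (fun x : I -> K => GRing.eval (codom x) t).
Proof.
elim: t => [n|c|n|t IHt u IHu|t IHt|t IHt n|t IHt u IHu|t _|t IHt n] //=.
- move=> _; have [hn|hn] := ltnP n #|I|.
    apply: polyfun_ext (polyfun_coord K (enum_val (Ordinal hn))) => x.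
    by rewrite -[n]/(nat_of_ord (Ordinal hn)) -[in RHS](enum_valK (Ordinal hn)) nth_codom_rank.
  by apply: polyfun_ext (polyfun_const I 0) => x; rewrite nth_default ?size_codom.
- by move=> _; apply: polyfun_const.
- by move=> _; apply: polyfun_const.
- by move=> /andP [/IHt ht /IHu hu]; apply: polyfunD.
- by move=> /IHt; apply: polyfunN.
- move=> /IHt ht; apply: polyfun_ext (polyfunM ht (polyfun_const I n%:R)) => x.
  by rewrite mulr_natr.
- by move=> /andP [/IHt ht /IHu hu]; apply: polyfunM.
- by move=> /IHt; apply: polyfunX.
Qed.

Lemma generic_true (I : finType) (Q : (I -> K) -> Prop) : (forall x, Q x) -> generically Q.
Proof.
move=> hQ; apply: (generically_polyfun (polyfun_const _ 1) (x0 := fun _ => 0)) => //.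
exact: oner_neq0.
Qed.

(* Chevalley's theorem, from quantifier elimination: a definable set contains
   or misses a nonempty Zariski-open set. *)
Lemma definable_dichotomy (I : finType) (Q : (I -> K) -> Prop) : definable Q ->
  generically Q \/ generically (fun x => ~ Q x).
Proof.
case=> f hf; have axK := @GRing.solve_monicpoly K.
pose g := GRing.quantifier_elim (@ClosedFieldQE.ex_elim K) (GRing.to_rform f).
have gP e : reflect (GRing.holds e (GRing.to_rform f)) (GRing.qf_eval e g).
  exact: (GRing.quantifier_elim_rformP (@ClosedFieldQE.wf_ex_elim K)
    (ClosedFieldQE.holds_ex_elim axK) e (GRing.to_rform_rformula f)).
have /andP [qf_g rg] : GRing.qf_form g && GRing.rformula g.
  exact: (GRing.quantifier_elim_wf (@ClosedFieldQE.wf_ex_elim K) (GRing.to_rform_rformula f)).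
have hQ x : Q x <-> GRing.qf_eval (codom x) g.
  by rewrite -hf -GRing.to_rformP; split=> /gP.
suff : generically (fun x : I -> K => GRing.qf_eval (codom x) g : Prop) \/
       generically (fun x : I -> K => ~~ GRing.qf_eval (codom x) g : Prop).
  case=> h; [left|right]; apply: generic_mono h => x; first by rewrite hQ.
  by move=> /negP h /hQ.
(* Without quantifiers only polynomial equations remain as atoms, and such an equation holds
   identically or fails generically; the connectives preserve the dichotomy. *)
elim: g qf_g rg {gP hQ} => [b|t u|t|g IHg h IHh|g IHg h IHh|g IHg h IHh|g IHg|//|//] //=.
- by case: b => _ _; [left|right]; apply: generic_true.
- move=> _ /andP [rt ru].
  have hp := polyfunB (eval_polyfun I rt) (eval_polyfun I ru).
  have [[x hx]|/forallNP h] := pselect (exists x : I -> K,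
    GRing.eval (codom x) t - GRing.eval (codom x) u != 0).
    by right; apply: (generically_polyfun hp hx) => y; rewrite subr_eq0.
  left; apply: generic_true => x; have /negP := h x.
  by rewrite negbK subr_eq0.
- move=> /andP [/IHg {}IHg /IHh {}IHh] /andP [/IHg {}IHg /IHh {}IHh].
  case: IHg => hg; last by right; apply: generic_mono hg => x /negbTE ->.
  case: IHh => hh; last by right; apply: generic_mono hh => x /negbTE ->; rewrite andbF.
  by left; apply: generic_mono (generic_and hg hh) => x [-> ->].
- move=> /andP [/IHg {}IHg /IHh {}IHh] /andP [/IHg {}IHg /IHh {}IHh].
  case: IHg => hg; first by left; apply: generic_mono hg => x ->.
  case: IHh => hh; first by left; apply: generic_mono hh => x ->; rewrite orbT.
  by right; apply: generic_mono (generic_and hg hh) => x [/negbTE -> /negbTE ->].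
- move=> /andP [/IHg {}IHg /IHh {}IHh] /andP [/IHg {}IHg /IHh {}IHh].
  case: IHg => hg; last by left; apply: generic_mono hg => x /negbTE ->.
  case: IHh => hh; first by left; apply: generic_mono hh => x ->; rewrite implybT.
  by right; apply: generic_mono (generic_and hg hh) => x [-> /negbTE ->].
- move=> /IHg {}IHg /IHg [] hg; [right|left] => //.
  by apply: generic_mono hg => x ->.
Qed.

End Definable.

(** * Inner products and direct isometries of 3-space *)

Section Space.
Variable K : numFieldType.
Implicit Types (u v w n : 'rV[K]_3) (A : 'M[K]_3).

Definition i0 : 'I_3 := ord0.
Definition i1 : 'I_3 := lift ord0 ord0.
Definition i2 : 'I_3 := lift ord0 (lift ord0 ord0).

Lemma ord3P (k : 'I_3) : [\/ k = i0, k = i1 | k = i2].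
Proof. by case: k => [[|[|[|]]] h] //; [apply: Or31|apply: Or32|apply: Or33]; apply/val_inj. Qed.

Definition row3 (a b c : K) : 'rV[K]_3 := \row_i [:: a; b; c]`_i.

Lemma row3P v : v = row3 (v 0 i0) (v 0 i1) (v 0 i2).
Proof. by apply/rowP => -[[|[|[|//]]] h]; rewrite !mxE /=; congr (v _ _); apply/val_inj. Qed.

Lemma row3_ind (P : 'rV[K]_3 -> Prop) : (forall a b c, P (row3 a b c)) -> forall v, P v.
Proof. by move=> h v; rewrite (row3P v). Qed.

Lemma row3_eq a b c a' b' c' : a = a' -> b = b' -> c = c' -> row3 a b c = row3 a' b' c'.
Proof. by move=> -> -> ->. Qed.

Lemma row3_inj a b c a' b' c' :
  row3 a b c = row3 a' b' c' -> [/\ a = a', b = b' & c = c'].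
Proof.
move=> h; split; [have := congr1 (fun v => v 0 i0) h|have := congr1 (fun v => v 0 i1) h
  |have := congr1 (fun v => v 0 i2) h]; by rewrite !mxE.
Qed.

Definition dot u v : K := (u *m v^T) 0 0.

Definition cross u v : 'rV[K]_3 :=
  row3 (u 0 i1 * v 0 i2 - u 0 i2 * v 0 i1) (u 0 i2 * v 0 i0 - u 0 i0 * v 0 i2)
       (u 0 i0 * v 0 i1 - u 0 i1 * v 0 i0).

Lemma row3E a b c : (row3 a b c 0 i0 = a) * (row3 a b c 0 i1 = b) * (row3 a b c 0 i2 = c).
Proof. by rewrite !mxE. Qed.

Lemma row3D a b c a' b' c' : row3 a b c + row3 a' b' c' = row3 (a + a') (b + b') (c + c').
Proof. by rewrite [LHS]row3P !mxE. Qed.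

Lemma row3N a b c : - row3 a b c = row3 (- a) (- b) (- c).
Proof. by rewrite [LHS]row3P !mxE. Qed.

Lemma row3Z k a b c : k *: row3 a b c = row3 (k * a) (k * b) (k * c).
Proof. by rewrite [LHS]row3P !mxE. Qed.

Lemma row30 : 0 = row3 0 0 0.
Proof. by rewrite [LHS]row3P !mxE. Qed.

Lemma dot_coord u v : dot u v = u 0 i0 * v 0 i0 + u 0 i1 * v 0 i1 + u 0 i2 * v 0 i2.
Proof. by rewrite /dot mxE !big_ord_recl big_ord0 !mxE addr0 addrA. Qed.

Lemma dot_row3 a b c a' b' c' :
  dot (row3 a b c) (row3 a' b' c') = a * a' + b * b' + c * c'.
Proof. by rewrite dot_coord !row3E. Qed.

Lemma cross_row3 a b c a' b' c' : cross (row3 a b c) (row3 a' b' c') =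
  row3 (b * c' - c * b') (c * a' - a * c') (a * b' - b * a').
Proof. by rewrite /cross !row3E. Qed.

Definition vecE := (row30, row3D, row3N, row3Z, cross_row3, dot_row3).

Lemma sqdistE u v : sqdist u v = dot (u - v) (u - v).
Proof. by rewrite /sqdist dot_coord !big_ord_recl big_ord0 !mxE !expr2 addr0 addrA. Qed.

Lemma dotC u v : dot u v = dot v u.
Proof. by elim/row3_ind: u => a b c; elim/row3_ind: v => a' b' c'; rewrite !vecE; ring. Qed.

Lemma dotDl u v w : dot (u + v) w = dot u w + dot v w.
Proof. by rewrite /dot mulmxDl mxE. Qed.

Lemma dotBl u v w : dot (u - v) w = dot u w - dot v w.
Proof. by rewrite /dot mulmxBl !mxE. Qed.

Lemma dotZl k u w : dot (k *: u) w = k * dot u w.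
Proof. by rewrite /dot -scalemxAl mxE. Qed.

Lemma dotDr u v w : dot w (u + v) = dot w u + dot w v.
Proof. by rewrite !(dotC w) dotDl. Qed.

Lemma dotBr u v w : dot w (u - v) = dot w u - dot w v.
Proof. by rewrite !(dotC w) dotBl. Qed.

Lemma dotZr k u w : dot w (k *: u) = k * dot w u.
Proof. by rewrite !(dotC w) dotZl. Qed.

Lemma dot_orthogonal A u v : A *m A^T = 1%:M -> dot (u *m A) (v *m A) = dot u v.
Proof. by move=> hA; rewrite /dot trmx_mul mulmxA -(mulmxA u) hA mulmx1. Qed.

(** Over the complex numbers there are isotropic vectors, so a nonzero Gram determinant, rather than
    linear independence, is the useful nondegeneracy of a pair. *)
Definition gram u v := dot u u * dot v v - dot u v ^+ 2.

Lemma dot_cross u v : dot (cross u v) (cross u v) = gram u v.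
Proof. by rewrite /gram; elim/row3_ind: u => a b c; elim/row3_ind: v => a' b' c'; rewrite !vecE; ring. Qed.

Definition mat3 u v w : 'M[K]_3 := \matrix_(i, j) (nth 0 [:: u; v; w] i) 0 j.

Lemma row_mat3 u v w : (row i0 (mat3 u v w) = u) * (row i1 (mat3 u v w) = v)
  * (row i2 (mat3 u v w) = w).
Proof. by do !split; apply/rowP => j; rewrite !mxE. Qed.

Lemma mat3_mul u v w A : mat3 u v w *m A = mat3 (u *m A) (v *m A) (w *m A).
Proof.
apply/row_matrixP => i; rewrite row_mul.
by case: i => [[|[|[|//]]] h]; [rewrite (_ : Ordinal h = i0)|rewrite (_ : Ordinal h = i1)
 |rewrite (_ : Ordinal h = i2)]; rewrite ?row_mat3 //; apply/val_inj.
Qed.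

Lemma mat3_mul_tr u v w u' v' w' i j : (mat3 u v w *m (mat3 u' v' w')^T) i j =
  dot (nth 0 [:: u; v; w] i) (nth 0 [:: u'; v'; w'] j).
Proof. by rewrite /dot !mxE; apply: eq_bigr => k _; rewrite !mxE. Qed.

Lemma det_mat3 u v w : \det (mat3 u v w) = dot u (cross v w).
Proof.
rewrite (expand_det_row _ ord0) !big_ord_recl big_ord0 /cofactor.
rewrite !(expand_det_row _ ord0) !big_ord_recl !big_ord0 /cofactor !det_mx11 !mxE /=.
elim/row3_ind: u => a b c; elim/row3_ind: v => a' b' c'; elim/row3_ind: w => a'' b'' c''.
rewrite !vecE !mxE /= /bump /=.
rewrite !expr0 !expr1 !(expr2 (-1)) ?addn0 ?add0n.
by ring.
Qed.

Lemma det_cross u v : \det (mat3 u v (cross u v)) = gram u v.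
Proof.
rewrite det_mat3 -dot_cross.
elim/row3_ind: u => a b c; elim/row3_ind: v => a' b' c'; rewrite !vecE; ring.
Qed.

Lemma dot_crossl u v : dot u (cross u v) = 0.
Proof. elim/row3_ind: u => a b c; elim/row3_ind: v => a' b' c'; rewrite !vecE; ring. Qed.

Lemma dot_crossr u v : dot v (cross u v) = 0.
Proof. elim/row3_ind: u => a b c; elim/row3_ind: v => a' b' c'; rewrite !vecE; ring. Qed.

(** The vector [gram u v *: w] has a polynomial expansion in u, v and [cross u v]; orthogonality
    kills the first two terms. *)
Lemma perp_cross u v w : dot w u = 0 -> dot w v = 0 -> gram u v != 0 ->
  w = (dot w (cross u v) / gram u v) *: cross u v.
Proof.
move=> hu hv g0.
have : gram u v *: w = dot w (cross u v) *: cross u v.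
  have -> : gram u v *: w = dot w (cross u v) *: cross u v
     + (dot v v * dot w u - dot u v * dot w v) *: u
     + (dot u u * dot w v - dot u v * dot w u) *: v.
    rewrite /gram; elim/row3_ind: u {hu g0} => a b c; elim/row3_ind: v {hv} => a' b' c'.
    elim/row3_ind: w => a'' b'' c''; rewrite !vecE; apply: row3_eq; ring.
  by rewrite hu hv !mulr0 !subr0 !scale0r !addr0.
by move=> /(congr1 (fun x => (gram u v)^-1 *: x)); rewrite !scalerA mulVf // scale1r mulrC.
Qed.

(** The frames u, v, u x v and u', v', u' x v' have equal Gram matrices and equal nonzero
    determinants, so the change of frame is orthogonal of determinant 1. *)
Lemma orthogonal_transport u v u' v' :
  dot u u = dot u' u' -> dot v v = dot v' v' -> dot u v = dot u' v' ->
  gram u v != 0 ->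
  exists A : 'M[K]_3, [/\ A *m A^T = 1%:M, \det A = 1, u *m A = u' & v *m A = v'].
Proof.
move=> huu hvv huv g0.
have g' : gram u' v' = gram u v by rewrite /gram huu hvv huv.
pose M := mat3 u v (cross u v); pose M' := mat3 u' v' (cross u' v').
have uM : M \in unitmx by rewrite unitmxE unitfE det_cross.
have MM : M' *m M'^T = M *m M^T.
  apply/matrixP => i j; rewrite !mat3_mul_tr.
  have hvu : dot v u = dot v' u' by rewrite dotC huv dotC.
  have z (x y : 'rV[K]_3) : dot (cross x y) x = 0 by rewrite dotC dot_crossl.
  have z' (x y : 'rV[K]_3) : dot (cross x y) y = 0 by rewrite dotC dot_crossr.
  case: i => [[|[|[|//]]] hi]; case: j => [[|[|[|//]]] hj] /=;
    rewrite ?dot_cross ?dot_crossl ?dot_crossr ?z ?z' ?g' ?huu ?hvv ?huv ?hvu //.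
have MA : M *m (invmx M *m M') = M' by rewrite mulKVmx.
exists (invmx M *m M'); split.
- rewrite trmx_mul mulmxA -(mulmxA _ M') MM mulmxA mulVmx // mul1mx.
  by rewrite trmx_inv mulmxV // unitmx_tr.
- by rewrite det_mulmx det_inv !det_cross g' mulVf.
- by move: MA; rewrite mat3_mul => /(congr1 (row i0)); rewrite !row_mat3.
- by move: MA; rewrite mat3_mul => /(congr1 (row i1)); rewrite !row_mat3.
Qed.

(** The image of the normal is again orthogonal to u and v, hence a multiple of it; the determinant
    forces the factor 1. *)
Lemma orthogonal_fix u v A : A *m A^T = 1%:M -> \det A = 1 ->
  u *m A = u -> v *m A = v -> gram u v != 0 -> A = 1%:M.
Proof.
move=> hA dA hu hv g0; set n := cross u v.
have uM : mat3 u v n \in unitmx by rewrite unitmxE unitfE det_cross.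
have nu : dot (n *m A) u = 0 by rewrite -{1}hu dot_orthogonal // dotC dot_crossl.
have nv : dot (n *m A) v = 0 by rewrite -{1}hv dot_orthogonal // dotC dot_crossr.
have nA := perp_cross nu nv g0; move: nA; set k := _ / _ => nA.
have : \det (mat3 u v n *m A) = k * \det (mat3 u v n).
  by rewrite mat3_mul hu hv nA !det_mat3; elim/row3_ind: u @n {hu g0 uM nu nA} k hv nv => a b c;
   elim/row3_ind: v => a' b' c' n k _ _; rewrite /n !vecE; ring.
rewrite det_mulmx dA mulr1 det_cross => /eqP; rewrite -{1}[gram u v]mul1r.
rewrite (inj_eq (mulIf g0)) => /eqP k1.
move: nA; rewrite -k1 scale1r => nA.
have : mat3 u v n *m A = mat3 u v n by rewrite mat3_mul hu hv nA.
by move=> /(congr1 (mulmx (invmx (mat3 u v n)))); rewrite mulKmx // mulVmx.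
Qed.

(* Three prescribed inner products leave two choices, mirror images in the
   plane of [u] and [v]. *)
Lemma three_spheres u v w1 w2 w3 : gram u v != 0 ->
  [/\ dot w2 u = dot w1 u, dot w2 v = dot w1 v & dot w2 w2 = dot w1 w1] ->
  [/\ dot w3 u = dot w1 u, dot w3 v = dot w1 v & dot w3 w3 = dot w1 w1] ->
  [\/ w1 = w2, w1 = w3 | w2 = w3].
Proof.
move=> g0 [h2u h2v h2] [h3u h3v h3]; set n := cross u v.
have key w : dot w u = dot w1 u -> dot w v = dot w1 v -> dot w w = dot w1 w1 ->
    w = w1 \/ w = w1 + (- (2 * dot w1 n) / gram u v) *: n.
  move=> hu hv hw.
  have := @perp_cross u v (w - w1); rewrite !dotBl hu hv !subrr => /(_ erefl erefl g0).
  set k := _ / _; clearbody k => hk.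
  have wE : w = w1 + k *: n by rewrite -hk addrC subrK.
  move: hw; rewrite wE !(dotDl, dotDr, dotZl, dotZr) (dotC n w1) dot_cross => hw.
  have : k * (2 * dot w1 n + k * gram u v) = 0.
    move: hw => /eqP; rewrite -subr_eq0 => /eqP hw; rewrite -[RHS]hw; ring.
  move=> /eqP; rewrite mulf_eq0 => /orP[/eqP ->|/eqP h]; first by left; rewrite scale0r addr0.
  right; congr (_ + _ *: _); apply: (mulIf g0); rewrite divfK //.
  by apply/eqP; rewrite -addr_eq0 addrC h.
case: (key w2 h2u h2v h2) => e2; first by apply: Or31.
case: (key w3 h3u h3v h3) => e3; first by apply: Or32.
by apply: Or33; rewrite e2 e3.
Qed.

Lemma polarization (a b c : 'rV[K]_3) :
  dot (a - c) (b - c) = (sqdist a c + sqdist b c - sqdist a b) / 2%:R.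
Proof.
rewrite !sqdistE; elim/row3_ind: a => x y z; elim/row3_ind: b => x' y' z'.
elim/row3_ind: c => x'' y'' z''; rewrite !vecE; apply: (mulIf (_ : 2%:R != 0 :> K)); rewrite ?divfK ?pnatr_eq0 //; ring.
Qed.

Lemma sqdistC u v : sqdist u v = sqdist v u.
Proof. by apply: eq_bigr => i _; rewrite -sqrrN opprB. Qed.

Section Congruence.
Variable V : finType.
Implicit Types rho : V -> 'rV[K]_3.

Lemma directly_congruent_refl rho : directly_congruent rho rho.
Proof. by exists 1%:M, 0; split=> [||v]; rewrite ?trmx1 ?mulmx1 ?det1 ?addr0. Qed.

Lemma directly_congruent_sym rho rho' :
  directly_congruent rho rho' -> directly_congruent rho' rho.
Proof.
case=> A [t [hA dA h]]; have hA' := mulmx1C hA.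
exists A^T, (- t *m A^T); split; rewrite ?trmxK ?det_tr //.
by move=> v; rewrite h mulmxDl -mulmxA hA mulmx1 mulNmx addrK.
Qed.

Lemma directly_congruent_trans rho rho' rho'' : directly_congruent rho rho' ->
  directly_congruent rho' rho'' -> directly_congruent rho rho''.
Proof.
case=> A [t [hA dA h]] [B [s [hB dB h']]].
exists (A *m B), (t *m B + s); split.
- by rewrite trmx_mul mulmxA -(mulmxA A) hB mulmx1.
- by rewrite det_mulmx dA dB mulr1.
- by move=> v; rewrite h' h mulmxDl mulmxA addrA.
Qed.

Lemma directly_congruent_sqdist rho rho' (u v : V) : directly_congruent rho rho' ->
  sqdist (rho' u) (rho' v) = sqdist (rho u) (rho v).
Proof.
case=> A [t [hA _ h]]; rewrite !sqdistE !h opprD addrACA subrr addr0 -mulmxBl.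
exact: dot_orthogonal.
Qed.

Lemma directly_congruent_pull (W : finType) (f : W -> V) rho rho' :
  directly_congruent rho rho' -> directly_congruent (rho \o f) (rho' \o f).
Proof. by case=> A [t [hA dA h]]; exists A, t; split=> // w; apply: h. Qed.

End Congruence.

End Space.

(** * Definability of direct congruence *)

Section DefinableGeometry.
Variables (K : numClosedFieldType) (V I : finType).
Implicit Types X Y : V * 'I_3 -> (I -> K) -> K.

Lemma polyfun_sqdist X u v : (forall c, polyfun (X c)) ->
  polyfun (fun x => sqdist (realization_of (X^~ x) u) (realization_of (X^~ x) v)).
Proof.
move=> hX; apply: polyfun_ext (_ : polyfun (fun x => \sum_(i < 3) (X (u, i) x - X (v, i) x) ^+ 2)).
  by move=> x; apply: eq_bigr => i _; rewrite !mxE.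
by apply: polyfun_sum => i; apply: polyfunX; apply: polyfunB.
Qed.

Definition isometry_matrix (z : 'I_3 * 'I_3 + 'I_3 -> K) : 'M[K]_3 :=
  \matrix_(i, j) z (inl (i, j)).
Definition isometry_shift (z : 'I_3 * 'I_3 + 'I_3 -> K) : 'rV[K]_3 :=
  \row_j z (inr j).

(** Congruence asks for twelve field elements, the entries of the matrix and of the translation,
    subject to polynomial equations. *)
Lemma definable_directly_congruent X Y :
  (forall c, polyfun (X c)) -> (forall c, polyfun (Y c)) ->
  definable (fun x => directly_congruent (realization_of (X^~ x)) (realization_of (Y^~ x))).
Proof.
move=> hX hY.
pose B (x : I -> K) (z : 'I_3 * 'I_3 + 'I_3 -> K) :=
  [/\ forall i j, \sum_k z (inl (i, k)) * z (inl (j, k)) = (i == j)%:R,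
      \det (isometry_matrix z) = 1
    & forall vc, Y vc x = \sum_k X (vc.1, k) x * z (inl (k, vc.2)) + z (inr vc.2)].
apply: definable_ext (_ : definable (fun x => exists z, B x z)).
  move=> x; split=> [[z [h1 h2 h3]]|[A [t [h1 h2 h3]]]].
    exists (isometry_matrix z), (isometry_shift z); split => //.
      apply/matrixP => i j; rewrite !mxE -h1.
      by apply: eq_bigr => k _; rewrite !mxE.
    move=> v; apply/rowP => c; rewrite !mxE h3 /=; congr (_ + _).
    by apply: eq_bigr => k _; rewrite !mxE.
  exists (fun s => match s with inl ij => A ij.1 ij.2 | inr j => t 0 j end); split.
  - move=> i j; have := congr1 (fun M : 'M[K]_3 => M i j) h1; rewrite !mxE => <-.
    by apply: eq_bigr => k _; rewrite !mxE.
  - by rewrite -[RHS]h2; congr (\det _); apply/matrixP => i j; rewrite !mxE.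
  - case=> v c; have := congr1 (fun r : 'rV[K]_3 => r 0 c) (h3 v); rewrite !mxE => -> /=.
    by congr (_ + _); apply: eq_bigr => k _; rewrite !mxE.
apply: definable_exists; rewrite /B.
have pz s : polyfun (fun z : I + ('I_3 * 'I_3 + 'I_3) -> K => z (inr s)).
  exact: polyfun_coord.
have px (f : (I -> K) -> K) : polyfun f ->
    polyfun (fun z : I + ('I_3 * 'I_3 + 'I_3) -> K => f (z \o inl)).
  by move=> hf; apply: (polyfun_comp (F := fun i z => z (inl i)) hf) => i; apply: polyfun_coord.
apply: definable_ext (_ : definable (fun z : I + ('I_3 * 'I_3 + 'I_3) -> K =>
    (forall i j, \sum_k z (inr (inl (i, k))) * z (inr (inl (j, k))) = (i == j)%:R) /\
    (\det (isometry_matrix (z \o inr)) = 1 /\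
     forall vc, Y vc (z \o inl) =
       \sum_k X (vc.1, k) (z \o inl) * z (inr (inl (k, vc.2))) + z (inr (inr vc.2))))).
  by move=> z; split=> [[? [? ?]]|[? ? ?]].
apply: definable_and; first do 2!apply: definable_forall => ?.
  apply: definable_eq; last exact: polyfun_const.
  by apply: polyfun_sum => k; apply: polyfunM.
apply: definable_and.
  apply: definable_eq; last exact: polyfun_const.
  apply: polyfun_det => i j; apply: polyfun_ext (pz (inl (i, j))) => z.
  by rewrite !mxE.
apply: definable_forall => vc; apply: definable_eq; first exact: px.
apply: polyfunD => //; apply: polyfun_sum => k; apply: polyfunM => //.
exact: px.
Qed.

End DefinableGeometry.

(** * The generic number of realizations *)

Section Lambda.
Variables (R : realType) (V : finType) (E : {set {set V}}).

(** Only an upper bound: representatives may repeat or be incompatible. This makes the bound easy to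
    multiply under gluing. *)
Definition covers (N : nat) : Prop :=
  generically (fun l : edge E -> R[i] =>
    exists rep : 'I_N -> V -> 'rV[R[i]]_3, forall rho, compatible l rho ->
      exists i, directly_congruent (rep i) rho).

Lemma realization_of_coords (rho : V -> 'rV[R[i]]_3) :
  realization_of (fun vc => rho vc.1 0 vc.2) = rho.
Proof. by apply/funext => v; apply/rowP => c; rewrite mxE. Qed.

Lemma definable_compatible (I : finType) (L : edge E -> (I -> R[i]) -> R[i])
    (X : V * 'I_3 -> (I -> R[i]) -> R[i]) :
  (forall e, polyfun (L e)) -> (forall c, polyfun (X c)) ->
  definable (fun x => compatible (L^~ x) (realization_of (X^~ x))).
Proof.
move=> hL hX; apply: definable_forall => e; apply: definable_forall => u.
apply: definable_forall => v.
have h := definable_imp (definable_bool _ I (val e == [set u; v]))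
  (definable_eq (polyfun_sqdist u v hX) (hL e)).
by apply: definable_ext h => x; split=> h /eqP; apply: h.
Qed.

(** For fixed k the representatives are finitely many unknowns, so exactness of the count is a
    formula with quantifiers over field elements. *)
Lemma definable_realization_count k :
  definable (fun l : edge E -> R[i] => realization_count l k).
Proof.
pose J := ('I_k * (V * 'I_3))%type.
pose B (l : edge E -> R[i]) (z : J -> R[i]) :=
  (forall i, compatible l (realization_of (fun vc => z (i, vc)))) /\
  ((forall i j, directly_congruent (realization_of (fun vc => z (i, vc)))
     (realization_of (fun vc => z (j, vc))) -> i == j) /\
  forall y : V * 'I_3 -> R[i], compatible l (realization_of y) ->
   exists i, directly_congruent (realization_of (fun vc => z (i, vc))) (realization_of y)).
apply: definable_ext (_ : definable (fun l => exists z, B l z)).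
  move=> l; split=> [[z [h1 [h2 h3]]]|[rep [h1 h2 h3]]].
    exists (fun i => realization_of (fun vc => z (i, vc))); split => //.
      by move=> i j /h2 /eqP.
    by move=> rho; rewrite -[rho]realization_of_coords; apply: h3.
  exists (fun ivc => rep ivc.1 ivc.2.1 0 ivc.2.2).
  have rE i : realization_of (fun vc => rep i vc.1 0 vc.2) = rep i.
    exact: realization_of_coords.
  split=> [i|/=]; first by rewrite /= rE.
  split=> [i j|y /h3 [i hi]]; first by rewrite !rE => /h2 ->.
  by exists i; rewrite rE.
have pcoord (I J' : finType) (i : I) (g : I -> J') :
    polyfun (fun z : J' -> R[i] => z (g i)) by apply: polyfun_coord.
apply: definable_exists; rewrite /B.
apply: definable_and.
  by apply: definable_forall => i; apply: definable_compatible => s; apply: polyfun_coord.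
apply: definable_and.
  do 2!apply: definable_forall => ?; apply: definable_imp; last exact: definable_bool.
  by apply: definable_directly_congruent => c; apply: polyfun_coord.
apply: definable_forall_fun; apply: definable_imp.
  by apply: definable_compatible => s; apply: polyfun_coord.
apply: definable_exists_fin => i.
by apply: definable_directly_congruent => c; apply: polyfun_coord.
Qed.

(** In a smallest covering family each member is needed: some compatible realization is congruent to
    it alone. These realizations are pairwise incongruent and represent all classes. *)
Lemma count_of_cover (l : edge E -> R[i]) N (rep : 'I_N -> V -> 'rV[R[i]]_3) :
  (forall rho, compatible l rho -> exists i, directly_congruent (rep i) rho) ->
  exists2 k, (k <= N)%N & realization_count l k.
Proof.
pose cov n := exists rep : 'I_n -> V -> 'rV[R[i]]_3,
  forall rho, compatible l rho -> exists i, directly_congruent (rep i) rho.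
move=> hrep; have covN : exists n, `[< cov n >] by exists N; apply/asboolP; exists rep.
have kN : (ex_minn covN <= N)%N.
  by case: ex_minnP => k _; apply; apply/asboolP; exists rep.
exists (ex_minn covN) => //; case: ex_minnP => {kN} k /asboolP [r hr] kmin.
have needed (j : 'I_k) : exists rho, [/\ compatible l rho, directly_congruent (r j) rho
    & forall i, directly_congruent (r i) rho -> i = j].
  apply: contrapT => hj; case: k r hr kmin j hj => [|k] r hr kmin j hj; first by case: j {hj}.
  suff /asboolP /kmin : cov k by rewrite ltnn.
  exists (fun i => r (lift j i)) => rho hrho; have [i hi] := hr _ hrho.
  apply: contrapT => hn; case: hj; exists rho.
  have onlyj i' : directly_congruent (r i') rho -> i' = j.
    by case: (unliftP j i') => [t ->|-> //] ht; case: hn; exists t.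
  by split=> //; rewrite -(onlyj _ hi).
have [s hs] := choice needed; exists s; split.
- by move=> i; have [] := hs i.
- move=> i j hij; have [_ hi _] := hs i; have [_ _ h] := hs j.
  by apply: h; apply: directly_congruent_trans hij.
- move=> rho /hr [i hi]; exists i; have [_ h _] := hs i.
  by apply: directly_congruent_trans hi; apply: directly_congruent_sym.
Qed.

(** If no k up to N were the generic count, each would fail generically by the dichotomy; at a
    common generic point the covering family still gives some count at most N. *)
Lemma lambda3_of_covers N : covers N -> exists2 k, (k <= N)%N & is_lambda3 R E k.
Proof.
move=> hN; apply: contrapT => hn.
have none (k : 'I_N.+1) : generically (fun l : edge E -> R[i] => ~ realization_count l k).
  case: (definable_dichotomy (definable_realization_count k)) => // hk.
  by case: hn; exists (nat_of_ord k) => //; rewrite -ltnS.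
have [l [[rep hrep] hl]] := generic_ex (generic_and hN (generic_all none)).
have [k kN hk] := count_of_cover hrep.
by apply: (hl (Ordinal (_ : (k < N.+1)%N))) hk; rewrite ltnS.
Qed.

End Lambda.

(** * Small quadratic perturbations of the identity *)

Section Complete.
Import mathcomp_extra classical_sets functions interval_inference topology normedtype sequences.
Import numFieldNormedType.Exports.

HB.instance Definition _ (R : realType) (m : nat) := Complete.copy 'rV[R]_m 'rV[R]_m.

Section QuadraticFixpoint.
Local Open Scope classical_set_scope.
Local Open Scope ring_scope.
Variables (R : realType) (m : nat).

Lemma entry_le_norm (y : 'rV[R]_m) i : `|y 0 i| <= `|y|.
Proof. by rewrite /Num.norm /= mx_normrE; apply: (le_bigmax _ _ (0, i)). Qed.

Lemma norm_le_entries (y : 'rV[R]_m) r : 0 <= r -> (forall i, `|y 0 i| <= r) -> `|y| <= r.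
Proof.
move=> r0 h; rewrite /Num.norm /= mx_normrE; apply: bigmax_le => // -[i j] _ /=.
by rewrite ord1.
Qed.

Variable c : 'I_m -> 'I_m -> 'I_m -> R.

Definition quadratic_map (y : 'rV[R]_m) : 'rV[R]_m :=
  \row_e \sum_a \sum_b c e a b * (y 0 a * y 0 b).

Let C := \sum_e \sum_a \sum_b `|c e a b|.

(** The Lipschitz constant of a quadratic map on a ball is proportional to the radius, so small
    balls give contractions. *)
Lemma quadratic_map_lipschitz y z r : `|y| <= r -> `|z| <= r ->
  `|quadratic_map y - quadratic_map z| <= C * (2 * r) * `|y - z|.
Proof.
move=> yr zr; have r0 : 0 <= r by apply: le_trans yr.
have C0 e : \sum_a \sum_b `|c e a b| <= C.
  rewrite [leRHS](bigD1 e) //= lerDl sumr_ge0 // => i _.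
  by do 2!rewrite sumr_ge0 // => ? _.
have hC : 0 <= C by do 3!rewrite sumr_ge0 // => ? _.
apply: norm_le_entries => [|e]; first by rewrite !mulr_ge0.
rewrite !mxE; apply: (@le_trans _ _ ((\sum_a \sum_b `|c e a b|) * (2 * r) * `|y - z|)); last first.
  by rewrite ler_wpM2r // ler_wpM2r // mulr_ge0.
rewrite -sumrB; apply: (le_trans (ler_norm_sum _ _ _)).
rewrite !mulr_suml; apply: ler_sum => a _.
rewrite -sumrB; apply: (le_trans (ler_norm_sum _ _ _)).
rewrite !mulr_suml; apply: ler_sum => b _.
rewrite -mulrBr normrM -mulrA ler_wpM2l //.
have -> : y 0 a * y 0 b - z 0 a * z 0 b =
    y 0 a * (y 0 b - z 0 b) + (y 0 a - z 0 a) * z 0 b by rewrite mulrBr mulrBl addrA subrK.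
have hd i : `|y 0 i - z 0 i| <= `|y - z| by have := entry_le_norm (y - z) i; rewrite !mxE.
apply: (le_trans (ler_normD _ _)); rewrite !normrM mulrDl mul1r mulrDl.
rewrite [X in _ + X]mulrC; apply: lerD; apply: ler_pM => //.
  exact: le_trans (entry_le_norm _ _) yr.
exact: le_trans (entry_le_norm _ _) zr.
Qed.

Lemma quadratic_fixpoint r : 0 < r -> exists2 d, 0 < d &
  forall w : 'rV[R]_m, `|w| <= d -> exists2 y, `|y| <= r & y = w - quadratic_map y.
Proof.
move=> r0; have hC : 0 <= C by do 3!rewrite sumr_ge0 // => ? _.
(* With this radius the Lipschitz constant 2Cs is at most 1/2, and the map sends the ball to itself
   as soon as w has norm at most s/2. *)
pose s := Num.min r (4 * C + 1)^-1.
have C1 : 0 < 4 * C + 1 by rewrite ltr_wpDl // mulr_ge0.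
have s0 : 0 < s by rewrite lt_min r0 invr_gt0.
have sr : s <= r by rewrite ge_min lexx.
have Cs : C * (2 * s) <= 2^-1.
  have : s <= (4 * C + 1)^-1 by rewrite ge_min lexx orbT.
  rewrite -(ler_pM2l C1) divff ?gt_eqF // mulrDl mul1r => h.
  have := ltW s0; lra.
exists (s / 2); first by rewrite divr_gt0.
move=> w hw; pose U : set 'rV[R]_m := [set y | `|y| <= s].
pose f y := w - quadratic_map y.
have q0 : quadratic_map 0 = 0.
  apply/rowP => e; rewrite !mxE big1 // => a _; rewrite big1 // => b _.
  by rewrite !mxE mul0r mulr0.
have fU : set_fun U U f.
  move=> y /= hy; apply: (le_trans (ler_normB _ _)).
  rewrite -[quadratic_map y]subr0 -q0 [leRHS](splitr s); apply: lerD => //.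
  have := @quadratic_map_lipschitz y 0 s hy; rewrite normr0 subr0 => /(_ (ltW s0)) h.
  apply: (le_trans h); rewrite [s / 2]mulrC.
  by apply: ler_pM => //; rewrite !mulr_ge0 // ltW.
pose F : {fun U >-> U} := HB.pack f (@isFun.Build _ _ U U f fU).
have ctr : is_contraction F.
  exists (2^-1)%:nng; split; first by rewrite /= invf_lt1 // ltr1n.
  move=> [y z] /= [hy hz]; rewrite /f opprB addrC addrA subrK distrC.
  by apply: (le_trans (quadratic_map_lipschitz hy hz)); rewrite ler_wpM2r.
have clU : closed U.
  rewrite (_ : U = closed_ball_ Num.norm (0 : 'rV[R]_m) s); first exact: closed_closed_ball_.
  by apply/funext => y; rewrite /U /closed_ball_ /= sub0r normrN.
have [|y hy yf] := banach_fixed_point ctr clU.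
  by exists 0; rewrite /U /= normr0 ltW.
by exists y => //; apply: le_trans sr.
Qed.

End QuadraticFixpoint.

End Complete.

(** * Independence, real frameworks and minimal rigidity *)

Section Rigid.
Local Open Scope complex_scope.

Section Independence.
Variables (K : numFieldType) (V : finType) (E : {set {set V}}).

(** Independence of the rows of the rigidity matrix, stated as surjectivity: up to a factor 2, any
    rates of change of the squared lengths are attained by some velocities. *)
Definition rigidity_onto (p : V -> 'rV[K]_3) : Prop :=
  forall w : edge E -> K, exists v : V -> 'rV[K]_3, forall (e : edge E) x y,
    val e = [set x; y] -> dot (p x - p y) (v x - v y) = w e.

Definition independent : Prop :=
  generically (fun x : V * 'I_3 -> K => rigidity_onto (realization_of x)).

End Independence.

Lemma set2_eq (V : finType) (x y u v : V) : [set x; y] = [set u; v] ->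
  (x = u /\ y = v) \/ (x = v /\ y = u).
Proof.
move=> e; have := set21 x y; have := set22 x y; rewrite e !inE.
have := set21 u v; have := set22 u v; rewrite -e !inE.
do 4![case/orP => /eqP ?]; subst; auto.
Qed.

Section Real.
Variables (R : realType) (V : finType) (E : {set {set V}}).
Hypothesis simpleE : simple_graph E.

Lemma edge_ends : exists ends : edge E -> V * V, forall e : edge E,
  val e = [set (ends e).1; (ends e).2].
Proof.
suff /choice [f hf] : forall e : edge E, exists xy : V * V, val e = [set xy.1; xy.2].
  by exists f.
move=> e; have /eqP/cards2P [x [y [_ exy]]] := simpleE (valP e).
by exists (x, y).
Qed.

(** Displacing p by a combination, with coefficients y, of velocities dual to the edges changes the
    squared length of e by 2 (y_e + Q(y)_e) with Q quadratic. Prescribing the change is the fixed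
    point equation y = w/2 - Q(y). *)
Lemma realize_lengths (p : V -> 'rV[R]_3) : rigidity_onto E p ->
  forall eps : R, 0 < eps -> exists2 d : R, 0 < d &
  forall w : edge E -> R, (forall e, `|w e| <= d) ->
  exists q : V -> 'rV[R]_3, (forall v, sqdist (p v) (q v) < eps) /\
    forall (e : edge E) x y, val e = [set x; y] ->
      sqdist (q x) (q y) = sqdist (p x) (p y) + w e.
Proof.
move=> surj eps eps0; have [ends hends] := edge_ends.
pose m := #|edge E|.
have /choice [vv hvv] : forall a : 'I_m, exists v : V -> 'rV[R]_3, forall (e : edge E) x y,
    val e = [set x; y] -> dot (p x - p y) (v x - v y) = (e == enum_val a)%:R.
  by move=> a; apply: (surj (fun e => (e == enum_val a)%:R)).
pose dd (e : edge E) a := vv a (ends e).1 - vv a (ends e).2.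
pose c (i a b : 'I_m) := 2^-1 * dot (dd (enum_val i) a) (dd (enum_val i) b).
pose M : R := \sum_a \sum_v \sum_i `|vv a v 0 i|.
have M0 : 0 <= M by do 3!rewrite sumr_ge0 // => ? _.
(* Each coordinate of the displacement is at most rM, so its squared length is at most 3 r M^2
   because r is at most 1, hence below eps. *)
pose r := Num.min 1 (eps / (3 * M ^+ 2 + 1)).
have M1 : 0 < 3 * M ^+ 2 + 1 by rewrite ltr_wpDl // mulr_ge0 // sqr_ge0.
have r0 : 0 < r by rewrite lt_min ltr01 divr_gt0.
have r1 : r <= 1 by rewrite ge_min lexx.
have rM : r * (3 * M ^+ 2 + 1) <= eps by rewrite -ler_pdivlMr // ge_min lexx orbT.
have [d d0 hd] := quadratic_fixpoint c r0.
exists (2 * d); first by rewrite mulr_gt0.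
move=> w hw; pose w' : 'rV[R]_m := \row_i (w (enum_val i) / 2).
have [|y yr yE] := hd w'.
  apply: norm_le_entries => [|i]; first exact: ltW.
  by rewrite mxE normrM [`|2^-1|]ger0_norm ?invr_ge0 // ler_pdivrMr // mulrC.
pose h v := \sum_a y 0 a *: vv a v.
exists (fun v => p v + h v); split.
  move=> v; rewrite sqdistE opprD addrA subrr sub0r dot_coord !mxE !mulrNN.
  have hc (i : 'I_3) : `|h v 0 i| <= r * M.
    rewrite /h summxE; apply: (le_trans (ler_norm_sum _ _ _)).
    rewrite mulr_sumr; apply: ler_sum => a _; rewrite mxE normrM.
    apply: ler_pM => //; first exact: le_trans (entry_le_norm _ _) yr.
    rewrite (bigD1 v) //= (bigD1 i) //= -addrA lerDl addr_ge0 // sumr_ge0 // => ? _.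
    by rewrite sumr_ge0.
  have hc2 (i : 'I_3) : h v 0 i * h v 0 i <= r * M ^+ 2.
    apply: (le_trans (ler_norm _)); rewrite normrM.
    apply: (@le_trans _ _ ((r * M) * (r * M))); first by apply: ler_pM.
    rewrite mulrACA -expr2 -expr2 ler_wpM2r ?sqr_ge0 //.
    by rewrite expr2 ler_piMr // ltW.
  have := hc2 i0; have := hc2 i1; have := hc2 i2; lra.
move=> e x z exz; rewrite !sqdistE /= opprD addrACA.
have hx : h x - h z = \sum_a y 0 a *: (vv a x - vv a z).
  by rewrite /h -sumrB; apply: eq_bigr => a _; rewrite scalerBr.
have sum_dot (u : 'rV[R]_3) (F : 'I_m -> 'rV[R]_3) : dot u (\sum_a F a) = \sum_a dot u (F a).
  rewrite /dot linear_sum mulmx_sumr summxE; by apply: eq_bigr => a _.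
pose ie := enum_rank e.
have h1 : dot (p x - p z) (h x - h z) = y 0 ie.
  rewrite hx sum_dot (bigD1 ie) //= big1 => [|a aie].
    by rewrite dotZr (hvv _ _ _ _ exz) enum_rankK eqxx mulr1 addr0.
  rewrite dotZr (hvv _ _ _ _ exz); case: eqP => [eE|]; last by rewrite mulr0.
  by rewrite /ie eE enum_valK eqxx in aie.
have h2 : dot (h x - h z) (h x - h z) = 2 * quadratic_map c y 0 ie.
  rewrite mxE mulr_sumr {1}hx dotC sum_dot; apply: eq_bigr => a _.
  rewrite dotZr dotC hx sum_dot !mulr_sumr; apply: eq_bigr => b _.
  rewrite dotZr /c enum_rankK mulrA; have -> : dot (vv a x - vv a z) (vv b x - vv b z) =
      dot (dd e a) (dd e b).
    rewrite /dd; have := hends e; rewrite exz => /set2_eq [[<- <-]|[<- <-]] //.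
    by rewrite -[in RHS](opprB (vv a _)) -[in RHS](opprB (vv b _)) !dot_coord !mxE !mulrNN.
  by field.
have h3 : y 0 ie = w e / 2 - quadratic_map c y 0 ie.
  by have := congr1 (fun u : 'rV[R]_m => u 0 ie) yE; rewrite !mxE enum_rankK.
move: h1 h2; set u := p x - p z; set t := h x - h z; clearbody u t => h1 h2.
rewrite dotDl !dotDr (dotC t) h1 h2.
suff : 2 * y 0 ie + 2 * quadratic_map c y 0 ie = w e by move=> <-; ring.
by rewrite [in LHS]h3; field.
Qed.

(** Lengthening only [e0] is possible arbitrarily close to p, and the result is equivalent for the
    remaining edges but not congruent. *)
Lemma not_rigid_without_edge (p : V -> 'rV[R]_3) e0 : e0 \in E ->
  rigidity_onto E p -> ~ rigid_framework (E :\ e0) p.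
Proof.
move=> e0E surj [eps [eps0 heps]]; have [d d0 hd] := realize_lengths surj eps0.
have [|q [hq hlen]] := hd (fun e => d *+ (val e == e0)).
  by move=> e; case: (_ == _); rewrite ?mulr1n ?mulr0n ?normr0 ?gtr0_norm // ltW.
have /eqP/cards2P [x [y [_ exy]]] := simpleE e0E.
have /heps /(_ hq) /(_ x y) : equivalent (E :\ e0) p q.
  move=> u v; rewrite in_setD1 => /andP [uv uvE].
  by rewrite (hlen (Sub [set u; v] uvE) u v) // SubK (negbTE uv) mulr0n addr0.
rewrite (hlen (Sub e0 e0E) x y) ?SubK // eqxx mulr1n => /eqP.
by rewrite -subr_eq0 addrC addrA addNr add0r (gt_eqF d0).
Qed.



(** Complex polynomials restricted to real points, kept as real and imaginary part; where such a
    function is nonzero, one of two real polynomials is. *)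
Definition polypair (I : finType) (g : (I -> R) -> R[i]) : Prop :=
  exists a b : (I -> R) -> R, [/\ polyfun a, polyfun b & forall x, g x = Complex (a x) (b x)].

Section PolyPair.
Variable I : finType.
Implicit Types g h : (I -> R) -> R[i].

Lemma polypair_const c : polypair (fun _ : I -> R => c).
Proof.
case: c => a b; exists (fun=> a), (fun=> b).
by split=> //; apply: polyfun_const.
Qed.

Lemma polypair_real (a : (I -> R) -> R) : polyfun a -> polypair (fun x => (a x)%:C).
Proof. by move=> ha; exists a, (fun=> 0); split=> //; apply: polyfun_const. Qed.

Lemma polypairD g h : polypair g -> polypair h -> polypair (fun x => g x + h x).
Proof.
move=> [a [b [ha hb hg]]] [c [d [hc hd hh]]].
exists (fun x => a x + c x), (fun x => b x + d x).
by split=> [||x]; [apply: polyfunD|apply: polyfunD|rewrite hg hh].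
Qed.

Lemma polypairM g h : polypair g -> polypair h -> polypair (fun x => g x * h x).
Proof.
move=> [a [b [ha hb hg]]] [c [d [hc hd hh]]].
exists (fun x => a x * c x - b x * d x), (fun x => a x * d x + b x * c x).
by split=> [||x]; [apply: polyfunB; apply: polyfunM|apply: polyfunD; apply: polyfunM|rewrite hg hh].
Qed.

Lemma polypair_ext g h : g =1 h -> polypair g -> polypair h.
Proof. by move=> gh [a [b [ha hb hg]]]; exists a, b; split=> // x; rewrite -gh. Qed.

Lemma polypair_comp (J : finType) (f : (J -> R[i]) -> R[i]) (F : J -> (I -> R) -> R) :
  polyfun f -> (forall j, polyfun (F j)) -> polypair (fun x => f (fun j => (F j x)%:C)).
Proof.
move=> [P hP] hF.
apply: polypair_ext (_ : polypair (fun x => \sum_(m <- msupp P) mcoeff m P *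
   \prod_i (F (enum_val i) x)%:C ^+ (fun_of_multinom m i))).
  by move=> x; rewrite hP mevalE.
elim: (msupp P) => [|m s IHs].
  by apply: polypair_ext (polypair_const 0) => x; rewrite big_nil.
apply: polypair_ext (polypairD _ IHs) => [x|]; first by rewrite big_cons.
apply: polypairM; first exact: polypair_const.
elim: (index_enum _) => [|i r IHr].
  by apply: polypair_ext (polypair_const 1) => x; rewrite big_nil.
apply: polypair_ext (polypairM _ IHr) => [x|]; first by rewrite big_cons.
elim: (fun_of_multinom m i) => [|n IHn].
  by apply: polypair_ext (polypair_const 1) => x; rewrite expr0.
apply: polypair_ext (polypairM (polypair_real (hF (enum_val i))) IHn) => x.
by rewrite exprS.
Qed.

Lemma generic_polypair g x0 (Q : (I -> R) -> Prop) : polypair g -> g x0 != 0 ->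
  (forall x, g x != 0 -> Q x) -> generically Q.
Proof.
move=> [a [b [ha hb hg]]] gx gQ; have [ax|ax] := eqVneq (a x0) 0; last first.
  apply: (generically_polyfun ha ax) => x hx; apply: gQ; rewrite hg.
  by apply: contraNneq hx => -[->].
have bx : b x0 != 0 by apply: contraNneq gx => bx; rewrite hg ax bx.
apply: (generically_polyfun hb bx) => x hx; apply: gQ; rewrite hg.
by apply: contraNneq hx => -[_ ->].
Qed.

End PolyPair.

(** The reciprocals of N, N+1, ... are distinct and at most d when N is at least 1/d, and finitely
    many of them outnumber the roots. *)
Lemma small_nonroot (q : {poly R[i]}) (d : R) : q != 0 -> 0 < d ->
  exists y : R, `|y| <= d /\ q.[y%:C] != 0.
Proof.
move=> q0 d0; pose N := (Num.bound (d^-1)).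
have N0 : (0 < N)%N by rewrite /N -(ltr_nat R) (le_lt_trans _ (archi_boundP _)) ?invr_ge0 // ltW.
pose F i : R := (N + i)%:R^-1.
have Finj : injective F.
  by move=> i j /invr_inj /eqP; rewrite eqr_nat eqn_add2l => /eqP.
have [/hasP [y /mapP [i _ ->] yq]|/hasPn h] :=
  boolP (has (fun y => q.[y] != 0) [seq (F i)%:C | i <- iota 0 (size q)]).
  exists (F i); split=> //; rewrite ger0_norm ?invr_ge0 //.
  rewrite invf_ple ?posrE // ?ltr0n ?addn_gt0 ?N0 //.
  apply: (@le_trans _ _ N%:R); last by rewrite ler_nat leq_addr.
  by apply/ltW/archi_boundP; rewrite invr_ge0 ltW.
have: (size [seq (F i)%:C | i <- iota 0 (size q)] < size q)%N.
  apply: max_poly_roots => //.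
    by apply/allP => y /h; rewrite negbK.
  rewrite map_inj_uniq ?iota_uniq // => i j /complexI; exact: Finj.
by rewrite size_map size_iota ltnn.
Qed.

Definition edge_lengths (ends : edge E -> V * V) (p : V -> 'rV[R]_3) (e : edge E) : R :=
  sqdist (p (ends e).1) (p (ends e).2).

(* The real length map is open at a point where its derivative is onto, and a
   nonzero complex polynomial does not vanish on a real box. *)
Lemma generic_lengths ends (Q : (edge E -> R[i]) -> Prop) :
  (forall e, val e = [set (ends e).1; (ends e).2]) ->
  independent R E -> generically Q ->
  generically (fun x : V * 'I_3 -> R =>
    Q (fun e => (edge_lengths ends (realization_of x) e)%:C)).
Proof.
move=> hends /generic_ex [x surj] /generic_polyfun [f [l1 [hf fl1 fQ]]].
set p := realization_of x in surj.
have [d d0 hd] := realize_lengths surj ltr01.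
(* The direction from the lengths of p to a natural point where f is nonzero: f is not identically
   zero on this line, so it is nonzero after an arbitrarily small step, which a framework near p
   realizes. *)
pose b (e : edge E) : R := (l1 e)%:R - edge_lengths ends p e.
have [q hq] := polyfun_line (fun e => (edge_lengths ends p e)%:C) (fun e => (b e)%:C) hf.
have q0 : q != 0.
  apply: contraNneq fl1 => q0; have := hq 1; rewrite q0 horner0 => <-; apply/eqP.
  congr f; apply/funext => e; rewrite mul1r /b -rmorphD addrC subrK.
  by rewrite rmorph_nat.
pose B := 1 + \sum_e `|b e|.
have B0 : 0 < B by rewrite ltr_pwDl // sumr_ge0.
have [y [yd hy]] := small_nonroot q0 (divr_gt0 d0 B0).
have [|p' [_ hp']] := hd (fun e => y * b e).
  move=> e; rewrite normrM; apply: (@le_trans _ _ (d / B * B)); last by rewrite divfK ?gt_eqF.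
  apply: ler_pM => //; rewrite /B (bigD1 e) //= addrCA lerDl addr_ge0 // sumr_ge0 //.
pose F (e : edge E) (x : V * 'I_3 -> R) := edge_lengths ends (realization_of x) e.
have hF e : polyfun (F e).
  apply: polyfun_ext (_ : polyfun (fun x => \sum_(i < 3)
     (x ((ends e).1, i) - x ((ends e).2, i)) ^+ 2)).
    by move=> z; apply: eq_bigr => i _; rewrite !mxE.
  apply: polyfun_sum => i; apply: polyfunX.
  by apply: polyfunB; apply: polyfun_coord.
apply: (generic_polypair (polypair_comp hf hF) (x0 := fun vc => p' vc.1 0 vc.2)).
  move: hy; rewrite -hq; congr (_ != 0); congr f; apply/funext => e.
  rewrite /F /edge_lengths -rmorphM -rmorphD; congr (_%:C).
  have pE v : realization_of (fun vc : V * 'I_3 => p' vc.1 0 vc.2) v = p' v.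
    by apply/rowP => c; rewrite mxE.
  by rewrite !pE (hp' e).
by move=> z; apply: fQ.
Qed.

Lemma positive_gap (T : finType) (g : T -> R) :
  exists2 eta : R, 0 < eta & forall t, 0 < g t -> eta <= g t.
Proof.
exists (\big[Num.min/1]_(t | 0 < g t) g t).
  by elim/big_ind: _ => // x y x0 y0; rewrite lt_min x0 y0.
move=> t ht; exact: bigmin_le_cond.
Qed.

Lemma sqdist_near (p : V -> 'rV[R]_3) (eta : R) : 0 < eta ->
  exists2 eps : R, 0 < eps & forall q : V -> 'rV[R]_3,
    (forall v, sqdist (p v) (q v) < eps) ->
    forall u v, `|sqdist (q u) (q v) - sqdist (p u) (p v)| < eta.
Proof.
move=> eta0; pose M : R := \sum_u \sum_v \sum_i `|p u 0 i - p v 0 i|.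
have M0 : 0 <= M by do 3!rewrite sumr_ge0 // => ? _.
pose s := Num.min 1 (eta / (12 + 12 * M + 1)).
have D0 : 0 < 12 + 12 * M + 1 by lra.
have s0 : 0 < s by rewrite lt_min ltr01 divr_gt0.
have s1 : s <= 1 by rewrite ge_min lexx.
have sM : s * (12 + 12 * M + 1) <= eta by rewrite -ler_pdivlMr // ge_min lexx orbT.
exists (s ^+ 2); first by rewrite exprn_gt0.
move=> q hq u v.
have coord w i : `|q w 0 i - p w 0 i| <= s.
  have : `|q w 0 i - p w 0 i| ^+ 2 <= s ^+ 2.
    rewrite real_normK ?num_real //.
    apply: le_trans (ltW (hq w)); rewrite /sqdist (bigD1 i) //= -[leLHS]addr0.
    apply: lerD; first by rewrite -sqrrN opprB.
    by apply: sumr_ge0 => j _; apply: sqr_ge0.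
  by rewrite ler_sqr ?nnegrE ?(ltW s0).
have hM i : `|p u 0 i - p v 0 i| <= M.
  rewrite /M (bigD1 u) //= (bigD1 v) //= (bigD1 i) //= -!addrA lerDl.
  rewrite !addr_ge0 // ?sumr_ge0 // => j _; rewrite ?sumr_ge0 // => k _.
  by rewrite sumr_ge0.
have term i : `|(q u 0 i - q v 0 i) ^+ 2 - (p u 0 i - p v 0 i) ^+ 2| <= s * (4 + 4 * M).
  set a := p u 0 i - p v 0 i; set t := (q u 0 i - p u 0 i) - (q v 0 i - p v 0 i).
  have tb : `|t| <= 2 * s.
    apply: (le_trans (ler_normB _ _)).
    by have := coord u i; have := coord v i; lra.
  have -> : (q u 0 i - q v 0 i) ^+ 2 - a ^+ 2 = t * (t + 2 * a) by rewrite /t /a; ring.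
  rewrite normrM; apply: (@le_trans _ _ (2 * s * (2 * s + 2 * M))).
    apply: ler_pM => //; apply: (le_trans (ler_normD _ _)); apply: lerD => //.
    by rewrite normrM (ger0_norm (ler0n _ 2)) ler_pM2l // hM.
  have : s * s <= s * 1 by rewrite ler_pM2l.
  nra.
rewrite /sqdist -sumrB; apply: (le_lt_trans (ler_norm_sum _ _ _)).
apply: (@le_lt_trans _ _ (\sum_(i < 3) s * (4 + 4 * M))); first by apply: ler_sum => i _.
rewrite sumr_const card_ord; apply: lt_le_trans sM.
have -> : s * (4 + 4 * M) *+ 3 = s * (12 + 12 * M) by rewrite -mulr_natr; ring.
by rewrite ltr_pM2l // ltrDl.
Qed.

(** With finitely many classes, the squared distance of a pair of vertices takes finitely many
    values over all realizations; near p it is too close to its value at p to take another one. *)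
Lemma rigid_of_realization_count (p : V -> 'rV[R]_3) ends k :
  (forall e, val e = [set (ends e).1; (ends e).2]) ->
  realization_count (fun e : edge E => (edge_lengths ends p e)%:C) k ->
  rigid_framework E p.
Proof.
move=> hends [rep [_ _ hrep]].
pose D (t : 'I_k * V * V) := sqdist (rep t.1.1 t.1.2) (rep t.1.1 t.2).
(* The representatives may have non-real distances; real parts suffice, since the distances of the
   nearby framework are real. *)
have [eta eta0 heta] := positive_gap (fun t => `|complex.Re (D t) - sqdist (p t.1.2) (p t.2)|).
have [eps eps0 heps] := sqdist_near p eta0.
exists eps; split=> // q eqv near u v.
pose qC w : 'rV[R[i]]_3 := map_mx (real_complex R) (q w).
have qCE x y : sqdist (qC x) (qC y) = (sqdist (q x) (q y))%:C.
  rewrite rmorph_sum; apply: eq_bigr => i _.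
  by rewrite rmorphXn rmorphB !mxE.
have [|i hi] := hrep qC.
  move=> e x y exy; rewrite qCE eqv -?exy ?(valP e) //; congr (_%:C).
  rewrite /edge_lengths; have := hends e; rewrite exy => /set2_eq [[-> ->] //|[-> ->]].
  exact: sqdistC.
have hD : (sqdist (q u) (q v))%:C = D (i, u, v).
  by rewrite -qCE /D (directly_congruent_sqdist _ _ hi).
apply/eqP/negPn/negP => neq.
have := heta (i, u, v); rewrite -hD /= normr_gt0 subr_eq0 => /(_ neq).
by rewrite leNgt heps.
Qed.

Theorem minimally_rigid_of_count k :
  independent R E -> is_lambda3 R E k -> minimally_rigid R E.
Proof.
move=> indE lamE; have [ends hends] := edge_ends.
split=> //.
  apply: generic_mono (generic_lengths hends indE lamE) => x hx.
  exact: rigid_of_realization_count hends hx.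
move=> e eE rigid; have [x [h1 h2]] := generic_ex (generic_and indE rigid).
exact: not_rigid_without_edge eE h1 h2.
Qed.

Theorem minimally_rigid_of_covers N : independent R E -> covers R E N ->
  exists k, [/\ (k <= N)%N, minimally_rigid R E & is_lambda3 R E k].
Proof.
move=> indE /lambda3_of_covers [k kN lam]; exists k; split=> //.
exact: minimally_rigid_of_count lam.
Qed.

End Real.

End Rigid.

(** * Infinitesimal rotations *)

Section Moves.
Variable K : numFieldType.
Implicit Types u v w d : 'rV[K]_3.

Lemma orthogonal_agree u v (A B : 'M[K]_3) : A *m A^T = 1%:M -> \det A = 1 ->
  B *m B^T = 1%:M -> \det B = 1 -> u *m A = u *m B -> v *m A = v *m B ->
  gram u v != 0 -> A = B.
Proof.
move=> hA dA hB dB hu hv g0.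
have hC : A *m B^T *m (A *m B^T)^T = 1%:M.
  by rewrite trmx_mul trmxK mulmxA -(mulmxA A) (mulmx1C hB) mulmx1.
have dC : \det (A *m B^T) = 1 by rewrite det_mulmx det_tr dA dB mulr1.
have fix_row w : w *m A = w *m B -> w *m (A *m B^T) = w.
  by move=> hw; rewrite mulmxA hw -mulmxA hB mulmx1.
have := orthogonal_fix hC dC (fix_row _ hu) (fix_row _ hv) g0.
by move=> /(congr1 (mulmx^~ B)); rewrite -mulmxA (mulmx1C hB) mulmx1 mul1mx.
Qed.

Lemma dot_cross_self u w : dot u (cross w u) = 0.
Proof. by elim/row3_ind: u => a b c; elim/row3_ind: w => a' b' c'; rewrite !vecE; ring. Qed.

Lemma crossZl k u v : cross (k *: u) v = k *: cross u v.
Proof.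
elim/row3_ind: u => a b c; elim/row3_ind: v => a' b' c'.
by rewrite !vecE; apply: row3_eq; ring.
Qed.

Lemma crossDl u v w : cross (u + v) w = cross u w + cross v w.
Proof.
elim/row3_ind: u => a b c; elim/row3_ind: v => a' b' c'; elim/row3_ind: w => x y z.
by rewrite !vecE; apply: row3_eq; ring.
Qed.

Lemma cross_self u : cross u u = 0.
Proof. by elim/row3_ind: u => a b c; rewrite !vecE; apply: row3_eq; ring. Qed.

Lemma cross0 w : cross w 0 = 0.
Proof. by elim/row3_ind: w => a b c; rewrite !vecE; apply: row3_eq; ring. Qed.

Lemma dot_cross_swap u v w : dot (cross w v) u = - dot v (cross w u).
Proof.
elim/row3_ind: u => a b c; elim/row3_ind: v => a' b' c'; elim/row3_ind: w => x y z.
by rewrite !vecE; ring.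
Qed.

Lemma cross_cross u d : cross (cross u d) u = dot u u *: d - dot u d *: u.
Proof.
elim/row3_ind: u => a b c; elim/row3_ind: d => a' b' c'.
by rewrite !vecE; apply: row3_eq; ring.
Qed.

Lemma hinge_velocity u d : dot u u != 0 -> dot u d = 0 ->
  cross ((dot u u)^-1 *: cross u d) u = d.
Proof.
move=> u0 hd.
by rewrite crossZl cross_cross hd scale0r subr0 scalerA mulVf // scale1r.
Qed.

(** A velocity field that preserves the three sides to first order is a rotation: take a rotation
    producing d on u; the remaining error on v is normal to the triangle, and a rotation about u
    removes it. *)
Lemma triangle_velocity u v d d' : dot u u != 0 -> gram u v != 0 ->
  dot u d = 0 -> dot v d' = 0 -> dot v d + dot u d' = 0 ->
  exists w, cross w u = d /\ cross w v = d'.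
Proof.
move=> u0 g0 hd hd' hdd.
have [w0 w0u] : exists w0, cross w0 u = d by eexists; apply: hinge_velocity.
have tv : dot (d' - cross w0 v) v = 0.
  by rewrite dotBl !(dotC _ v) hd' dot_cross_self subr0.
have tu : dot (d' - cross w0 v) u = 0.
  by rewrite dotBl dot_cross_swap w0u opprK (dotC d') addrC.
have := perp_cross tu tv g0; set k := _ / _ => tE.
exists (w0 + k *: u); split; rewrite crossDl crossZl ?cross_self ?scaler0 ?addr0 //.
by rewrite -tE addrC subrK.
Qed.

End Moves.

(** * Restriction to subgraphs and counting classes by labels *)

Definition mk_edge (V : finType) (E : {set {set V}}) e (eE : e \in E) : edge E := Sub e eE.

Section Subgraph.
Variables (V1 V : finType) (f : V1 -> V) (E1 : {set {set V1}}) (E : {set {set V}}).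

Definition graph_image : {set {set V}} := [set f @: (e : {set V1}) | e in E1].

Lemma graph_image_simple : injective f -> simple_graph E1 -> simple_graph graph_image.
Proof. by move=> finj hE _ /imsetP [e eE ->]; rewrite card_imset // hE. Qed.

Lemma graph_image_edge (e : {set V1}) x y : injective f -> f @: e = [set x; y] ->
  exists a b, [/\ x = f a, y = f b & e = [set a; b]].
Proof.
move=> finj ee; have : x \in f @: e by rewrite ee set21.
have : y \in f @: e by rewrite ee set22.
case/imsetP => b be yE /imsetP [a ae xE]; exists a, b; split=> //.
by apply: (imset_inj finj); rewrite ee imsetU !imset_set1 xE yE.
Qed.

Hypothesis (finj : injective f) (sub : graph_image \subset E).

Lemma edge_image_proof (e : edge E1) : f @: val e \in E.
Proof. by apply: (subsetP sub); apply: imset_f; apply: valP. Qed.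

Definition edge_image (e : edge E1) : edge E := Sub (f @: val e) (edge_image_proof e).

Lemma edge_image_inj : injective edge_image.
Proof. by move=> a b /(congr1 val) /(imset_inj finj) /val_inj. Qed.

Lemma compatible_pull (R : realType) (l : edge E -> R[i]) rho :
  compatible l rho -> compatible (l \o edge_image) (rho \o f).
Proof.
move=> h e u v euv; apply: (h (edge_image e)).
by rewrite /= euv imsetU !imset_set1.
Qed.

Lemma covers_pull (R : realType) N : covers R E1 N ->
  generically (fun l : edge E -> R[i] => exists rep : 'I_N -> V1 -> 'rV[R[i]]_3,
    forall rho, compatible l rho -> exists i, directly_congruent (rep i) (rho \o f)).
Proof.
move=> /(generic_pull edge_image_inj); apply: generic_mono => l [rep hrep].
by exists rep => rho /compatible_pull; apply: hrep.
Qed.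

Lemma independent_pull (K : numFieldType) : independent K E1 ->
  generically (fun x : V * 'I_3 -> K => rigidity_onto E1 (realization_of x \o f)).
Proof.
have pinj : injective (fun ac : V1 * 'I_3 => (f ac.1, ac.2)).
  by move=> [a c] [b d] [/finj -> ->].
move=> /(generic_pull pinj); apply: generic_mono => x; congr rigidity_onto.
Qed.

End Subgraph.

Section Covering.
Variables (R : realType) (V : finType).
Notation real := (V -> 'rV[R[i]]_3).

(** One realization is chosen per label; labels that do not occur get an arbitrary one. *)
Lemma cover_fibres (T : finType) N (P : real -> Prop) (L : T -> real -> Prop) :
  #|T| = N ->
  (forall rho, P rho -> exists t, L t rho) ->
  (forall t rho rho', P rho -> P rho' -> L t rho -> L t rho' -> directly_congruent rho rho') ->
  exists rep : 'I_N -> real, forall rho, P rho -> exists i, directly_congruent (rep i) rho.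
Proof.
move=> <- hL hfib.
have /choice [rep hrep] : forall t, exists r : real, (exists rho, P rho /\ L t rho) -> P r /\ L t r.
  move=> t; have [[rho hrho]|h] := pselect (exists rho, P rho /\ L t rho).
    by exists rho.
  by exists (fun=> 0).
exists (fun i => rep (enum_val i)) => rho hrho; have [t ht] := hL _ hrho.
exists (enum_rank t); rewrite enum_rankK.
have [h1 h2] : P (rep t) /\ L t (rep t) by apply: hrep; exists rho.
exact: hfib ht.
Qed.

(** Each label is refined by one bit telling whether the realization is congruent to the base
    realization of that label. *)
Lemma cover_fibres2 (T : finType) N (P : real -> Prop) (L : T -> real -> Prop) :
  #|T| = N ->
  (forall rho, P rho -> exists t, L t rho) ->
  (forall t r1 r2 r3, P r1 -> P r2 -> P r3 -> L t r1 -> L t r2 -> L t r3 ->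
     [\/ directly_congruent r1 r2, directly_congruent r1 r3 | directly_congruent r2 r3]) ->
  exists rep : 'I_(2 * N) -> real, forall rho, P rho -> exists i, directly_congruent (rep i) rho.
Proof.
move=> cT hL hfib.
have /choice [base hbase] : forall t, exists r : real, (exists rho, P rho /\ L t rho) -> P r /\ L t r.
  move=> t; have [[rho hrho]|h] := pselect (exists rho, P rho /\ L t rho).
    by exists rho.
  by exists (fun=> 0).
pose L' (bt : bool * T) rho := L bt.2 rho /\ (bt.1 <-> directly_congruent (base bt.2) rho).
apply: (@cover_fibres _ _ P L') => [|rho hrho|[b t] rho rho' Pr Pr' [/= h1 h2] [/= h1' h2']].
- by rewrite card_prod card_bool cT.
- have [t ht] := hL _ hrho.
  by exists (`[< directly_congruent (base t) rho >], t); split=> //=; split=> /asboolP.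
- have [Pb Lb] : P (base t) /\ L t (base t) by apply: hbase; exists rho.
  case: b h2 h2' => h2 h2'.
    apply: directly_congruent_trans (_ : directly_congruent _ (base t)) _.
      by apply: directly_congruent_sym; apply/h2.
    exact/h2'.
  by case: (hfib t _ _ _ Pb Pr Pr' Lb h1 h1') => // [/h2|/h2'].
Qed.

End Covering.

Section PolyfunVectors.
Variables (K : numFieldType) (V : finType).
Notation conf := (V * 'I_3 -> K).
Implicit Types F G : conf -> 'rV[K]_3.

Definition polyvec F := forall i, polyfun (fun x => F x 0 i).

Lemma polyvec_point v : polyvec (fun x => realization_of x v).
Proof. by move=> i; apply: polyfun_ext (polyfun_coord K (v, i)) => x; rewrite mxE. Qed.

Lemma polyvecB F G : polyvec F -> polyvec G -> polyvec (fun x => F x - G x).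
Proof. by move=> hF hG i; apply: polyfun_ext (polyfunB (hF i) (hG i)) => x; rewrite !mxE. Qed.

Lemma polyfun_dot F G : polyvec F -> polyvec G -> polyfun (fun x => dot (F x) (G x)).
Proof.
move=> hF hG; apply: polyfun_ext (_ : polyfun (fun x => F x 0 i0 * G x 0 i0 +
  F x 0 i1 * G x 0 i1 + F x 0 i2 * G x 0 i2)); first by move=> x; rewrite dot_coord.
by do 2?apply: polyfunD; apply: polyfunM.
Qed.

Lemma polyvec_cross F G : polyvec F -> polyvec G -> polyvec (fun x => cross (F x) (G x)).
Proof.
move=> hF hG [[|[|[|//]]] hi].
- apply: polyfun_ext (_ : polyfun (fun x => F x 0 i1 * G x 0 i2 - F x 0 i2 * G x 0 i1)).
    by move=> x; rewrite !mxE.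
  by apply: polyfunB; apply: polyfunM.
- apply: polyfun_ext (_ : polyfun (fun x => F x 0 i2 * G x 0 i0 - F x 0 i0 * G x 0 i2)).
    by move=> x; rewrite !mxE.
  by apply: polyfunB; apply: polyfunM.
- apply: polyfun_ext (_ : polyfun (fun x => F x 0 i0 * G x 0 i1 - F x 0 i1 * G x 0 i0)).
    by move=> x; rewrite !mxE.
  by apply: polyfunB; apply: polyfunM.
Qed.

Lemma polyfun_gram F G : polyvec F -> polyvec G -> polyfun (fun x => gram (F x) (G x)).
Proof.
move=> hF hG; apply: polyfunB; last by apply: polyfunX; apply: polyfun_dot.
by apply: polyfunM; apply: polyfun_dot.
Qed.

End PolyfunVectors.

(* Witness configurations are given by a vector for each vertex. *)
Lemma realization_of_vectors (K : numFieldType) (V : finType) (p : V -> 'rV[K]_3) v :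
  realization_of (fun vc => p vc.1 0 vc.2) v = p v.
Proof. by apply/rowP => c; rewrite mxE. Qed.

Lemma generic_triangle_real (K : numFieldType) (V : finType) (x y z : V) :
  uniq [:: x; y; z] -> generically (fun p : V * 'I_3 -> K =>
    let u := realization_of p y - realization_of p x in
    dot u u != 0 /\ gram u (realization_of p z - realization_of p x) != 0).
Proof.
rewrite /= !inE negb_or => /andP[/andP[xy xz] /andP[yz _]].
pose w (v : V) : 'rV[K]_3 := if v == y then row3 1 0 0 else if v == z then row3 0 1 0 else 0.
have hpv v : polyvec (fun p : V * 'I_3 -> K => realization_of p v - realization_of p x).
  by apply: polyvecB; apply: polyvec_point.
apply: (generically_polyfun (polyfunM (polyfun_dot (hpv y) (hpv y)) (polyfun_gram (hpv y) (hpv z)))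
  (x0 := fun vc => w vc.1 0 vc.2)).
  rewrite !realization_of_vectors /w !eqxx (negbTE xy) (negbTE xz) [z == y]eq_sym (negbTE yz).
  rewrite !subr0 /gram !vecE !(mulr0, mul0r, addr0, add0r, mulr1) expr0n /= ?subr0.
  by rewrite ?mulr1 oner_neq0.
by move=> p; rewrite mulf_eq0 negb_or => /andP[].
Qed.

(** Asked of every realization compatible with generic lengths, because the gluing bounds have to
    count all of them. *)
Definition nondegenerate_triangle (R : realType) (W : finType) (F : {set {set W}}) (x y z : W) :=
  generically (fun l : edge F -> R[i] => forall rho, compatible l rho ->
    gram (rho y - rho x) (rho z - rho x) != 0).

(** With all three sides given, the Gram determinant is a polynomial in the lengths; for unit
    lengths it equals 3/4. *)
Lemma nondegenerate_of_edges (R : realType) (W : finType) (F : {set {set W}}) (x y z : W) :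
  [set x; y] \in F -> [set x; z] \in F -> [set y; z] \in F ->
  nondegenerate_triangle R F x y z.
Proof.
move=> exy exz eyz; pose a := mk_edge exy; pose b := mk_edge exz; pose c := mk_edge eyz.
apply: (@generically_polyfun _ _ _ (fun l : edge F -> R[i] =>
  l a * l b - ((l a + l b - l c) / 2%:R) ^+ 2) (fun=> 1)) => [||l nd rho hrho].
- apply: polyfunB; first by apply: polyfunM; apply: polyfun_coord.
  apply: polyfunX; apply: polyfunM; last exact: polyfun_const.
  by apply: polyfunB; first apply: polyfunD; apply: polyfun_coord.
- by rewrite addrK !mul1r subr_eq0 eq_sym exprVn invr_eq1 -natrX pnatr_eq1.
move: nd; rewrite /gram (polarization (rho y) (rho z)) -!sqdistE !(sqdistC _ (rho x)).
by rewrite -(hrho a x y erefl) -(hrho b x z erefl) -(hrho c y z erefl).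
Qed.

(** * Gluing two graphs along a triangle or along a hinge with a bar *)

Section Glue.
Variables (V1 V2 V : finType) (f1 : V1 -> V) (f2 : V2 -> V).
Variables (E1 : {set {set V1}}) (E2 : {set {set V2}}).
Hypotheses (f1inj : injective f1) (f2inj : injective f2).
Hypothesis fcover : forall v, (exists a, v = f1 a) \/ (exists b, v = f2 b).

Lemma congruent_of_parts (K : numFieldType) (rho rho' : V -> 'rV[K]_3) (A B : 'M[K]_3) t s x1 x2 :
  A *m A^T = 1%:M -> \det A = 1 -> f1 x1 = f2 x2 -> A = B ->
  (forall a, rho' (f1 a) = rho (f1 a) *m A + t) ->
  (forall b, rho' (f2 b) = rho (f2 b) *m B + s) ->
  directly_congruent rho rho'.
Proof.
move=> hA dA hx AB h1 h2; exists A, t; split=> // v.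
have ts : t = s by have := h1 x1; rewrite hx h2 AB => /addrI.
by case: (fcover v) => -[a ->]; rewrite ?h1 // h2 AB ts.
Qed.

Section Onto.
Variables (K : numFieldType) (E : {set {set V}}).
Hypotheses (sub1 : graph_image f1 E1 \subset E) (sub2 : graph_image f2 E2 \subset E).

Lemma merge_velocities (v1 : V1 -> 'rV[K]_3) (v2 : V2 -> 'rV[K]_3) :
  (forall a b, f1 a = f2 b -> v1 a = v2 b) ->
  exists v : V -> 'rV[K]_3, (forall a, v (f1 a) = v1 a) /\ (forall b, v (f2 b) = v2 b).
Proof.
move=> h; suff /choice [v hv] : forall z, exists r, (forall a, z = f1 a -> r = v1 a) /\
    (forall b, z = f2 b -> r = v2 b).
  by exists v; split=> [a|b]; [apply: (hv (f1 a)).1|apply: (hv (f2 b)).2].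
move=> z; case: (fcover z) => -[a ->].
  by exists (v1 a); split=> [a' /f1inj -> //|b /h].
by exists (v2 a); split=> [b /esym /h //|b /f2inj ->].
Qed.

Lemma edge_equation_pull (W : finType) (f : W -> V) (F : {set {set W}}) (finj : injective f)
    (sub : graph_image f F \subset E) (p : V -> 'rV[K]_3) (vW : W -> 'rV[K]_3)
    (v : V -> 'rV[K]_3) (w : edge E -> K) :
  (forall a, v (f a) = vW a) ->
  (forall (e : edge F) x y, val e = [set x; y] ->
     dot ((p \o f) x - (p \o f) y) (vW x - vW y) = w (edge_image sub e)) ->
  forall (e : edge E) x y, val e \in graph_image f F -> val e = [set x; y] ->
     dot (p x - p y) (v x - v y) = w e.
Proof.
move=> hv h e x y /imsetP [e' he' ee] exy.
have [a [b [-> -> e'ab]]] : exists a b, [/\ x = f a, y = f b & e' = [set a; b]].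
  by apply: graph_image_edge => //; rewrite -ee.
rewrite !hv (h (Sub e' he')) //; congr w; apply/val_inj.
by rewrite ee.
Qed.

(* Superimposing an infinitesimal rigid motion does not change the rates of
   change of the edge lengths. *)
Lemma rate_motion (a b va vb t w x : 'rV[K]_3) :
  dot (a - b) ((va + t + cross w (a - x)) - (vb + t + cross w (b - x))) = dot (a - b) (va - vb).
Proof.
elim/row3_ind: a => a1 a2 a3; elim/row3_ind: b => b1 b2 b3; elim/row3_ind: w => w1 w2 w3.
elim/row3_ind: x => x1 x2 x3; elim/row3_ind: va => c1 c2 c3; elim/row3_ind: vb => d1 d2 d3.
by elim/row3_ind: t => t1 t2 t3; rewrite !vecE; ring.
Qed.

Lemma third_side_rate (u v a b : 'rV[K]_3) : dot u a = 0 -> dot v b = 0 ->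
  dot (u - v) (a - b) = 0 -> dot v a + dot u b = 0.
Proof.
move=> hu hv; rewrite dotBl !dotBr hu hv sub0r subr0 => /eqP.
by rewrite -opprD oppr_eq0 addrC => /eqP.
Qed.

End Onto.

Section Triangle.
Variables (x1 y1 z1 : V1) (x2 y2 z2 : V2).
Hypotheses (fx : f1 x1 = f2 x2) (fy : f1 y1 = f2 y2) (fz : f1 z1 = f2 z2).
Hypothesis overlap : forall a b, f1 a = f2 b ->
  [\/ a = x1 /\ b = x2, a = y1 /\ b = y2 | a = z1 /\ b = z2].
Hypothesis tri1 : uniq [:: x1; y1; z1].
Hypothesis edges1 : [&& [set x1; y1] \in E1, [set x1; z1] \in E1 & [set y1; z1] \in E1].
Hypothesis edges2 : [&& [set x2; y2] \in E2, [set x2; z2] \in E2 & [set y2; z2] \in E2].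

Let E := graph_image f1 E1 :|: graph_image f2 E2.
Let sub1 : graph_image f1 E1 \subset E := subsetUl _ _.
Let sub2 : graph_image f2 E2 \subset E := subsetUr _ _.

Lemma triangle_glue_simple : simple_graph E1 -> simple_graph E2 -> simple_graph E.
Proof. by move=> h1 h2 e /setUP [] /(graph_image_simple _) -> //. Qed.

(** The prescribed rates are realized on each part separately. On the shared triangle both solutions
    have the same rates, so they differ by an infinitesimal rigid motion; adding it to the second
    solution makes them agree. *)
Lemma triangle_glue_independent (K : numFieldType) :
  independent K E1 -> independent K E2 -> independent K E.
Proof.
move=> /(independent_pull f1inj) ind1 /(independent_pull f2inj) ind2.
have trif : uniq [:: f1 x1; f1 y1; f1 z1] by rewrite (map_inj_uniq f1inj [:: x1; y1; z1]).
apply: generic_mono (generic_and (generic_and ind1 ind2) (generic_triangle_real K trif)).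
move=> x; set p := realization_of x => -[[on1 on2] /= []].
set u := p (f1 y1) - p (f1 x1); set v := p (f1 z1) - p (f1 x1) => u0 g0 w.
have [v1 h1] := on1 (w \o edge_image sub1); have [v2 h2] := on2 (w \o edge_image sub2).
have same a1 b1 a2 b2 : f1 a1 = f2 a2 -> f1 b1 = f2 b2 -> [set a1; b1] \in E1 ->
    [set a2; b2] \in E2 -> dot (p (f1 a1) - p (f1 b1)) ((v1 a1 - v2 a2) - (v1 b1 - v2 b2)) = 0.
  move=> ha hb e1 e2; have := h1 (mk_edge e1) a1 b1 erefl; have := h2 (mk_edge e2) a2 b2 erefl.
  rewrite /= -ha -hb; have -> : edge_image sub1 (mk_edge e1) = edge_image sub2 (mk_edge e2).
    by apply/val_inj; rewrite /= !imsetU !imset_set1 ha hb.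
  move=> <- /eqP; rewrite -subr_eq0 -dotBr => /eqP h; rewrite -[RHS]h; congr dot.
  by rewrite !opprB addrACA [RHS]addrACA; congr (_ + _); rewrite addrC.
have [exy exz eyz] := and3P edges1.
have [exy' exz' eyz'] := and3P edges2.
pose dd a b : 'rV[K]_3 := v1 a - v2 b.
pose t := dd x1 x2.
have hu : dot u (dd y1 y2 - t) = 0.
  by have := same _ _ _ _ fy fx; rewrite ![[set y1; x1]]setUC ![[set y2; x2]]setUC; apply.
have hv : dot v (dd z1 z2 - t) = 0.
  by have := same _ _ _ _ fz fx; rewrite ![[set z1; x1]]setUC ![[set z2; x2]]setUC; apply.
have huv : dot v (dd y1 y2 - t) + dot u (dd z1 z2 - t) = 0.
  have := same _ _ _ _ fy fz eyz eyz'.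
  have -> : p (f1 y1) - p (f1 z1) = u - v by rewrite /u /v opprB addrA subrK.
  have -> : v1 y1 - v2 y2 - (v1 z1 - v2 z2) = (dd y1 y2 - t) - (dd z1 z2 - t).
    by rewrite [X in _ = _ + X]opprB [RHS]addrA subrK.
  exact: third_side_rate.
have [om [omu omv]] := triangle_velocity u0 g0 hu hv huv.
pose v2' b := v2 b + t + cross om (p (f2 b) - p (f1 x1)).
have agree a b : f1 a = f2 b -> v1 a = v2' b.
  move=> fab; rewrite /v2' -fab; case: (overlap fab) => -[-> ->].
  - by rewrite subrr cross0 addr0 /t /dd addrC subrK.
  - by rewrite -/u omu addrACA subrr addr0 /dd addrC subrK.
  - by rewrite -/v omv addrACA subrr addr0 /dd addrC subrK.
have [vel [hvel1 hvel2]] := merge_velocities agree.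
exists vel => e a b eab; have : val e \in E by apply: valP.
case/setUP => he; first exact: (edge_equation_pull f1inj hvel1 h1 he eab).
refine (edge_equation_pull f2inj hvel2 _ he eab) => e' a' b' e'ab.
by rewrite /v2' rate_motion; apply: h2.
Qed.

(** The classes of the two restrictions determine the class of the whole: the isometries relating
    the parts agree on the shared nondegenerate triangle and hence coincide. *)
Lemma triangle_glue_covers (R : realType) N1 N2 :
  covers R E1 N1 -> covers R E2 N2 -> covers R E (N1 * N2).
Proof.
move=> /(covers_pull f1inj sub1) c1 /(covers_pull f2inj sub2) c2.
have /and3P [exy exz eyz] := edges1.
have img a b : [set a; b] \in E1 -> [set f1 a; f1 b] \in E.
  by move=> h; apply/setUP; left; apply/imsetP; exists [set a; b]; rewrite // imsetU !imset_set1.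
have nondeg := nondegenerate_of_edges R (img _ _ exy) (img _ _ exz) (img _ _ eyz).
apply: generic_mono (generic_and (generic_and c1 c2) nondeg).
move=> l [[[rep1 h1] [rep2 h2]] nd].
apply: (@cover_fibres _ _ _ _ _ (fun ij rho => directly_congruent (rep1 ij.1) (rho \o f1) /\
   directly_congruent (rep2 ij.2) (rho \o f2))); first by rewrite card_prod !card_ord.
  by move=> rho hrho; have [i hi] := h1 _ hrho; have [j hj] := h2 _ hrho; exists (i, j).
move=> [i j] rho rho' hrho hrho' /= [hi hj] [hi' hj'].
have [A [t [hA dA hAt]]] : directly_congruent (rho \o f1) (rho' \o f1).
  by apply: directly_congruent_trans hi'; apply: directly_congruent_sym.
have [B [s [hB dB hBs]]] : directly_congruent (rho \o f2) (rho' \o f2).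
  by apply: directly_congruent_trans hj'; apply: directly_congruent_sym.
have g0 := nd _ hrho.
have {}hAt a : rho' (f1 a) = rho (f1 a) *m A + t := hAt a.
have {}hBs b : rho' (f2 b) = rho (f2 b) *m B + s := hBs b.
have dif a b a' b' : f1 a = f2 a' -> f1 b = f2 b' ->
    (rho (f1 a) - rho (f1 b)) *m A = (rho (f1 a) - rho (f1 b)) *m B.
  move=> ha hb.
  have : rho' (f1 a) - rho' (f1 b) = rho' (f2 a') - rho' (f2 b') by rewrite ha hb.
  rewrite (hAt a) (hAt b) (hBs a') (hBs b') /= -ha -hb.
  by rewrite !opprD (addrACA _ t) subrr addr0 (addrACA _ s) subrr addr0 -!mulmxBl.
have AB : A = B by apply: (orthogonal_agree hA dA hB dB _ _ g0);
    [apply: (dif _ _ y2 x2) | apply: (dif _ _ z2 x2)].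
exact: congruent_of_parts hA dA fx AB hAt hBs.
Qed.

End Triangle.

Section Hinge.
Variables (x1 y1 c1 : V1) (x2 y2 c2 : V2).
Hypotheses (fx : f1 x1 = f2 x2) (fy : f1 y1 = f2 y2).
Hypothesis overlap : forall a b, f1 a = f2 b -> (a = x1 /\ b = x2) \/ (a = y1 /\ b = y2).
Hypotheses (uniq1 : uniq [:: x1; y1; c1]) (uniq2 : uniq [:: x2; y2; c2]).
Hypotheses (edge1 : [set x1; y1] \in E1) (edge2 : [set x2; y2] \in E2).

Let bar : {set V} := [set f1 c1; f2 c2].
Let E := bar |: (graph_image f1 E1 :|: graph_image f2 E2).
Let sub1 : graph_image f1 E1 \subset E.
Proof. by apply: subset_trans (subsetUr _ _); apply: subsetUl. Qed.
Let sub2 : graph_image f2 E2 \subset E.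
Proof. by apply: subset_trans (subsetUr _ _); apply: subsetUr. Qed.

Lemma hinge_vertices : uniq [:: f1 x1; f1 y1; f1 c1; f2 c2].
Proof.
rewrite -[[:: _; _; _; _]]/(map f1 [:: x1; y1; c1] ++ [:: f2 c2]) cat_uniq.
rewrite (map_inj_uniq f1inj) uniq1 /= orbF andbT fx fy !inE !(inj_eq f2inj).
move: uniq2; rewrite /= !inE negb_or => /andP[/andP[_ xc] /andP[yc _]].
rewrite eq_sym (negbTE xc) eq_sym (negbTE yc) /= eq_sym.
apply/negP => /eqP /overlap [] [h _]; move: uniq1; rewrite h /= !inE eqxx ?orbT //.
by rewrite andbF.
Qed.

Lemma hinge_glue_simple : simple_graph E1 -> simple_graph E2 -> simple_graph E.
Proof.
move=> h1 h2 e /setU1P [->|/setUP [] /(graph_image_simple _) -> //].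
have := hinge_vertices; rewrite cards2 /= !inE => /and4P[_ _ /negbTE -> _].
by [].
Qed.

(** Up to sign and a factor 2, the second quantity is the rate of the squared length of the bar when
    the second part rotates about the hinge. *)
Lemma generic_hinge_real (K : numFieldType) : generically (fun p : V * 'I_3 -> K =>
  let q := realization_of p in let u := q (f1 y1) - q (f1 x1) in
  dot u u != 0 /\ dot (q (f1 c1) - q (f2 c2)) (cross u (q (f2 c2) - q (f1 x1))) != 0).
Proof.
have := hinge_vertices; set x := f1 x1; set y := f1 y1; set c := f1 c1; set d := f2 c2.
rewrite /= !inE !negb_or => /and4P[/and3P[xy xc xd] /andP[yc yd] cd _].
pose w (v : V) : 'rV[K]_3 := if v == y then row3 1 0 0 else if v == c then row3 0 1 0
  else if v == d then row3 0 0 1 else 0.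
have hpv v v' : polyvec (fun p : V * 'I_3 -> K => realization_of p v - realization_of p v').
  by apply: polyvecB; apply: polyvec_point.
apply: (generically_polyfun (polyfunM (polyfun_dot (hpv y x) (hpv y x))
   (polyfun_dot (hpv c d) (polyvec_cross (hpv y x) (hpv d x))))
  (x0 := fun vc => w vc.1 0 vc.2)); last first.
  by move=> p; rewrite mulf_eq0 negb_or => /andP[].
rewrite !realization_of_vectors /w !eqxx (negbTE xy) (negbTE xc) (negbTE xd).
rewrite [c == y]eq_sym [d == y]eq_sym [d == c]eq_sym (negbTE yc) (negbTE yd) (negbTE cd).
rewrite !subr0 !vecE !(mulr0, mul0r, addr0, add0r, mulr1, subr0, oppr0, sub0r).
by rewrite ?mulrN ?mulr1 oppr_eq0 oner_neq0.
Qed.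

(** Agreement on the hinge determines the correcting motion of the second part up to a rotation
    about the hinge; the speed k of that rotation is chosen to meet the rate of the bar. *)
Lemma hinge_glue_independent (K : numFieldType) :
  independent K E1 -> independent K E2 -> independent K E.
Proof.
move=> /(independent_pull f1inj) ind1 /(independent_pull f2inj) ind2.
apply: generic_mono (generic_and (generic_and ind1 ind2) (generic_hinge_real K)).
move=> x; set p := realization_of x => -[[on1 on2] /= []].
set u := p (f1 y1) - p (f1 x1); set vol := dot _ (cross u _) => u0 vol0 w.
have [v1 h1] := on1 (w \o edge_image sub1); have [v2 h2] := on2 (w \o edge_image sub2).
pose dd a b : 'rV[K]_3 := v1 a - v2 b.
pose t := dd x1 x2.
have hu : dot u (dd y1 y2 - t) = 0.
  have := h1 (mk_edge edge1) y1 x1 (setUC _ _); have := h2 (mk_edge edge2) y2 x2 (setUC _ _).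
  rewrite /= -fx -fy; have -> : edge_image sub1 (mk_edge edge1) = edge_image sub2 (mk_edge edge2).
    by apply/val_inj; rewrite /= !imsetU !imset_set1 fx fy.
  move=> <- /eqP; rewrite -subr_eq0 -dotBr => /eqP h; rewrite -[RHS]h; congr dot.
  by rewrite /dd /t !opprB addrACA [RHS]addrACA; congr (_ + _); rewrite addrC.
have [om0 om0u] : exists om0, cross om0 u = dd y1 y2 - t by eexists; apply: hinge_velocity.
have [k hk] : exists k, dot (p (f1 c1) - p (f2 c2))
    (v1 c1 - (v2 c2 + t + cross (om0 + k *: u) (p (f2 c2) - p (f1 x1)))) =
    w (mk_edge (setU11 bar (graph_image f1 E1 :|: graph_image f2 E2))).
  set wb := w _.
  exists ((dot (p (f1 c1) - p (f2 c2))
    (v1 c1 - (v2 c2 + t + cross om0 (p (f2 c2) - p (f1 x1)))) - wb) / vol).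
  rewrite crossDl crossZl !opprD !addrA dotBr dotZr -/vol divfK //.
  by rewrite subKr.
pose om := om0 + k *: u.
have omu : cross om u = dd y1 y2 - t by rewrite crossDl crossZl cross_self scaler0 addr0.
pose v2' b := v2 b + t + cross om (p (f2 b) - p (f1 x1)).
have agree a b : f1 a = f2 b -> v1 a = v2' b.
  move=> fab; rewrite /v2' -fab; case: (overlap fab) => -[-> ->].
  - by rewrite subrr cross0 addr0 /t /dd addrC subrK.
  - by rewrite -/u omu addrACA subrr addr0 /dd addrC subrK.
have [vel [hvel1 hvel2]] := merge_velocities agree.
exists vel => e a b eab; have : val e \in E by apply: valP.
case/setU1P => [ebar|/setUP [] he].
- have -> : w e = w (mk_edge (setU11 bar (graph_image f1 E1 :|: graph_image f2 E2))).
    by congr w; apply/val_inj.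
  rewrite -hk; move: ebar; rewrite eab => /set2_eq [[-> ->]|[-> ->]]; rewrite hvel1 hvel2 //.
  rewrite -[in LHS](opprB (p (f1 c1))) -[in LHS](opprB (v1 c1)).
  by rewrite !dot_coord !mxE !mulrNN.
- exact: (edge_equation_pull f1inj hvel1 h1 he eab).
- refine (edge_equation_pull f2inj hvel2 _ he eab) => e' a' b' e'ab.
  by rewrite /v2' rate_motion; apply: h2.
Qed.

(* A direct isometry between the two parts is a rotation about the common
   edge; the bar leaves two of these rotations. *)
Lemma hinge_glue_covers (R : realType) N1 N2 :
  nondegenerate_triangle R E1 x1 y1 c1 -> nondegenerate_triangle R E2 x2 y2 c2 ->
  covers R E1 N1 -> covers R E2 N2 -> covers R E (2 * (N1 * N2)).
Proof.
move=> /(generic_pull (edge_image_inj f1inj (sub := sub1))) nd1.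
move=> /(generic_pull (edge_image_inj f2inj (sub := sub2))) nd2.
move=> /(covers_pull f1inj sub1) cov1 /(covers_pull f2inj sub2) cov2.
apply: generic_mono (generic_and (generic_and cov1 cov2) (generic_and nd1 nd2)).
move=> l [[[rep1 h1] [rep2 h2]] [g1 g2]].
apply: (@cover_fibres2 _ _ _ _ _ (fun ij rho => directly_congruent (rep1 ij.1) (rho \o f1) /\
   directly_congruent (rep2 ij.2) (rho \o f2))); first by rewrite card_prod !card_ord.
  by move=> rho hrho; have [i hi] := h1 _ hrho; have [j hj] := h2 _ hrho; exists (i, j).
move=> [i j] r1 r2 r3 H1 H2 H3 /= [i1 j1] [i2' j2] [i3 j3].
have part (W : finType) (f : W -> V) (rep r r' : _ -> 'rV[R[i]]_3) :
    directly_congruent rep (r \o f) -> directly_congruent rep (r' \o f) ->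
    exists A t, [/\ A *m A^T = 1%:M, \det A = 1 & forall a, r' (f a) = r (f a) *m A + t].
  move=> h h'; apply: (directly_congruent_trans _ h').
  exact: directly_congruent_sym.
have dif (A : 'M[R[i]]_3) t (W : finType) (f : W -> V) (r r' : V -> 'rV[R[i]]_3) :
    (forall a, r' (f a) = r (f a) *m A + t) ->
    forall a b, r' (f a) - r' (f b) = (r (f a) - r (f b)) *m A.
  by move=> h a b; rewrite !h opprD addrACA subrr addr0 -mulmxBl.
pose u r : 'rV[R[i]]_3 := r (f1 y1) - r (f1 x1).
pose v r : 'rV[R[i]]_3 := r (f1 c1) - r (f1 x1).
pose w r : 'rV[R[i]]_3 := r (f2 c2) - r (f1 x1).
have uv r : compatible l r -> gram (u r) (v r) != 0.
  by move=> /(compatible_pull sub1) /g1.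
have uw r : compatible l r -> gram (u r) (w r) != 0.
  by move=> /(compatible_pull sub2) /g2; rewrite /= -fx -fy.
have glue r r' A t : compatible l r -> A *m A^T = 1%:M -> \det A = 1 ->
    (forall a, r' (f1 a) = r (f1 a) *m A + t) ->
    directly_congruent (rep2 j) (r \o f2) -> directly_congruent (rep2 j) (r' \o f2) ->
    w r' = w r *m A -> directly_congruent r r'.
  move=> Hr hA dA hAt hj hj' wA; have [B [s [hB dB hBs]]] := part _ _ _ _ _ hj hj'.
  have AB : A = B.
    apply: (orthogonal_agree hA dA hB dB _ _ (uw _ Hr)).
      by rewrite -(dif _ _ _ _ _ _ hAt) /u fx fy (dif _ _ _ _ _ _ hBs).
    by rewrite -wA /w fx (dif _ _ _ _ _ _ hBs).
  exact: congruent_of_parts hA dA fx AB hAt hBs.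
have [A2 [t2 [hA2 dA2 h12]]] := part _ _ _ _ _ i1 i2'.
have [A3 [t3 [hA3 dA3 h13]]] := part _ _ _ _ _ i1 i3.
(* Moved back into the frame of [r1], the tip of the second part keeps its inner products with the
   hinge, with v (by the bar) and with itself; [three_spheres] then leaves two positions. *)
have dots r A t : compatible l r -> A *m A^T = 1%:M ->
    (forall a, r (f1 a) = r1 (f1 a) *m A + t) ->
    directly_congruent (rep2 j) (r \o f2) ->
    [/\ dot (w r *m A^T) (u r1) = dot (w r1) (u r1), dot (w r *m A^T) (v r1) = dot (w r1) (v r1)
      & dot (w r *m A^T) (w r *m A^T) = dot (w r1) (w r1)].
  move=> Hr hA hAt hj.
  have back z z' : dot (z *m A^T) z' = dot z (z' *m A).
    by rewrite /dot trmx_mul mulmxA.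
  have [B [s [hB _ hBs]]] := part _ _ _ _ _ j1 hj.
  have sq2 a b : sqdist (r (f2 a)) (r (f2 b)) = sqdist (r1 (f2 a)) (r1 (f2 b)).
    by rewrite !sqdistE (dif _ _ _ _ _ _ hBs) dot_orthogonal.
  have sq1 a b : sqdist (r (f1 a)) (r (f1 b)) = sqdist (r1 (f1 a)) (r1 (f1 b)).
    by rewrite !sqdistE (dif _ _ _ _ _ _ hAt) dot_orthogonal.
  have bar_len r' : compatible l r' -> sqdist (r' (f2 c2)) (r' (f1 c1)) =
      l (mk_edge (setU11 bar (graph_image f1 E1 :|: graph_image f2 E2))).
    by move=> Hr'; apply: Hr'; rewrite /= setUC.
  split.
  - rewrite back -(dif _ _ _ _ _ _ hAt) /w /u !polarization fx fy !sq2.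
    by [].
  - rewrite back -(dif _ _ _ _ _ _ hAt) /w !polarization (bar_len _ Hr) (bar_len _ H1) sq1.
    by rewrite fx sq2.
  - rewrite dot_orthogonal ?trmxK ?(mulmx1C hA) // /w -!sqdistE fx sq2.
    by [].
have wA r (A : 'M[R[i]]_3) : A *m A^T = 1%:M -> w r *m A^T *m A = w r.
  by move=> hA; rewrite -mulmxA (mulmx1C hA) mulmx1.
case: (three_spheres (uv _ H1) (dots _ _ _ H2 hA2 h12 j2) (dots _ _ _ H3 hA3 h13 j3)) => hw.
- by apply: Or31; apply: (glue _ _ _ _ H1 hA2 dA2 h12 j1 j2); rewrite hw wA.
- by apply: Or32; apply: (glue _ _ _ _ H1 hA3 dA3 h13 j1 j3); rewrite hw wA.
- apply: Or33; apply: (glue r2 r3 (A2^T *m A3) (- t2 *m A2^T *m A3 + t3) H2 _ _ _ j2 j3).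
  + by rewrite trmx_mul trmxK mulmxA -(mulmxA A2^T) hA3 mulmx1 (mulmx1C hA2).
  + by rewrite det_mulmx det_tr dA2 dA3 mulr1.
  + move=> a; rewrite h13 h12 mulmxA mulmxDl -(mulmxA (r1 (f1 a))) hA2 mulmx1.
    by rewrite addrA -mulmxDl mulNmx addrK.
  + by rewrite mulmxA hw wA.
Qed.

End Hinge.

End Glue.

(** * Computable polynomials in four variables *)

(* Bare operations, so that one and the same program runs on binary integers,
   on multivariate polynomials and on field elements. *)
Record ops := Ops {
  car :> Type; ozero : car; oadd : car -> car -> car; oopp : car -> car;
  omul : car -> car -> car }.

Definition ring_ops (R : comNzRingType) : ops :=
  Ops (0 : R) +%R -%R *%R.

Record hom (O O' : ops) (f : O -> O') : Prop := Hom {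
  hom0 : f (ozero O) = ozero O';
  homD : forall a b, f (oadd a b) = oadd (f a) (f b);
  homN : forall a, f (oopp a) = oopp (f a);
  homM : forall a b, f (omul a b) = omul (f a) (f b) }.

Lemma hom_rmorphism (R S : comNzRingType) (f : {rmorphism R -> S}) :
  @hom (ring_ops R) (ring_ops S) f.
Proof. by split=> *; rewrite /= (rmorph0, rmorphD, rmorphN, rmorphM). Qed.

Section Univariate.
Variable O : ops.

Fixpoint padd (p q : seq O) : seq O :=
  match p, q with
  | [::], _ => q
  | _, [::] => p
  | a :: p', b :: q' => oadd a b :: padd p' q'
  end.

Fixpoint pmul (p q : seq O) : seq O :=
  if p is a :: p' then padd (map (omul a) q) (ozero O :: pmul p' q) else [::].

(** Coefficients with the constant term first, never normalized: no zero test is needed, and the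
    shape of a result does not depend on the coefficients. *)
Definition poly_ops : ops := @Ops (seq O) [::] padd (map (@oopp O)) pmul.

End Univariate.

Lemma hom_map (O O' : ops) (f : O -> O') : hom f -> @hom (poly_ops O) (poly_ops O') (map f).
Proof.
move=> [h0 hD hN hM].
have padd_map p q : map f (padd p q) = padd (map f p) (map f q).
  by elim: p q => [|a p IHp] [|b q] //=; rewrite hD IHp.
split=> //= [p|p q].
  by rewrite -!map_comp; apply: eq_map => a /=.
elim: p => //= a p IHp; rewrite padd_map /= h0 IHp -!map_comp.
by congr padd; apply: eq_map => b /=.
Qed.

Definition peval (O : ops) (R : comNzRingType) (f : O -> R) (x : R) (p : seq O) : R :=
  foldr (fun a acc => f a + x * acc) 0 p.

Lemma hom_peval (O : ops) (R : comNzRingType) (f : O -> ring_ops R) (x : R) :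
  hom f -> @hom (poly_ops O) (ring_ops R) (peval f x).
Proof.
move=> [h0 hD hN hM].
have padd_eval p q : peval f x (padd p q) = peval f x p + peval f x q.
  elim: p q => [|a p IHp] [|b q] //=; rewrite ?add0r ?addr0 // hD IHp mulrDr.
  by rewrite addrACA.
split=> //= [p|p q].
  by elim: p => [|a p IHp] /=; rewrite ?oppr0 // hN IHp opprD mulrN.
elim: p => [|a p IHp] /=; first by rewrite mul0r.
rewrite padd_eval /= h0 IHp add0r mulrDl mulrA; congr (_ + _).
elim: q {IHp} => [|b q IHq] /=; first by rewrite mulr0.
by rewrite hM IHq mulrDr mulrCA.
Qed.

Section Terms.
Variables (O : ops) (T : Type) (tm : O -> seq (seq nat * T)).

Fixpoint terms_from (i : nat) (p : seq O) : seq (seq nat * T) :=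
  if p is a :: p' then [seq (i :: mv.1, mv.2) | mv <- tm a] ++ terms_from i.+1 p' else [::].

End Terms.

Definition poly4_ops (O : ops) := poly_ops (poly_ops (poly_ops (poly_ops O))).

Definition terms4 (O : ops) : poly4_ops O -> seq (seq nat * O) :=
  @terms_from (poly_ops (poly_ops (poly_ops O))) O
    (@terms_from (poly_ops (poly_ops O)) O
      (@terms_from (poly_ops O) O
        (@terms_from O O (fun a => [:: ([::], a)]) 0) 0) 0) 0.

Definition peval4 (R : comNzRingType) (t1 t2 t3 t4 : R) : poly4_ops (ring_ops R) -> R :=
  @peval (poly_ops (poly_ops (poly_ops (ring_ops R)))) R
    (@peval (poly_ops (poly_ops (ring_ops R))) R
      (@peval (poly_ops (ring_ops R)) R (@peval (ring_ops R) R id t4) t3) t2) t1.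

Lemma hom_peval4 (R : comNzRingType) (t1 t2 t3 t4 : R) :
  @hom (poly4_ops (ring_ops R)) (ring_ops R) (peval4 t1 t2 t3 t4).
Proof. by do 4!apply: hom_peval; split. Qed.

Definition map4 (O O' : ops) (f : O -> O') : poly4_ops O -> poly4_ops O' :=
  map (map (map (map f))).

Lemma hom_map4 (O O' : ops) (f : O -> O') : hom f -> hom (map4 f).
Proof. by move=> hf; do 4!apply: hom_map. Qed.

Lemma terms_from_map (O O' : ops) (T T' : Type) (tm : O -> seq (seq nat * T))
    (tm' : O' -> seq (seq nat * T')) (f : O -> O') (g : T -> T') :
  (forall a, tm' (f a) = [seq (mv.1, g mv.2) | mv <- tm a]) ->
  forall i p, terms_from tm' i (map f p) = [seq (mv.1, g mv.2) | mv <- terms_from tm i p].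
Proof.
move=> h i p; elim: p i => //= a p IHp i.
by rewrite map_cat IHp h -!map_comp.
Qed.

Lemma terms4_map (O O' : ops) (f : O -> O') (p : poly4_ops O) :
  terms4 (map4 f p) = [seq (mv.1, f mv.2) | mv <- terms4 p].
Proof.
apply: (@terms_from_map (poly_ops (poly_ops (poly_ops O))) (poly_ops (poly_ops (poly_ops O')))
  O O' _ _ (map (map (map f))) f) => p3.
apply: (@terms_from_map (poly_ops (poly_ops O)) (poly_ops (poly_ops O'))
  O O' _ _ (map (map f)) f) => p2.
apply: (@terms_from_map (poly_ops O) (poly_ops O') O O' _ _ (map f) f) => p1.
by apply: (@terms_from_map O O' O O' _ _ f f).
Qed.

Fixpoint mono_val (R : comNzRingType) (t : seq R) (m : seq nat) : R :=
  match t, m with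
  | x :: t', e :: m' => x ^+ e * mono_val t' m'
  | _, _ => 1
  end.

Definition terms_val (R : comNzRingType) (t : seq R) (l : seq (seq nat * R)) : R :=
  \sum_(mv <- l) mv.2 * mono_val t mv.1.

Lemma terms_val_cat (R : comNzRingType) (t : seq R) l1 l2 :
  terms_val t (l1 ++ l2) = terms_val t l1 + terms_val t l2.
Proof. exact: big_cat. Qed.

Lemma terms_from_val (O : ops) (R : comNzRingType) (tm : O -> seq (seq nat * R))
    (f : O -> R) (x : R) (t : seq R) :
  (forall a, terms_val t (tm a) = f a) ->
  forall i p, terms_val (x :: t) (terms_from tm i p) = x ^+ i * peval f x p.
Proof.
move=> h i p; elim: p i => [|a p IHp] i /=; first by rewrite /terms_val big_nil mulr0.
rewrite terms_val_cat IHp mulrDr exprSr -mulrA; congr (_ + _).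
rewrite -h /terms_val big_map mulr_sumr; apply: eq_bigr => mv _ /=.
by rewrite mulrCA.
Qed.

Lemma terms4_val (R : comNzRingType) (t1 t2 t3 t4 : R) (p : poly4_ops (ring_ops R)) :
  terms_val [:: t1; t2; t3; t4] (terms4 p) = peval4 t1 t2 t3 t4 p.
Proof.
have h4 p4 : terms_val [:: t4] (@terms_from (ring_ops R) _ (fun a => [:: ([::], a)]) 0 p4) =
    @peval (ring_ops R) R id t4 p4.
  rewrite (@terms_from_val (ring_ops R) R _ id) ?mul1r // => a.
  by rewrite /terms_val big_seq1 /= mulr1.
have h3 p3 := @terms_from_val (poly_ops (ring_ops R)) R _ _ t3 [:: t4] h4 0 p3.
have h2 p2 := @terms_from_val (poly_ops (poly_ops (ring_ops R))) R _ _ t2 [:: t3; t4]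
  (fun a => etrans (h3 a) (mul1r _)) 0 p2.
have h1 := @terms_from_val (poly_ops (poly_ops (poly_ops (ring_ops R)))) R _ _ t1 [:: t2; t3; t4]
  (fun a => etrans (h2 a) (mul1r _)) 0 p.
exact: etrans h1 (mul1r _).
Qed.

Definition mono_add (e m : seq nat) : seq nat := [seq x.1 + x.2 | x <- zip e m]%N.

Lemma mono_val_add (R : comNzRingType) (t : seq R) e m : size e = size t -> size m = size t ->
  mono_val t (mono_add e m) = mono_val t e * mono_val t m.
Proof.
elim: t e m => [|x t IHt] [|a e] [|b m] //=; first by rewrite mulr1.
by move=> [se] [sm]; rewrite IHt // exprD mulrACA.
Qed.

Inductive expr := EVar of nat | EAdd of expr & expr | EOpp of expr | EMul of expr & expr.

Fixpoint interp (O : ops) (env : seq O) (e : expr) : O :=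
  match e with
  | EVar n => nth (ozero O) env n
  | EAdd a b => oadd (interp env a) (interp env b)
  | EOpp a => oopp (interp env a)
  | EMul a b => omul (interp env a) (interp env b)
  end.

Lemma interp_hom (O O' : ops) (f : O -> O') (env : seq O) e : hom f ->
  f (interp env e) = interp (map f env) e.
Proof.
move=> [h0 hD hN hM]; elim: e => /= [n|a IHa b IHb|a IHa|a IHa b IHb]; rewrite ?hD ?hN ?hM ?IHa ?IHb //.
have [hn|hn] := ltnP n (size env); first by rewrite (nth_map (ozero O)).
by rewrite !nth_default ?size_map.
Qed.

Lemma terms_from_size (O : ops) (T : Type) (tm : O -> seq (seq nat * T)) n :
  (forall a, all (fun mv => size mv.1 == n) (tm a)) ->
  forall i p, all (fun mv => size mv.1 == n.+1) (terms_from tm i p).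
Proof. by move=> h i p; elim: p i => //= a p IHp i; rewrite all_cat all_map /= h IHp. Qed.

Lemma terms4_size (O : ops) (p : poly4_ops O) : all (fun mv => size mv.1 == 4) (terms4 p).
Proof. by do 4!apply: terms_from_size => ?. Qed.

(** * Sparse Gaussian elimination modulo 23 *)

Definition sparse := seq (Z * Z).

Definition redp (a : Z) : Z := Z.modulo a 23.

Definition scale_row (f : Z) (r : sparse) : sparse :=
  [seq (ia.1, redp (Z.mul f ia.2)) | ia <- r].

Arguments redp : simpl never.
Arguments scale_row : simpl never.

(* [r - f * q], for rows sorted by column. *)
Fixpoint sub_row (f : Z) (r : sparse) : sparse -> sparse :=
  fix aux (q : sparse) :=
    match r, q with
    | [::], _ => scale_row (Z.opp f) q
    | _, [::] => r
    | (i, a) :: r', (j, b) :: q' =>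
      match Z.compare i j with
      | Lt => (i, a) :: sub_row f r' q
      | Gt => (j, redp (Z.opp (Z.mul f b))) :: aux q'
      | Eq => let v := redp (Z.sub a (Z.mul f b)) in
              if Z.eqb v 0 then sub_row f r' q' else (i, v) :: sub_row f r' q'
      end
    end.

(** Pivots are ordered by leading column. By Fermat, a^21 is the inverse of a modulo 23, so a new
    pivot gets leading entry 1. *)
Fixpoint insert_row (pivs : seq sparse) (r : sparse) : seq sparse :=
  match r with
  | [::] => pivs
  | (i, a) :: _ =>
    match pivs with
    | (((j, b) :: _) as pv) :: ps =>
      match Z.compare i j with
      | Lt => scale_row (Z.pow a 21) r :: pivs
      | Gt => pv :: insert_row ps r
      | Eq => pv :: insert_row ps (sub_row a r pv)
      end
    | _ => [:: scale_row (Z.pow a 21) r]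
    end
  end.

Definition echelon (rows : seq sparse) : seq sparse := foldl insert_row [::] rows.

(* Rows with leading entry 1 in the columns from [k] to [n - 1] and all other
   entries below column [N]. *)
Fixpoint unitriangular (k n N : Z) (pivs : seq sparse) : bool :=
  match pivs with
  | [::] => Z.eqb k n
  | ((i, a) :: r) :: ps =>
    [&& Z.eqb i k, Z.eqb a 1, all (fun jb => Z.ltb k jb.1 && Z.ltb jb.1 N) r
      & unitriangular (Z.succ k) n N ps]
  | _ => false
  end.

Definition F23 : fieldType := 'F_23.

Definition zf (a : Z) : F23 := (int_of_Z a)%:~R.

Lemma zfD a b : zf (Z.add a b) = zf a + zf b.
Proof. by rewrite /zf (rmorphD int_of_Z a b) rmorphD. Qed.

Lemma zfN a : zf (Z.opp a) = - zf a.
Proof. by rewrite /zf (rmorphN int_of_Z a) rmorphN. Qed.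

Lemma zfM a b : zf (Z.mul a b) = zf a * zf b.
Proof. by rewrite /zf (rmorphM int_of_Z a b) rmorphM. Qed.

Lemma zf_redp a : zf (redp a) = zf a.
Proof.
rewrite [in RHS](Z.div_mod a 23) // zfD zfM.
have -> : zf 23 = 0 by apply/val_inj.
by rewrite mul0r add0r.
Qed.

Section Soundness.
Variable x : Z -> F23.

Definition row_val (r : sparse) : F23 := \sum_(ia <- r) zf ia.2 * x ia.1.

Lemma row_val_cons i a r : row_val ((i, a) :: r) = zf a * x i + row_val r.
Proof. by rewrite /row_val big_cons. Qed.

Lemma row_val_scale f r : row_val (scale_row f r) = zf f * row_val r.
Proof.
rewrite /row_val big_map mulr_sumr; apply: eq_bigr => ia _ /=.
by rewrite zf_redp zfM mulrA.
Qed.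

Lemma row_val_sub f r q : row_val (sub_row f r q) = row_val r - zf f * row_val q.
Proof.
elim: r q => [|[i a] r IHr] q /=.
  have -> : (fix aux (q0 : sparse) : sparse := scale_row (Z.opp f) q0) q = scale_row (Z.opp f) q.
    by case: q.
  by rewrite row_val_scale zfN mulNr /row_val big_nil add0r.
elim: q => [|[j b] q IHq]; first by rewrite /row_val big_nil mulr0 subr0.
case: (Z.compare_spec i j) => [ij|_|_].
- rewrite -ij; set v := redp _.
  have hv : zf v = zf a - zf f * zf b by rewrite zf_redp zfD zfN zfM.
  have -> : row_val ((i, a) :: r) - zf f * row_val ((i, b) :: q) =
      zf v * x i + (row_val r - zf f * row_val q).
    by rewrite !row_val_cons hv mulrDr mulrBl opprD mulrA addrACA.
  case: Z.eqb_spec => [v0|_]; last by rewrite row_val_cons IHr.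
  by rewrite IHr v0 mul0r add0r.
- by rewrite row_val_cons IHr addrA -row_val_cons.
- by rewrite row_val_cons IHq (row_val_cons j b) zf_redp zfN zfM mulrDr opprD mulNr mulrA addrCA.
Qed.

Arguments sub_row : simpl never.

Definition all_zero (rows : seq sparse) := forall r, r \in rows -> row_val r = 0.

(** Elimination only forms linear combinations, so kernel vectors stay in the kernel. Nothing has to
    be proved about the echelon shape, which [unitriangular] checks on the result. *)
Lemma insert_row_zero pivs r : all_zero pivs -> row_val r = 0 -> all_zero (insert_row pivs r).
Proof.
elim: pivs r => [|pv ps IH] [|[i a] r] hp hr //.
  by move=> s; rewrite inE => /eqP ->; rewrite row_val_scale hr mulr0.
have hps : all_zero ps by move=> s hs; apply: hp; rewrite inE hs orbT.
case: pv hp => [|[j b] pv] hp /=.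
  by move=> s; rewrite inE => /eqP ->; rewrite row_val_scale hr mulr0.
have hpv : row_val ((j, b) :: pv) = 0 by apply: hp; rewrite inE eqxx.
case: Z.compare => s; rewrite in_cons => /orP [/eqP ->|hs].
- exact: hpv.
- refine (IH _ hps _ _ hs).
  by rewrite row_val_sub hr hpv mulr0 subr0.
- by rewrite row_val_scale hr mulr0.
- exact: hp.
- exact: hpv.
- exact: (IH ((i, a) :: r) hps hr).
Qed.

Lemma foldl_insert_zero pivs rows : all_zero pivs -> all_zero rows ->
  all_zero (foldl insert_row pivs rows).
Proof.
elim: rows pivs => [|r rows IH] ps hps hrows //=.
apply: IH => [|s hs]; last by apply: hrows; rewrite inE hs orbT.
by apply: insert_row_zero => //; apply: hrows; rewrite inE eqxx.
Qed.

Lemma unitriangular_zero k n N pivs : unitriangular k n N pivs -> all_zero pivs ->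
  (forall i, Z.le n i -> Z.lt i N -> x i = 0) ->
  forall i, Z.le k i -> Z.lt i N -> x i = 0.
Proof.
elim: pivs k => [|[|[j a] r] ps IH] k //=; first by move=> /Z.eqb_spec ->.
case/and4P => /Z.eqb_spec -> /Z.eqb_spec -> /allP hr tri hz hx i ki ilt.
have hps : all_zero ps by move=> s hs; apply: hz; rewrite inE hs orbT.
have rest := IH _ tri hps hx.
have [e|ne] := Z.eq_dec i k; last first.
  by apply: rest => //; apply: Zlt_le_succ; case: (Z.le_lteq k i) => /(_ ki) [//|e]; case: ne.
have := hz ((k, Zpos xH) :: r); rewrite inE eqxx => /(_ isT).
rewrite row_val_cons /row_val big_seq big1 => [|[j' b] /hr /andP [/Z.ltb_spec0 h1 /Z.ltb_spec0 h2]].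
  by rewrite e addr0 /zf /= mul1r.
by rewrite (rest j') ?mulr0 //; apply: Zlt_le_succ.
Qed.

End Soundness.

(* The polynomial system for K_{4,6} and the data of its elimination *)
Declare Scope expr_scope.
Delimit Scope expr_scope with E.
Bind Scope expr_scope with expr.
Notation "a + b" := (EAdd a b) : expr_scope.
Notation "- a" := (EOpp a) : expr_scope.
Notation "a - b" := (EAdd a (EOpp b)) : expr_scope.
Notation "a * b" := (EMul a b) : expr_scope.

Section Generators.
Local Open Scope expr_scope.
Variables H11 H12 H13 H22 H23 H33 h1 h2 h3 c s : expr.

Let a11 := H22 * H33 - H23 * H23.
Let a12 := H13 * H23 - H12 * H33.
Let a13 := H12 * H23 - H13 * H22.
Let a22 := H11 * H33 - H13 * H13.
Let a33 := H11 * H22 - H12 * H12.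

(** With h = Hp the adjugate of H sends h to det(H) p, and the first entry of det(H) p is a11
    because p is the diagonal of the inverse of H. The factor [s] scales all quantities to make the
    equation homogeneous. *)
Definition gen_k := a11 * (h1 - s) + a12 * h2 + a13 * h3.

Definition gen_d := c * (H11 * a11 + H12 * a12 + H13 * a13) -
  s * (h1 * a11 + h2 * a22 + h3 * a33).

(** [gen_k] and [gen_d] vanish identically where H has rank at most one; these further relations,
    valid for invertible H, do not. *)
Definition gen_q :=
  h1 * h1 * (H22 * (H33 + H23))
  - h1 * h2 * (H23 * (H33 + H23) + H13 * H22 + H12 * (H33 + H33 + H23))
  + h1 * h3 * (H22 * (H33 + H23))
  + h2 * h2 * (H13 * (H33 + H23 + H23 + H13) + H12 * (H13 - H33))
  - h2 * h3 * (H13 * H22 + H12 * H33)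
  + c * (H12 * H33 * (H23 + H22 + H12) - H13 * H22 * (H33 + H23 + H13))
  + s * h1 * (H22 * (H13 - H33 - H23) + H12 * H23)
  + s * h2 * (H23 * (H23 + H12) + H22 * (H13 - H33) + H12 * (H33 - H13))
  - s * h3 * (H12 * (H22 + H12))
  - s * s * (H13 * H22 + H12 * H23).
End Generators.

(* Variables: the entries H11, H12, H13, H22, H23, H33 of the inverse Gram
   matrix, h1, h2, h3, c, and the homogenizing variable. *)
Definition generators : seq expr :=
  let v := EVar in
  [:: gen_k (v 1) (v 2) (v 3) (v 4) (v 5) (v 6) (v 7) (v 8) (v 10);
      gen_k (v 1) (v 4) (v 0) (v 2) (v 5) (v 7) (v 6) (v 8) (v 10);
      gen_k (v 4) (v 2) (v 3) (v 1) (v 0) (v 8) (v 7) (v 6) (v 10);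
      gen_d (v 0) (v 1) (v 2) (v 3) (v 4) (v 5) (v 6) (v 7) (v 8) (v 9) (v 10);
      gen_q (v 1) (v 2) (v 3) (v 4) (v 5) (v 6) (v 7) (v 8) (v 9) (v 10);
      gen_q (v 2) (v 1) (v 5) (v 4) (v 3) (v 6) (v 8) (v 7) (v 9) (v 10);
      gen_q (v 1) (v 4) (v 0) (v 2) (v 5) (v 7) (v 6) (v 8) (v 9) (v 10);
      gen_q (v 4) (v 1) (v 5) (v 2) (v 0) (v 7) (v 8) (v 6) (v 9) (v 10);
      gen_q (v 2) (v 4) (v 0) (v 1) (v 3) (v 8) (v 6) (v 7) (v 9) (v 10);
      gen_q (v 4) (v 2) (v 3) (v 1) (v 0) (v 8) (v 7) (v 6) (v 9) (v 10)].

Definition m4 (a b c d : nat) : seq nat := [:: a; b; c; d].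

(* Pivot columns and rows, in an elimination order with little fill-in. *)
Definition pivot_monos : seq (seq nat) := [::
  m4 3 0 0 0; m4 2 1 0 0; m4 2 0 0 1; m4 0 0 6 0; m4 0 6 0 0; m4 6 0 0 0; m4 1 0 5 0;
  m4 0 0 0 6; m4 0 5 1 0; m4 5 0 1 0; m4 5 1 0 0; m4 5 0 0 0; m4 0 0 5 1; m4 4 0 0 0;
  m4 0 5 0 1; m4 5 0 0 1; m4 0 0 5 0; m4 0 0 1 5; m4 0 1 0 5; m4 0 5 0 0; m4 0 4 0 0;
  m4 0 1 5 0; m4 1 5 0 0; m4 4 0 2 0; m4 2 0 4 0; m4 4 0 0 2; m4 1 0 4 0; m4 3 0 0 1;
  m4 0 3 1 0; m4 0 2 4 0; m4 0 3 3 0; m4 4 1 0 0; m4 2 0 2 0; m4 0 0 4 2; m4 1 4 1 0;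
  m4 0 1 0 3; m4 4 0 0 1; m4 1 0 4 1; m4 0 4 0 2; m4 4 1 0 1; m4 0 4 1 0; m4 0 1 1 4;
  m4 2 4 0 0; m4 0 4 0 1; m4 2 0 0 2; m4 0 0 4 1; m4 0 4 1 1; m4 1 0 0 3; m4 3 1 0 0;
  m4 1 0 0 4; m4 0 1 0 4; m4 1 4 0 0; m4 4 0 1 0; m4 0 4 2 0; m4 0 1 3 0; m4 1 3 0 0;
  m4 2 2 0 0; m4 3 0 3 0; m4 3 1 0 2; m4 3 0 2 0; m4 2 0 3 0; m4 1 2 1 0; m4 1 0 3 0;
  m4 0 2 2 0; m4 3 0 1 0; m4 2 1 1 0; m4 1 1 2 0; m4 2 3 0 0; m4 0 0 3 3; m4 1 0 0 5;
  m4 0 3 0 1; m4 4 1 1 0; m4 1 0 3 1; m4 2 0 2 1; m4 2 1 0 3; m4 3 0 0 2; m4 0 2 3 0;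
  m4 0 3 2 0; m4 4 0 1 1; m4 1 1 0 4; m4 0 1 4 0; m4 3 0 2 1; m4 2 0 3 1; m4 2 0 0 3;
  m4 3 0 1 1; m4 0 2 3 1; m4 0 1 4 1; m4 1 1 4 0; m4 3 1 2 0; m4 1 3 2 0; m4 1 2 3 0;
  m4 2 1 3 0; m4 2 3 1 0; m4 4 2 0 0; m4 2 2 2 0; m4 3 2 1 0; m4 3 3 0 0; m4 0 2 0 4;
  m4 2 0 0 4; m4 0 2 0 3; m4 0 2 1 1; m4 0 3 0 3; m4 0 3 0 2; m4 0 1 1 2; m4 3 2 0 0;
  m4 3 0 0 3; m4 2 0 1 2; m4 0 1 2 1; m4 2 1 0 1; m4 1 1 0 2; m4 1 2 0 1; m4 1 0 1 3;
  m4 0 0 3 2; m4 0 0 1 4; m4 0 0 2 3; m4 1 0 2 2; m4 2 1 1 1; m4 0 2 0 2; m4 0 1 1 3;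
  m4 1 3 0 1; m4 0 2 1 2; m4 1 1 1 2; m4 1 2 1 1; m4 2 1 2 0; m4 1 0 2 1; m4 1 1 1 1;
  m4 1 3 1 0; m4 1 2 2 0; m4 2 1 0 2; m4 1 0 1 2; m4 1 1 0 3; m4 2 2 0 1; m4 0 3 1 1;
  m4 1 2 0 2; m4 2 2 1 0; m4 2 0 1 3; m4 0 0 2 4; m4 2 0 1 1; m4 1 1 2 1; m4 3 1 0 1;
  m4 0 1 2 2; m4 1 0 1 4; m4 3 0 1 2; m4 2 0 2 2; m4 1 0 2 3; m4 1 0 3 2; m4 0 3 2 1;
  m4 0 1 3 1; m4 0 2 2 2; m4 0 3 1 2; m4 2 3 0 1; m4 1 1 3 0; m4 1 3 1 1; m4 3 1 1 0;
  m4 0 1 3 2; m4 1 2 2 1; m4 2 2 1 1; m4 3 1 1 1; m4 1 2 1 2; m4 1 1 3 1; m4 1 1 2 2;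
  m4 2 2 0 2; m4 0 2 1 3; m4 0 2 2 1; m4 1 4 0 1; m4 0 1 2 3; m4 1 1 1 3; m4 1 2 0 3;
  m4 3 2 0 1; m4 1 3 0 2; m4 2 1 1 2; m4 2 1 2 1].

(** All have degree at most 5, so their products with a linear form stay among [monos]. *)
Definition basis_monos : seq (seq nat) := [::
  m4 0 0 0 0; m4 0 0 0 1; m4 0 0 1 0; m4 0 1 0 0; m4 1 0 0 0; m4 0 0 0 2; m4 0 0 1 1;
  m4 0 0 2 0; m4 0 1 0 1; m4 0 1 1 0; m4 0 2 0 0; m4 1 0 0 1; m4 1 0 1 0; m4 1 1 0 0;
  m4 2 0 0 0; m4 0 0 0 3; m4 0 0 1 2; m4 0 0 2 1; m4 0 0 3 0; m4 0 1 0 2; m4 0 1 1 1;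
  m4 0 1 2 0; m4 0 2 0 1; m4 0 2 1 0; m4 0 3 0 0; m4 1 0 0 2; m4 1 0 1 1; m4 1 0 2 0;
  m4 1 1 0 1; m4 1 1 1 0; m4 1 2 0 0; m4 2 0 1 0; m4 0 0 0 4; m4 0 0 1 3; m4 0 0 2 2;
  m4 0 0 3 1; m4 0 0 4 0; m4 0 0 0 5].

(** A pair is the position of a generator and the exponents of the monomial multiplying it. *)
Definition pivot_rows : seq (nat * seq nat) := [::
  (0, m4 0 0 0 0); (1, m4 0 0 0 0); (2, m4 0 0 0 0); (1, m4 0 0 3 0); (1, m4 0 3 0 0);
  (1, m4 3 0 0 0); (2, m4 0 0 3 0); (3, m4 0 0 0 2); (0, m4 0 3 0 0); (1, m4 2 0 1 0);
  (1, m4 2 1 0 0); (1, m4 2 0 0 0); (1, m4 0 0 2 1); (1, m4 1 0 0 0); (1, m4 0 2 0 1);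
  (1, m4 2 0 0 1); (1, m4 0 0 2 0); (1, m4 0 0 0 3); (0, m4 0 0 0 3); (1, m4 0 2 0 0);
  (1, m4 0 1 0 0); (1, m4 0 1 2 0); (1, m4 1 2 0 0); (0, m4 2 0 1 0); (2, m4 2 0 1 0);
  (1, m4 1 0 0 2); (2, m4 0 0 2 0); (1, m4 0 0 0 1); (1, m4 0 0 1 0); (2, m4 0 1 2 0);
  (0, m4 0 1 2 0); (1, m4 1 1 0 0); (0, m4 0 0 1 0); (1, m4 0 0 1 2); (0, m4 1 2 0 0);
  (3, m4 0 0 0 0); (1, m4 1 0 0 1); (2, m4 0 0 2 1); (2, m4 0 2 0 1); (1, m4 1 1 0 1);
  (1, m4 0 1 1 0); (2, m4 0 0 1 2); (2, m4 1 2 0 0); (1, m4 0 1 0 1); (0, m4 0 0 0 1);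
  (1, m4 0 0 1 1); (1, m4 0 1 1 1); (2, m4 0 0 0 1); (6, m4 0 0 0 0); (1, m4 0 0 0 2);
  (0, m4 0 0 0 2); (2, m4 1 1 0 0); (1, m4 1 0 1 0); (5, m4 0 1 1 0); (2, m4 0 0 1 0);
  (2, m4 1 0 0 0); (2, m4 0 1 0 0); (6, m4 0 0 2 0); (0, m4 1 1 0 1); (2, m4 1 0 1 0);
  (0, m4 1 0 1 0); (9, m4 0 0 0 0); (4, m4 0 0 0 0); (0, m4 1 0 0 0); (0, m4 0 1 0 0);
  (8, m4 0 0 0 0); (5, m4 0 0 0 0); (0, m4 1 1 0 0); (0, m4 0 0 1 2); (7, m4 0 0 0 2);
  (7, m4 0 0 0 0); (1, m4 1 1 1 0); (2, m4 0 0 1 1); (0, m4 0 0 1 1); (2, m4 1 1 0 1);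
  (2, m4 0 0 0 2); (0, m4 0 0 2 0); (0, m4 0 1 1 0); (1, m4 1 0 1 1); (3, m4 1 1 0 0);
  (2, m4 0 1 1 0); (0, m4 1 0 1 1); (0, m4 0 0 2 1); (3, m4 0 0 0 1); (3, m4 0 0 1 0);
  (0, m4 0 1 1 1); (2, m4 0 1 1 1); (0, m4 1 1 1 0); (2, m4 1 1 1 0); (0, m4 2 1 0 0);
  (7, m4 1 1 0 0); (6, m4 1 1 0 0); (2, m4 2 1 0 0); (5, m4 1 1 0 0); (8, m4 1 1 0 0);
  (4, m4 1 1 0 0); (9, m4 1 1 0 0); (6, m4 0 2 0 0); (0, m4 2 0 0 1); (0, m4 1 0 0 1);
  (0, m4 0 1 0 1); (0, m4 0 2 0 1); (0, m4 0 2 0 0); (2, m4 0 1 0 1); (2, m4 0 2 0 0);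
  (0, m4 1 0 0 2); (0, m4 2 0 0 0); (3, m4 1 0 0 0); (2, m4 1 0 0 1); (2, m4 2 0 0 0);
  (3, m4 0 1 0 0); (7, m4 0 0 0 1); (8, m4 0 0 0 1); (4, m4 0 0 0 1); (9, m4 0 0 0 1);
  (2, m4 1 0 0 2); (5, m4 0 0 0 1); (6, m4 0 0 0 1); (4, m4 0 0 1 0); (5, m4 0 1 0 0);
  (5, m4 0 0 1 0); (7, m4 0 0 1 0); (6, m4 1 0 0 0); (6, m4 0 0 1 0); (5, m4 1 0 0 0);
  (8, m4 1 0 0 0); (4, m4 1 0 0 0); (9, m4 0 1 0 0); (8, m4 0 1 0 0); (7, m4 1 0 0 0);
  (7, m4 0 1 0 0); (9, m4 1 0 0 0); (3, m4 0 0 2 0); (6, m4 0 1 0 0); (4, m4 0 1 0 0);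
  (0, m4 0 0 3 0); (2, m4 2 0 0 1); (3, m4 1 0 1 0); (1, m4 0 1 0 2); (3, m4 0 1 1 0);
  (3, m4 2 0 0 0); (6, m4 1 0 0 1); (5, m4 0 0 2 0); (4, m4 1 0 1 0); (6, m4 0 0 1 1);
  (4, m4 1 0 0 1); (5, m4 0 0 1 1); (7, m4 0 0 1 1); (7, m4 0 2 0 0); (6, m4 0 1 0 1);
  (3, m4 1 0 0 1); (4, m4 0 1 1 0); (4, m4 0 0 1 1); (9, m4 1 0 0 1); (4, m4 0 0 0 2);
  (8, m4 0 1 1 0); (8, m4 0 0 0 2); (3, m4 0 0 1 1); (3, m4 0 1 0 1); (7, m4 0 1 0 1);
  (5, m4 0 0 0 2); (5, m4 0 1 0 1); (8, m4 0 2 0 0); (9, m4 0 1 0 1); (9, m4 2 0 0 0);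
  (5, m4 1 0 0 1); (6, m4 2 0 0 0); (4, m4 0 0 2 0); (7, m4 0 0 2 0); (6, m4 0 0 0 2);
  (6, m4 0 1 1 0); (0, m4 0 1 0 2)].

(** The residues modulo 23 of [params special_lengths], as shown in [special_params_mod]. *)
Definition special_params : seq Z := map Z.of_nat [:: 2; 1; 0; 0; 11; 1; 15; 12; 16; 3; 13; 1; 19; 17; 11; 2; 0; 1; 0; 11; 0; 7; 22; 3; 10; 0; 0; 0; 1; 11; 12]%N.

Definition monos : seq (seq nat) := pivot_monos ++ basis_monos.

(** * Macaulay rows and their verification modulo 23 *)

Section Rows.
Variable O : ops.

(** The nested list of w0 + w1 t1 + w2 t2 + w3 t3 + w4 t4, with t1 the outermost variable. *)
Definition linear_form (w0 w1 w2 w3 w4 : O) : poly4_ops O :=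
  [:: [:: [:: [:: w0; w4]; [:: w3]]; [:: [:: w2]]]; [:: [:: [:: w1]]]].

Definition param_env (w : seq O) : seq (poly4_ops O) :=
  let p i := nth (ozero O) w i in
  let H k := linear_form (p (5 * k)%N) (p (5 * k + 1)%N) (p (5 * k + 2)%N)
                         (p (5 * k + 3)%N) (p (5 * k + 4)%N) in
  let s := p 30 in
  [:: H 0; H 1; H 2; H 3; H 4; H 5;
      [:: [::]; [:: [:: [:: s]]]]; [:: [:: [::]; [:: [:: s]]]]; [:: [:: [:: [::]; [:: s]]]];
      [:: [:: [:: [:: ozero O; s]]]]; [:: [:: [:: [:: s]]]]].

Definition gen_polys (w : seq O) : seq (poly4_ops O) :=
  [seq interp (O := poly4_ops O) (param_env w) g | g <- generators].

Definition row_terms (ps : seq (poly4_ops O)) (ge : nat * seq nat) : seq (seq nat * O) :=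
  [seq (mono_add ge.2 mv.1, mv.2) | mv <- terms4 (nth [::] ps ge.1)].

End Rows.

Lemma param_env_map (O O' : ops) (f : O -> O') w : hom f ->
  map (map4 f) (param_env w) = param_env (map f w).
Proof.
move=> hf; rewrite /param_env /map4 /linear_form /= (hom0 hf).
have h i : f (nth (ozero O) w i) = nth (ozero O') (map f w) i.
  have [hi|hi] := ltnP i (size w); first by rewrite (nth_map (ozero O)).
  by rewrite !nth_default ?size_map // (hom0 hf).
by rewrite !h.
Qed.

Lemma gen_polys_map (O O' : ops) (f : O -> O') w : hom f ->
  map (map4 f) (gen_polys w) = gen_polys (map f w).
Proof.
move=> hf; rewrite /gen_polys -map_comp; apply: eq_map => g /=.
by rewrite (interp_hom _ _ (hom_map4 hf)) param_env_map.
Qed.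

Lemma row_terms_map (O O' : ops) (f : O -> O') w ge : hom f ->
  row_terms (gen_polys (map f w)) ge =
  [seq (mv.1, f mv.2) | mv <- row_terms (gen_polys w) ge].
Proof.
move=> hf; rewrite /row_terms -(gen_polys_map w hf) -map_comp.
rewrite -[[::]]/(map4 f [::]) (_ : nth _ _ _ = map4 f (nth [::] (gen_polys w) ge.1)).
  by rewrite terms4_map -map_comp.
have [hi|hi] := ltnP ge.1 (size (gen_polys w)); first by rewrite (nth_map [::]).
by rewrite !nth_default ?size_map.
Qed.

Definition Zp_ops : ops := @Ops Z Z0 (fun a b => redp (Z.add a b)) (fun a => redp (Z.opp a))
  (fun a b => redp (Z.mul a b)).

Lemma hom_zf : @hom Zp_ops (ring_ops F23) zf.
Proof. by split=> *; rewrite /= ?zf_redp ?zfD ?zfN ?zfM. Qed.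

(** A lookup table replacing [index] during [vm_compute]; exponents outside it are sent to -1 by
    [column_of]. *)
Definition column_table : seq (seq (seq (seq Z))) :=
  [seq [seq [seq [seq Z.of_nat (index (m4 a b c d) monos) | d <- iota 0 (7 - a - b - c)]
    | c <- iota 0 (7 - a - b)] | b <- iota 0 (7 - a)] | a <- iota 0 7].

Definition column_of (tbl : seq (seq (seq (seq Z)))) (m : seq nat) : Z :=
  match m with
  | [:: a; b; c; d] => nth (Zneg xH) (nth [::] (nth [::] (nth [::] tbl a) b) c) d
  | _ => (Zneg xH)
  end.

Definition sparse_row (tbl : seq (seq (seq (seq Z)))) (r : seq (seq nat * Z)) : sparse :=
  sort (fun x y => Z.leb x.1 y.1) [seq (column_of tbl mv.1, mv.2) | mv <- r].

Definition support_ok (tbl : seq (seq (seq (seq Z)))) (rs : seq (seq (seq nat * Z))) : bool :=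
  all (all (fun mv => (size mv.1 == 4) && Z.leb 0 (column_of tbl mv.1)
     && Z.ltb (column_of tbl mv.1) 210)) rs.

Definition unit_mono (i : nat) : seq nat := [seq (j == i : nat) | j <- iota 0 4].

Definition linear_terms (O : ops) (l : seq O) (m : seq nat) : seq (seq nat * O) :=
  (m, nth (ozero O) l 0) ::
  [seq (mono_add (unit_mono i) m, nth (ozero O) l i.+1) | i <- iota 0 4].

Definition special_linear : seq Z := map Z.of_nat [:: 13; 12; 19; 5; 0]%N.

(** Two facts modulo 23: the 172 rows are independent on the pivot columns, and together with the 38
    products of [special_linear] with the basis monomials they have full rank 210, which makes
    multiplication by that form invertible. *)
Definition rank_check : bool :=
  let tbl := column_table in
  let ps := @gen_polys Zp_ops special_params in
  let rs := [seq @row_terms Zp_ops ps ge | ge <- pivot_rows] in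
  let ls := [seq @linear_terms Zp_ops special_linear m | m <- basis_monos] in
  let pivs := foldl insert_row [::] [seq sparse_row tbl r | r <- rs] in
  [&& support_ok tbl rs, support_ok tbl ls, unitriangular 0 172 210 pivs
    & unitriangular 0 210 210 (foldl insert_row pivs [seq sparse_row tbl r | r <- ls])].

Lemma rank_checkP : rank_check.
Proof. by vm_compute. Qed.

Lemma size_monos : size monos = 210%N. Proof. by []. Qed.
Lemma size_pivot_rows : size pivot_rows = 172%N. Proof. by []. Qed.

Lemma column_ofP m : size m = 4%N -> Z.le 0 (column_of column_table m) ->
  column_of column_table m = Z.of_nat (index m monos).
Proof.
have absurd (P : Prop) : Z.le 0 (Zneg xH) -> P by case.
case: m => [|a [|b [|c [|d [|//]]]]] //; rewrite /column_of => _.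
have [ha|ha] := ltnP a 7; last first.
  rewrite (_ : nth [::] column_table a = [::]); first by rewrite ?nth_nil; apply: absurd.
  by rewrite nth_default ?size_map ?size_iota.
rewrite /column_table (nth_map 0%N) ?size_iota // nth_iota // add0n.
have [hb|hb] := ltnP b (7 - a); last first.
  rewrite (_ : nth [::] _ b = [::]); first by rewrite ?nth_nil; apply: absurd.
  by rewrite nth_default ?size_map ?size_iota.
rewrite (nth_map 0%N) ?size_iota // nth_iota // add0n.
have [hc|hc] := ltnP c (7 - a - b); last first.
  rewrite (_ : nth [::] _ c = [::]); first by rewrite ?nth_nil; apply: absurd.
  by rewrite nth_default ?size_map ?size_iota.
rewrite (nth_map 0%N) ?size_iota // nth_iota // add0n.
have [hd|hd] := ltnP d (7 - a - b - c); last first.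
  rewrite (_ : nth _ _ d = Zneg xH); first by rewrite ?nth_nil; apply: absurd.
  by rewrite nth_default ?size_map ?size_iota.
rewrite (nth_map 0%N) ?size_iota; last exact: hd.
rewrite nth_iota; last exact: hd.

by rewrite add0n.
Qed.

Lemma special_support ge mv : ge \in pivot_rows ->
  mv \in @row_terms Zp_ops (gen_polys (O := Zp_ops) special_params) ge ->
  [/\ size mv.1 = 4%N, mv.1 \in monos & column_of column_table mv.1 = Z.of_nat (index mv.1 monos)].
Proof.
move=> hge hmv; have /andP [/allP h _] := rank_checkP.
have /allP /(_ _ hmv) /andP [/andP [/eqP h4 /Z.leb_spec0 h0] /Z.ltb_spec0 hlt] := h _ (map_f _ hge).
have e := column_ofP h4 h0; split=> //.
rewrite -index_mem size_monos; apply/ssrnat.ltP/Nat2Z.inj_lt.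
by rewrite -e.
Qed.

Definition unit_ops : ops := @Ops unit tt (fun _ _ => tt) (fun _ => tt) (fun _ _ => tt).

(** The exponents produced do not depend on the coefficients, as comparison with the one-point
    structure [unit_ops] shows; so the support checked modulo 23 is the support over every ring. *)
Lemma row_support (O : ops) (w : seq O) ge mv : size w = 31%N -> ge \in pivot_rows ->
  mv \in [seq mv.1 | mv <- row_terms (gen_polys w) ge] -> size mv = 4%N /\ mv \in monos.
Proof.
move=> sw hge.
have fst_unit (O' : ops) (w' : seq O') : size w' = 31%N ->
    [seq mv.1 | mv <- row_terms (gen_polys w') ge] =
    [seq mv.1 | mv <- @row_terms unit_ops (gen_polys (O := unit_ops) (nseq 31%N tt)) ge].
  move=> sw'; have hu : @hom O' unit_ops (fun=> tt) by split.
  have -> : nseq 31%N tt = map (fun=> tt) w'.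
    by clear hu; elim: w' 31%N sw' => [|a w' IHw] [|k] //= [] /IHw ->.
  rewrite (row_terms_map w' ge hu) -map_comp.
  exact: eq_map.
rewrite (fst_unit _ w sw) -(fst_unit Zp_ops special_params) // => /mapP [mv' hmv' ->].
by have [] := special_support hge hmv'.
Qed.

Definition row_at (r : nat) : nat * seq nat := nth (0, [::]) pivot_rows r.

Lemma row_atP (r : 'I_172) : row_at r \in pivot_rows.
Proof. by apply: mem_nth; rewrite size_pivot_rows. Qed.

Definition macaulay (R : comNzRingType) (w : seq R) : 'M[R]_(172, 172 + 38) :=
  \matrix_(r, k) \sum_(mv <- @row_terms (ring_ops R) (gen_polys (O := ring_ops R) w) (row_at r)
     | index mv.1 monos == k) mv.2.

Lemma map_macaulay (R S : comNzRingType) (f : {rmorphism R -> S}) (w : seq R) :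
  map_mx f (macaulay w) = macaulay (map f w).
Proof.
apply/matrixP => r k; rewrite !mxE rmorph_sum.
have /= -> := @row_terms_map (ring_ops R) (ring_ops S) f w (row_at r) (hom_rmorphism f).
by rewrite big_map.
Qed.

Lemma macaulayE (R : comNzRingType) (w : seq R) (x : 'cV_(172 + 38)) (r : 'I_172) :
  size w = 31%N -> (macaulay w *m x) r 0 =
  \sum_(mv <- @row_terms (ring_ops R) (gen_polys (O := ring_ops R) w) (row_at r))
    mv.2 * x (inord (index mv.1 monos)) 0.
Proof.
move=> sw; rewrite mxE; under eq_bigr do rewrite mxE big_distrl /=.
rewrite (exchange_big_dep xpredT) // big_seq [RHS]big_seq; apply: eq_bigr => mv hmv.
have [_ hm] : size mv.1 = 4%N /\ mv.1 \in monos.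
  by apply: (@row_support (ring_ops R) w _ _ sw (row_atP r)); apply: map_f hmv.
have hi : (index mv.1 monos < 172 + 38)%N by rewrite -[(172 + 38)%N]size_monos index_mem.
rewrite (bigD1 (Ordinal hi)) //= big1 => [|k /andP [/eqP e /eqP ne]].
  by rewrite addr0; congr (_ * x _ _); apply/val_inj; rewrite [RHS]inordK.
by case: ne; apply/val_inj.
Qed.

Definition mono_vec (R : comNzRingType) (t : seq R) : 'cV[R]_(172 + 38) :=
  \col_k mono_val t (nth [::] monos k).

Definition solves (R : comNzRingType) (w : seq R) (t1 t2 t3 t4 : R) : Prop :=
  forall k, (k < size generators)%N ->
    @interp (ring_ops R) [seq peval4 t1 t2 t3 t4 p | p <- param_env (O := ring_ops R) w]
      (nth (EVar 0) generators k) = 0.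

Lemma macaulay_solution (R : comNzRingType) (w : seq R) t1 t2 t3 t4 : size w = 31%N ->
  solves w t1 t2 t3 t4 -> macaulay w *m mono_vec [:: t1; t2; t3; t4] = 0.
Proof.
move=> sw sol; apply/colP => r; rewrite [RHS]mxE.
set t := [:: t1; t2; t3; t4]; pose l := @row_terms (ring_ops R) (gen_polys (O := ring_ops R) w) (row_at r).
transitivity (terms_val t l).
  rewrite macaulayE // /terms_val; apply: eq_big_seq => mv hmv; congr (_ * _).
  have [_ hm] : size mv.1 = 4%N /\ mv.1 \in monos.
    by apply: (@row_support (ring_ops R) w _ _ sw (row_atP r)); apply: map_f hmv.
  have hi : (index mv.1 monos < 172 + 38)%N by rewrite -[(172 + 38)%N]size_monos index_mem.
  rewrite mxE inordK; last exact: hi.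
  by rewrite nth_index.
have size_e : size (row_at r).2 = 4%N.
  have /allP : all (fun ge => size ge.2 == 4%N) pivot_rows by [].
  by move=> /(_ _ (row_atP r)) /eqP.
rewrite /l /row_terms /terms_val big_map /=.
set p := nth _ _ _.
transitivity (mono_val t (row_at r).2 * terms_val t (@terms4 (ring_ops R) p)).
  rewrite /terms_val mulr_sumr; apply: eq_big_seq => mv hmv.
  have /allP /(_ _ hmv) /eqP size_mv := @terms4_size (ring_ops R) p.
  rewrite -[LHS]/(mv.2 * mono_val t (mono_add (row_at r).2 mv.1)).
  by rewrite mono_val_add // mulrCA.
rewrite terms4_val /p /gen_polys.
have [hg|hg] := ltnP (row_at r).1 (size generators); last first.
  by rewrite nth_default ?size_map // mulr0.
rewrite (nth_map (EVar 0)) //.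
by rewrite (interp_hom _ _ (hom_peval4 t1 t2 t3 t4)) sol // mulr0.
Qed.

Lemma linear_terms_map (O O' : ops) (f : O -> O') l m : hom f ->
  linear_terms (map f l) m = [seq (mv.1, f mv.2) | mv <- linear_terms l m].
Proof.
move=> hf; have h i : nth (ozero O') (map f l) i = f (nth (ozero O) l i).
  have [hi|hi] := ltnP i (size l); first by rewrite (nth_map (ozero O)).
  by rewrite !nth_default ?size_map // (hom0 hf).
by rewrite /linear_terms /= !h.
Qed.

Definition linear_val (R : comNzRingType) (l t : seq R) : R :=
  nth 0 l 0 + \sum_(i < 4) nth 0 l i.+1 * nth 0 t i.

Lemma mono_val_unit (R : comNzRingType) (t : seq R) i : size t = 4%N -> (i < 4)%N ->
  mono_val t (unit_mono i) = nth 0 t i.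
Proof.
case: t => [|t0 [|t1 [|t2 [|t3 []]]]] // _.
by case: i => [|[|[|[|]]]] // _; rewrite /= !(expr0, expr1, mul1r, mulr1).
Qed.

Lemma terms_val_linear (R : comNzRingType) (l t : seq R) m : size t = 4%N -> size m = 4%N ->
  terms_val t (@linear_terms (ring_ops R) l m) = linear_val l t * mono_val t m.
Proof.
move=> st sm; rewrite /terms_val /linear_terms big_cons mulrDl mulr_suml; congr (_ + _).
rewrite big_map -/(index_iota 0 4) big_mkord; apply: eq_bigr => i _.
by rewrite mono_val_add ?st // mono_val_unit // mulrA.
Qed.

Lemma linear_terms_support (O : ops) (l : seq O) m : m \in basis_monos ->
  all (fun mv => mv.1 \in monos) (linear_terms l m).
Proof.
have /allP h : all (fun m => all (mem monos) (m :: [seq mono_add (unit_mono i) m | i <- iota 0 4]))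
  basis_monos by vm_compute.
by move=> /h.
Qed.

Lemma basis_size m : m \in basis_monos -> size m = 4%N.
Proof. by have /allP h : all (fun m => size m == 4%N) basis_monos by []; move=> /h /eqP. Qed.

Lemma basis_one : [:: 0; 0; 0; 0]%N \in basis_monos.
Proof. by vm_compute. Qed.

Lemma size_pivot_monos : size pivot_monos = 172%N. Proof. by []. Qed.
Lemma size_basis_monos : size basis_monos = 38%N. Proof. by []. Qed.

Lemma basisP (k : 'I_38) : nth [::] basis_monos k \in basis_monos.
Proof. by apply: mem_nth; rewrite size_basis_monos. Qed.

Lemma nth_monos_basis (k : 'I_38) :
  nth [::] monos (rshift 172 k) = nth [::] basis_monos k.
Proof.
rewrite -[monos]/(pivot_monos ++ basis_monos) nth_cat size_pivot_monos.
by rewrite [(rshift _ _ < _)%N]ltnNge leq_addr [(rshift _ _ - _)%N]addKn.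
Qed.

(** * Multiplication matrices on the basis monomials *)

Section Reduction.
Variables (R : comNzRingType) (w l : seq R).

Definition pivot_det : R := \det (lsubmx (macaulay w)).

(* Modulo the rows, [pivot_det] times every monomial is a combination of the
   basis monomials. *)
Definition reduction : 'M[R]_(172 + 38, 38) :=
  col_mx (- (\adj (lsubmx (macaulay w)) *m rsubmx (macaulay w))) pivot_det%:M.

(** [pivot_det] times the matrix of multiplication by the form l. Using the adjugate instead of an
    inverse keeps it defined over any commutative ring and compatible with specialization. *)
Definition multiplication_mx : 'M[R]_38 := \matrix_(k, j)
  \sum_(mv <- @linear_terms (ring_ops R) l (nth [::] basis_monos k))
    mv.2 * reduction (inord (index mv.1 monos)) j.

Lemma macaulay_reduction : macaulay w *m reduction = 0.
Proof.
rewrite -{1}[macaulay w]hsubmxK mul_row_col mulmxN mulmxA mul_mx_adj.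
by rewrite mul_scalar_mx mul_mx_scalar addNr.
Qed.

Lemma reduction_eq (x : 'cV[R]_(172 + 38)) : macaulay w *m x = 0 ->
  pivot_det *: x = reduction *m dsubmx x.
Proof.
rewrite -{1}[macaulay w]hsubmxK -{1}[x]vsubmxK mul_row_col => /eqP; rewrite addr_eq0 => /eqP e.
rewrite mul_col_mx mulNmx -mulmxA mul_scalar_mx -{1}[x]vsubmxK scale_col_mx; congr col_mx.
by rewrite -[rsubmx _ *m _]opprK -e mulmxN opprK mulmxA mul_adj_mx mul_scalar_mx.
Qed.

Lemma multiplicationE (x : 'cV[R]_38) k : (multiplication_mx *m x) k 0 =
  \sum_(mv <- @linear_terms (ring_ops R) l (nth [::] basis_monos k))
    mv.2 * (reduction *m x) (inord (index mv.1 monos)) 0.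
Proof.
rewrite mxE; under eq_bigr do rewrite mxE mulr_suml.
rewrite exchange_big; apply: eq_bigr => mv _ /=.
by rewrite mxE mulr_sumr; apply: eq_bigr => j _; rewrite mulrA.
Qed.

(** Evaluated at a solution, reduction modulo the rows is an identity of numbers, so the vector of
    basis monomials is an eigenvector. *)
Lemma multiplication_eigen (t : seq R) : size t = 4%N ->
  macaulay w *m mono_vec t = 0 ->
  multiplication_mx *m dsubmx (mono_vec t) =
    (pivot_det * linear_val l t) *: dsubmx (mono_vec t).
Proof.
move=> st /reduction_eq e; apply/colP => k; rewrite multiplicationE -e.
rewrite ![in RHS]mxE nth_monos_basis -mulrA -terms_val_linear ?basis_size ?basisP //.
rewrite /terms_val mulr_sumr; apply: eq_big_seq => mv hmv.
have /allP /(_ _ hmv) /= hm := @linear_terms_support (ring_ops R) l _ (basisP k).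
have lt_index : (index mv.1 monos < 210)%N by rewrite -size_monos index_mem.
rewrite !mxE inordK; last exact: lt_index.
by rewrite nth_index // mulrCA.
Qed.

End Reduction.

Lemma map_pivot_det (R S : comNzRingType) (f : {rmorphism R -> S}) (w : seq R) :
  f (pivot_det w) = pivot_det (map f w).
Proof. by rewrite /pivot_det -map_macaulay -map_lsubmx det_map_mx. Qed.

Lemma map_multiplication_mx (R S : comNzRingType) (f : {rmorphism R -> S}) (w l : seq R) :
  map_mx f (multiplication_mx w l) = multiplication_mx (map f w) (map f l).
Proof.
have hred : map_mx f (reduction w) = reduction (map f w).
  rewrite map_col_mx map_mxN map_mxM map_mx_adj map_lsubmx map_rsubmx map_scalar_mx.
  by rewrite map_macaulay map_pivot_det.
apply/matrixP => k j; rewrite !mxE rmorph_sum.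
rewrite (@linear_terms_map (ring_ops R) (ring_ops S) f l _ (hom_rmorphism f)).
by rewrite big_map; apply: eq_bigr => mv _; rewrite rmorphM -hred [in RHS]mxE.
Qed.

Definition special_mod : seq F23 := map zf special_params.

Definition pivot_rows_mod : seq sparse := [seq sparse_row column_table r |
  r <- [seq row_terms (gen_polys (O := Zp_ops) special_params) ge | ge <- pivot_rows]].

Definition linear_rows_mod : seq sparse := [seq sparse_row column_table r |
  r <- [seq @linear_terms Zp_ops special_linear m | m <- basis_monos]].

Definition column_value (v : 'cV[F23]_(172 + 38)) (i : Z) : F23 :=
  oapp (v^~ 0) 0 (insub (Z.to_nat i)).

Lemma column_valueE v (k : 'I_(172 + 38)) : column_value v (Z.of_nat k) = v k 0.
Proof.
by rewrite /column_value Nat2Z.id; case: insubP => [k' _ /val_inj ->|]; rewrite ?ltn_ord.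
Qed.

Lemma row_val_sparse v (r : seq (seq nat * Z)) :
  (forall mv, mv \in r -> mv.1 \in monos /\ column_of column_table mv.1 = Z.of_nat (index mv.1 monos)) ->
  row_val (column_value v) (sparse_row column_table r) =
  \sum_(mv <- [seq (mv.1, zf mv.2) | mv <- r]) mv.2 * v (inord (index mv.1 monos)) 0.
Proof.
move=> hr; rewrite /row_val /sparse_row (perm_big _ (permEl (perm_sort _ _))) !big_map /=.
apply: eq_big_seq => mv /hr [hm ->]; congr (_ * _).
have hi : (index mv.1 monos < 172 + 38)%N by rewrite -[(172 + 38)%N]size_monos index_mem.
by rewrite -column_valueE inordK.
Qed.

Lemma size_special_mod : size special_mod = 31%N. Proof. by []. Qed.

Lemma pivot_rows_zero v : macaulay special_mod *m v = 0 ->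
  all_zero (column_value v) pivot_rows_mod.
Proof.
move=> hv _ /mapP [_ /mapP [ge hge ->] ->].
have [k ->] : exists k : 'I_172, ge = row_at k.
  have h : (index ge pivot_rows < 172)%N by rewrite -size_pivot_rows index_mem.
  by exists (Ordinal h); rewrite /row_at nth_index.
rewrite row_val_sparse => [|mv hmv]; last first.
  by have [] := special_support (row_atP k) hmv.
have /= <- := @row_terms_map Zp_ops (ring_ops F23) zf special_params (row_at k) hom_zf.
by rewrite -(macaulayE _ _ size_special_mod) hv mxE.
Qed.

Lemma linear_rows_zero (v : 'cV[F23]_(172 + 38)) :
  (forall m, m \in basis_monos ->
    \sum_(mv <- @linear_terms (ring_ops F23) (map zf special_linear) m)
      mv.2 * v (inord (index mv.1 monos)) 0 = 0) ->
  all_zero (column_value v) linear_rows_mod.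
Proof.
move=> hv _ /mapP [_ /mapP [m hm ->] ->]; rewrite row_val_sparse => [|mv hmv].
  have /= <- := @linear_terms_map Zp_ops (ring_ops F23) zf special_linear m hom_zf.
  exact: hv.
have /and4P [_ /allP h _ _] := rank_checkP.
have /allP /(_ _ hmv) /andP [/andP [/eqP h4 /Z.leb_spec0 h0] _] := h _ (map_f _ hm).
split; last exact: column_ofP.
by have /allP /(_ _ hmv) := @linear_terms_support Zp_ops special_linear m hm.
Qed.

(** A kernel vector on the pivot columns, extended by zero, is killed by all rows, hence by their
    echelon form, which forces it to vanish. *)
Lemma pivot_det_special : pivot_det special_mod != 0.
Proof.
rewrite /pivot_det -det_tr; apply/det0P => -[c c0 hc].
pose v : 'cV[F23]_(172 + 38) := col_mx c^T 0.
have hv : macaulay special_mod *m v = 0.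
  rewrite -[macaulay _]hsubmxK mul_row_col mulmx0 addr0.
  by rewrite -[LHS]trmxK trmx_mul trmxK hc trmx0.
have /and4P [_ _ tri _] := rank_checkP.
have zero := unitriangular_zero tri (foldl_insert_zero _ (pivot_rows_zero hv)) _.
clear tri; case/eqP: c0; apply/rowP => k; rewrite [RHS]mxE.
have -> : c 0 k = v (lshift 38 k) 0 by rewrite col_mxEu mxE.
rewrite -column_valueE; apply: zero; [by []| |exact: Nat2Z.is_nonneg|].
  move=> i hi1 hi2; have e : i = Z.of_nat (Z.to_nat i).
    by rewrite Z2Nat.id //; apply: Z.le_trans hi1.
  have hk : (Z.to_nat i < 172 + 38)%N.
    by apply/ssrnat.ltP/(Nat2Z.inj_lt _ 210); rewrite -e.
  have hk' : (172 <= Z.to_nat i)%N by apply/ssrnat.leP/(Nat2Z.inj_le 172); rewrite -e.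
  rewrite e -[Z.to_nat i]/(nat_of_ord (Ordinal hk)) column_valueE.
  case: (split_ordP (Ordinal hk)) => j ej; rewrite ej; last by rewrite col_mxEd mxE.
  have ej' : Z.to_nat i = j by have := congr1 val ej.
  by move: hk'; rewrite ej' leqNgt ltn_ord.
by apply/(Nat2Z.inj_lt _ 210)/ssrnat.ltP; apply: ltn_trans (ltn_ord k) _.
Qed.

(** A kernel vector c yields [reduction *m c], killed by the Macaulay rows and by the rows of the
    linear form; the full rank 210 makes it zero. *)
Lemma multiplication_special : \det (multiplication_mx special_mod (map zf special_linear)) != 0.
Proof.
rewrite -det_tr; apply/det0P => -[c c0 hc].
pose v := reduction special_mod *m c^T.
have hv : macaulay special_mod *m v = 0 by rewrite mulmxA macaulay_reduction mul0mx.
have hl : all_zero (column_value v) linear_rows_mod.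
  apply: linear_rows_zero => m hm.
  have hk : (index m basis_monos < 38)%N by rewrite -size_basis_monos index_mem.
  have := multiplicationE special_mod (map zf special_linear) c^T (Ordinal hk).
  rewrite nth_index // => <-; rewrite -[multiplication_mx _ _]trmxK -trmx_mul hc.
  by rewrite trmx0 mxE.
have /and4P [_ _ _ tri] := rank_checkP.
have zero := unitriangular_zero tri
  (foldl_insert_zero (foldl_insert_zero _ (pivot_rows_zero hv)) hl) _.
clear tri; case/eqP: c0; apply/rowP => k; rewrite [RHS]mxE; apply: (mulfI pivot_det_special).
rewrite mulr0; have -> : pivot_det special_mod * c 0 k = v (rshift 172 k) 0.
  by rewrite /v /reduction mul_col_mx col_mxEd mul_scalar_mx !mxE.
rewrite -column_valueE; apply: zero; [by []| |exact: Nat2Z.is_nonneg|].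
  by move=> i h1 h2; case: (Z.lt_irrefl i); apply: Z.lt_le_trans h2 h1.
by apply/(Nat2Z.inj_lt _ 210)/ssrnat.ltP; apply: (ltn_ord (rshift 172 k)).
Qed.

(** * At most 38 solutions *)

Lemma finite_of_bounded (T : eqType) (P : T -> Prop) N :
  (forall s, uniq s -> (forall x, x \in s -> P x) -> (size s <= N)%N) ->
  exists2 s : seq T, (size s <= N)%N & forall x, P x -> x \in s.
Proof.
move=> bound; pose Q n := `[< exists s : seq T, [/\ uniq s, forall x, x \in s -> P x & size s = n] >].
have Q0 : exists n, Q n by exists 0%N; apply/asboolP; exists [::].
have Qb n : Q n -> (n <= N)%N by move=> /asboolP [s [us hs <-]]; apply: bound.
case: (ex_maxnP Q0 Qb) => n /asboolP [s [us hs <-]] hmax; exists s; first exact: bound.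
move=> x px; apply/negPn/negP => xs; have /hmax : Q (size (x :: s)).
  apply/asboolP; exists (x :: s); split=> //=; first by rewrite xs.
  by move=> y; rewrite inE => /orP [/eqP ->|/hs].
by rewrite ltnn.
Qed.

(** Weights 1, y, y^2, y^3: two distinct points collide only if y is a root of the nonzero
    polynomial given by their difference, and there are finitely many pairs. *)
Lemma separating_weight (K : numFieldType) (s : seq 'rV[K]_4) :
  exists y : K, {in s &, injective (fun t : 'rV_4 => \sum_(i < 4) y ^+ i * t 0 i)}.
Proof.
pose q (t : 'rV[K]_4) : {poly K} := \poly_(i < 4) t 0 (inord i).
have qE t y : (q t).[y] = \sum_(i < 4) y ^+ i * t 0 i.
  rewrite horner_poly; apply: eq_bigr => i _; rewrite mulrC; congr (_ * t 0 _).
  by apply/val_inj; rewrite /= inordK.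
have [y hy] : exists y : nat, (\prod_(tt <- allpairs pair s s | tt.1 != tt.2) q (tt.1 - tt.2)).[y%:R] != 0.
  apply: poly_nonroot; rewrite prodf_seq_neq0; apply/allP => -[t t'] _ /=; apply/implyP => ne.
  apply/eqP => q0; case/eqP: ne; apply/eqP; rewrite -subr_eq0; apply/eqP/rowP => i.
  have : (q (t - t'))`_i = 0 by rewrite q0 coef0.
  by rewrite coef_poly ltn_ord inord_val => ->; rewrite mxE.
exists y%:R => t t' ht ht' e; apply/eqP/negPn/negP => ne.
move: hy; rewrite horner_prod prodf_seq_neq0 => /allP /(_ (t, t') (allpairs_f _ ht ht')).
rewrite ne qE /= => /eqP; apply.
under eq_bigr do rewrite !mxE mulrBr.
by rewrite sumrB e subrr.
Qed.

Section Count.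
Variables (K : numFieldType) (w : seq K).
Hypotheses (size_w : size w = 31%N) (reg : pivot_det w != 0).

Definition coords (t : 'rV[K]_4) : seq K := mkseq (fun i => t 0 (inord i)) 4.

Definition solution (t : 'rV[K]_4) : Prop :=
  solves w (t 0 (inord 0)) (t 0 (inord 1)) (t 0 (inord 2)) (t 0 (inord 3)).

Let basis_vec t : 'cV[K]_38 := dsubmx (mono_vec (coords t)).

Lemma solution_eigen t l : solution t ->
  multiplication_mx w l *m basis_vec t = (pivot_det w * linear_val l (coords t)) *: basis_vec t.
Proof. by move=> /(macaulay_solution size_w) st; apply: multiplication_eigen. Qed.

Lemma basis_vec_neq0 t : basis_vec t != 0.
Proof.
apply/eqP => /colP; have hk : (index [:: 0; 0; 0; 0]%N basis_monos < 38)%N.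
  by rewrite -size_basis_monos index_mem basis_one.
move=> /(_ (Ordinal hk)); rewrite !mxE nth_monos_basis nth_index ?basis_one //= !expr0 !mul1r.
by move/eqP; rewrite oner_eq0.
Qed.

(** Under a separating form distinct solutions give distinct roots of a characteristic polynomial of
    degree 38. *)
Lemma solutions_bounded :
  exists2 s : seq 'rV[K]_4, (size s <= 38)%N & forall t, solution t -> t \in s.
Proof.
apply: finite_of_bounded => s us hs; have [y yinj] := separating_weight s.
pose l := 0 :: mkseq (fun i => y ^+ i) 4.
have lE t : linear_val l (coords t) = \sum_(i < 4) y ^+ i * t 0 i.
  by rewrite /linear_val add0r; apply: eq_bigr => i _; rewrite [nth _ l _]nth_mkseq // nth_mkseq // inord_val.
pose B := (multiplication_mx w l)^T.
have root_theta t : t \in s -> root (char_poly B) (pivot_det w * linear_val l (coords t)).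
  move=> /hs st; rewrite -eigenvalue_root_char; apply/eigenvalueP; exists (basis_vec t)^T.
    by rewrite -trmx_mul solution_eigen // linearZ.
  by rewrite -[0]trmx0 (inj_eq trmx_inj) basis_vec_neq0.
have := max_poly_roots (rs := [seq pivot_det w * linear_val l (coords t) | t <- s])
  (monic_neq0 (char_poly_monic B)) _ _.
rewrite size_char_poly size_map; apply.
  by apply/allP => _ /mapP [t ht ->]; apply: root_theta.
by rewrite map_inj_in_uniq // => t t' ht ht' /(mulfI reg); rewrite !lE; apply: yinj.
Qed.

(** If the square of the form were a at a solution, its eigenvector would lie in the kernel of this
    matrix. *)
Lemma linear_val_neq0 l a : \det ((a * (pivot_det w * pivot_det w))%:M -
    multiplication_mx w l *m multiplication_mx w l) != 0 ->
  forall t, solution t -> linear_val l (coords t) ^+ 2 != a.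
Proof.
move=> d0 t st; apply: contra_neq d0 => <-; apply/eqP; rewrite -det_tr; apply/det0P.
exists (basis_vec t)^T; first by rewrite -[0]trmx0 (inj_eq trmx_inj) basis_vec_neq0.
rewrite -trmx_mul mulmxBl -mulmxA solution_eigen // -scalemxAr solution_eigen // scalerA.
by rewrite mul_scalar_mx -scalerBl (_ : _ - _ = 0) ?scale0r ?trmx0 //; ring.
Qed.

End Count.

(** * The system as a function of the lengths, and a special integer point *)

Definition entry (R : nzRingType) (T : seq (seq int)) (i j : nat) : R := (nth 0 (nth [::] T i) j)%:~R.

(* 52 times the inverse of [quadric_mx special_lengths]. *)
Definition interpolation : seq (seq int) :=
  [:: [:: 52; 0; 0; 0; 0; 0]; [:: 38; -58; 36; -10; 8; -4]; [:: -22; -54; 38; -12; 7; 3];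
      [:: 0; 52; 0; 0; 0; 0]; [:: 54; 38; 32; -6; -3; -5]; [:: 0; 0; 52; 0; 0; 0]].

Section Params.
Variables (R : comNzRingType) (d : nat -> nat -> R).

Definition gap (i j : nat) : R := d i.+1 j - d 0%N j.

Definition quadric_mx : 'M[R]_6 := \matrix_(j, k)
  let x := gap 0 j in let y := gap 1 j in let z := gap 2 j in
  nth 0 [:: x * x; 2%:R * (x * y); 2%:R * (x * z); y * y; 2%:R * (y * z); z * z] k.

Definition affine_mx : 'M[R]_(6, 5) := \matrix_(j, k)
  nth 0 [:: 4%:R * d 0%N j; 2%:R * gap 0 j; 2%:R * gap 1 j; 2%:R * gap 2 j; -1] k.

Definition interpolation_mx : 'M[R]_6 := \matrix_(i, j) entry R interpolation i j.

(** The constant factor makes the product 52 times the identity at [special_lengths], so determinant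
    and adjugate are immediate there. *)
Definition denominator : R := \det (quadric_mx *m interpolation_mx).

(** Rows are the six entries of H, columns the coefficients of 1 and of the four unknowns;
    everything is multiplied by [denominator]. *)
Definition inverse_gram_mx : 'M[R]_(6, 5) :=
  interpolation_mx *m \adj (quadric_mx *m interpolation_mx) *m affine_mx.

Definition params : seq R :=
  mkseq (fun k => inverse_gram_mx (inord (k %/ 5)) (inord (k %% 5))) 30 ++ [:: denominator].

(* Four times the denominator times the inner product of the nodes [j] and [k]
   relative to the apex 0, as an affine function of the polar coordinates. *)
Definition polar_params (j k : nat) : seq R :=
  let x := gap 0 j in let y := gap 1 j in let z := gap 2 j in
  let x' := gap 0 k in let y' := gap 1 k in let z' := gap 2 k in
  let q := \row_(i < 6)
    nth 0 [:: x * x'; x * y' + y * x'; x * z' + z * x'; y * y'; y * z' + z * y'; z * z'] i in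
  mkseq (fun i => (q *m inverse_gram_mx) 0 (inord i)
    + denominator * nth 0 [:: 0; - (x + x'); - (y + y'); - (z + z'); 1] i) 5.

(** If apex 0 and the nodes j and k had zero Gram determinant, the polar form at the solution would
    have square 16 s^2 d_0j d_0k with s the denominator, and this determinant would vanish. *)
Definition collinearity (j k : nat) : R :=
  let B := multiplication_mx params (polar_params j k) in
  \det ((16%:R * (denominator * denominator) * (d 0%N j * d 0%N k)
    * (pivot_det params * pivot_det params))%:M - B *m B).

(** Only the first four nodes enter; nonvanishing makes the frame of the apexes invertible in every
    realization ([frame_unit]). *)
Definition affine_det : R := \det (\matrix_(j < 4, k < 4) nth 1 [:: gap 0 j; gap 1 j; gap 2 j] k).

End Params.

Section Natural.
Variables (R S : comNzRingType) (f : {rmorphism R -> S}) (d : nat -> nat -> R) (e : nat -> nat -> S).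
Hypothesis de : forall i j, (i < 4)%N -> (j < 6)%N -> e i j = f (d i j).

Let gapE i j : (i < 3)%N -> (j < 6)%N -> gap e i j = f (gap d i j).
Proof. by move=> hi hj; rewrite /gap !de // rmorphB. Qed.

Lemma map_quadric_mx : map_mx f (quadric_mx d) = quadric_mx e.
Proof.
apply/matrixP => j k; rewrite !mxE !gapE //.
by case: k => [[|[|[|[|[|[|]]]]]]] //= _; rewrite !rmorphM ?rmorph_nat.
Qed.

Lemma map_affine_mx : map_mx f (affine_mx d) = affine_mx e.
Proof.
apply/matrixP => j k; rewrite !mxE !gapE // !de //.
by case: k => [[|[|[|[|[|]]]]]] //= _; rewrite ?rmorphM ?rmorph_nat ?rmorphN1.
Qed.

Lemma map_interpolation_mx : map_mx f (interpolation_mx R) = interpolation_mx S.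
Proof. by apply/matrixP => j k; rewrite !mxE rmorph_int. Qed.

Lemma map_denominator : f (denominator d) = denominator e.
Proof. by rewrite /denominator -det_map_mx map_mxM map_quadric_mx map_interpolation_mx. Qed.

Lemma map_inverse_gram_mx : map_mx f (inverse_gram_mx d) = inverse_gram_mx e.
Proof.
by rewrite !map_mxM map_mx_adj map_mxM map_quadric_mx map_interpolation_mx map_affine_mx.
Qed.

Lemma map_params : map f (params d) = params e.
Proof.
rewrite /params map_cat; congr cat; last by rewrite -map_denominator.
by rewrite -map_comp; apply: eq_map => k /=; rewrite -map_inverse_gram_mx [in RHS]mxE.
Qed.

Lemma map_polar_params j k : (j < 6)%N -> (k < 6)%N ->
  map f (polar_params d j k) = polar_params e j k.
Proof.
move=> hj hk; rewrite /polar_params -map_comp; apply/eq_in_map => i.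
rewrite mem_iota add0n => /andP [_ hi] /=.
rewrite rmorphD rmorphM map_denominator -map_inverse_gram_mx !gapE //; congr (_ + _ * _).
  rewrite !mxE rmorph_sum; apply: eq_bigr => l _; rewrite rmorphM !mxE; congr (_ * _).
  by case: l => [[|[|[|[|[|[|]]]]]]] //= _; rewrite ?[f (_ * _ + _ * _)]rmorphD !rmorphM.
by case: i hi => [|[|[|[|[|]]]]] //= _; rewrite ?rmorph0 ?rmorph1 // rmorphN rmorphD.
Qed.

Lemma map_collinearity j k : (j < 6)%N -> (k < 6)%N -> f (collinearity d j k) = collinearity e j k.
Proof.
move=> hj hk; rewrite /collinearity -det_map_mx map_mxB map_mxM map_multiplication_mx map_scalar_mx.
rewrite map_params map_polar_params // !(rmorphM f) (rmorph_nat f) map_denominator map_pivot_det.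
by rewrite map_params !de.
Qed.

Lemma map_affine_det : f (affine_det d) = affine_det e.
Proof.
rewrite /affine_det -det_map_mx; congr (\det _); apply/matrixP => j k; rewrite !mxE.
have hj : (j < 6)%N by apply: ltn_trans (ltn_ord j) _.
rewrite !gapE //.
by case: k => [[|[|[|[|]]]]] //= _; rewrite rmorph1.
Qed.

End Natural.

(** The entry at (0, 2) is zero, which removes the scalar term from [collinearity] for the nodes 0
    and 2. *)
Definition special_lengths (i j : nat) : int :=
  nth 0 (nth [::] [:: [:: 1; 1; 0; 0; 0; 0]; [:: 2; 1; 0; -1; 1; 3]; [:: 1; 2; 0; -1; 3; -1];
                      [:: 1; 1; 1; 2; -1; 1]] i) j.

Definition special_gram : seq (seq int) :=
  [:: [:: 208; 104; 0; 0; -52]; [:: -80; 88; -40; 8; -10]; [:: -304; 12; -48; 20; 40];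
      [:: 208; 0; 104; 0; -52]; [:: 368; 84; 80; 36; -110]; [:: 0; 0; 0; 104; -52]].

Lemma special_quadric : quadric_mx special_lengths *m interpolation_mx int = 52%:M.
Proof.
apply/matrixP => j k; rewrite !mxE.
under eq_bigr do rewrite !mxE.
rewrite !big_ord_recl big_ord0.
by case: j => [[|[|[|[|[|[|]]]]]]] //= ?; case: k => [[|[|[|[|[|[|]]]]]]].
Qed.

Lemma special_inverse_gram : inverse_gram_mx special_lengths =
  52 ^+ 5 *: \matrix_(i, j) entry int special_gram i j.
Proof.
rewrite /inverse_gram_mx special_quadric -[52%:M]scalemx1 adjZ adj1 -scalemxAr -scalemxAl mulmx1.
congr (_ *: _); apply/matrixP => j k; rewrite !mxE.
under eq_bigr do rewrite !mxE.
rewrite !big_ord_recl big_ord0.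
by case: j => [[|[|[|[|[|[|]]]]]]] //= ?; case: k => [[|[|[|[|[|]]]]]].
Qed.

Lemma special_denominator : denominator special_lengths = 52 ^+ 6.
Proof. by rewrite /denominator special_quadric det_scalar. Qed.

Lemma special_params_mod : map intr (params special_lengths) = special_mod.
Proof.
rewrite /params special_inverse_gram special_denominator map_cat -map_comp.
rewrite (_ : map _ _ =
    [seq 52%:R ^+ 5 * entry F23 special_gram (k %/ 5) (k %% 5) | k <- iota 0 30]); last first.
  apply/eq_in_map => k; rewrite mem_iota add0n => /andP [_ hk] /=.
  rewrite !mxE /entry rmorphM rmorphXn /= !inordK ?ltn_pmod //; last by rewrite ltn_divLR.
  by rewrite !intz.
rewrite [map _ [:: _]]/= rmorphXn /=.
by apply/eqP; vm_compute.
Qed.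

Lemma special_affine_det : affine_det special_lengths != 0.
Proof.
pose B : 'M[int]_4 := \matrix_(i, j) entry int
  [:: [:: 0; -1; 2; -1]; [:: -1; 0; 2; -1]; [:: -1; -1; 3; -1]; [:: 1; 1; -2; 1]] i j.
suff e : (\matrix_(j < 4, k < 4) nth 1 [:: gap special_lengths 0 j; gap special_lengths 1 j;
    gap special_lengths 2 j] k) *m B = 1%:M.
  by apply: contra_eq_neq (congr1 determinant e); rewrite det_mulmx /affine_det => ->; rewrite mul0r det1.
apply/matrixP => j k; rewrite !mxE.
under eq_bigr do rewrite !mxE.
rewrite !big_ord_recl big_ord0.
by case: j => [[|[|[|[|]]]]] //= ?; case: k => [[|[|[|[|]]]]].
Qed.

Lemma size_params (R : comNzRingType) (d : nat -> nat -> R) : size (params d) = 31%N.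
Proof. by rewrite size_cat size_mkseq. Qed.

Lemma special_polar_params :
  map intr (polar_params special_lengths 0 2) = map zf special_linear.
Proof.
rewrite /polar_params special_inverse_gram special_denominator -map_comp.
rewrite (_ : map _ _ = [seq 52%:R ^+ 5 * entry F23 special_gram 2 k +
    52%:R ^+ 6 * entry F23 [:: [:: 0; -1; 0; -1; 1]] 0 k | k <- iota 0 5]); last first.
  apply/eq_in_map => k; rewrite mem_iota add0n => /andP [_ hk] /=.
  set q := \row_i _; set W := \matrix_(i, j) _.
  have scale (c : int) : (q *m (c *: W)) 0 (inord k) = c * (q *m W) 0 (inord k).
    by rewrite -scalemxAr mxE.
  have pow n : ((52 : int) ^+ n)%:~R = 52%:R ^+ n :> F23 by rewrite rmorphXn.
  rewrite scale intrD; apply: congr2; rewrite intrM pow; apply: congr1.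
    rewrite mxE; under eq_bigr do rewrite !mxE.
    rewrite !big_ord_recl big_ord0 inordK //.
    by case: k hk {scale} => [|[|[|[|[|]]]]].
  by case: k hk {scale} => [|[|[|[|[|]]]]].
by apply/eqP; vm_compute.
Qed.

Lemma special_pivot_det : pivot_det (params special_lengths) != 0.
Proof.
apply/eqP => e; have := pivot_det_special.
by rewrite -special_params_mod -map_pivot_det e rmorph0 eqxx.
Qed.

Lemma special_collinearity : collinearity special_lengths 0 2 != 0.
Proof.
apply/eqP => e; have := multiplication_special.
rewrite -special_params_mod -special_polar_params -map_multiplication_mx det_map_mx.
move: e; rewrite /collinearity; set B := multiplication_mx _ _.
(* What remains is the determinant of minus the square of the multiplication matrix, known to be
   nonzero modulo 23. *)
rewrite [special_lengths 0 0 * _]mulr0 mulr0 mul0r raddf0 sub0r -scaleN1r detZ det_mulmx.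
have : (-1) ^+ 38 != 0 :> int by rewrite signr_eq0.
move: (\det B) ((-1) ^+ 38) => b a a0 /eqP.
rewrite mulf_eq0 (negPf a0) mulf_eq0 orbb => /eqP ->.
by rewrite rmorph0 eqxx.
Qed.

Definition lengths (R : Type) (x : 'I_4 * 'I_6 -> R) (i j : nat) : R := x (inord i, inord j).

(** A quantity computed alike in all commutative rings is a polynomial in the lengths, namely its
    own value at indeterminates; nonvanishing at one integer point suffices in characteristic
    zero. *)
Lemma generic_natural (K : numFieldType) (F : forall R : comNzRingType, (nat -> nat -> R) -> R) :
  (forall (R S : comNzRingType) (f : {rmorphism R -> S}) d e,
    (forall i j, (i < 4)%N -> (j < 6)%N -> e i j = f (d i j)) -> f (F R d) = F S e) ->
  F int special_lengths != 0 ->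
  generically (fun x : 'I_4 * 'I_6 -> K => F K (lengths x) != 0).
Proof.
move=> natural F0.
pose var i j : mpoly #|{: 'I_4 * 'I_6}| K := mpolyX _ (mnm1 (enum_rank (inord i, inord j))).
pose ev (x : 'I_4 * 'I_6 -> K) : {rmorphism mpoly #|{: 'I_4 * 'I_6}| K -> K} :=
  meval (fun i => x (enum_val i)).
have evE x i j : (i < 4)%N -> (j < 6)%N -> lengths x i j = ev x (var i j).
  by rewrite /ev /= mevalXU enum_rankK.
pose point (ij : 'I_4 * 'I_6) : K := (special_lengths ij.1 ij.2)%:~R.
have pointE i j : (i < 4)%N -> (j < 6)%N -> lengths point i j = intr (special_lengths i j).
  by move=> hi hj; rewrite /lengths /point !inordK.
apply: (@generically_polyfun _ _ _ (fun x => F K (lengths x)) point) => //.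
  by exists (F _ var) => x; rewrite -(natural _ _ _ _ _ (evE x)).
by rewrite -(natural _ _ _ _ _ pointE) intr_eq0.
Qed.

Lemma params_generic (K : numFieldType) : generically (fun x : 'I_4 * 'I_6 -> K =>
  [/\ affine_det (lengths x) != 0, denominator (lengths x) != 0, pivot_det (params (lengths x)) != 0
    & collinearity (lengths x) 0 2 != 0]).
Proof.
have h1 := @generic_natural K affine_det map_affine_det special_affine_det.
have h2 := @generic_natural K denominator map_denominator _.
have h3 := @generic_natural K (fun R d => pivot_det (params d)) _ special_pivot_det.
have h4 := @generic_natural K (fun R d => collinearity d 0 2) _ special_collinearity.
apply: generic_mono (generic_and (generic_and h1 (h2 _)) (generic_and (h3 _) (h4 _))).
- by move=> x [[? ?] [? ?]].
- by rewrite special_denominator expf_neq0.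
- by move=> R S f d e de; rewrite map_pivot_det (map_params de).
- by move=> R S f d e de; apply: map_collinearity.
Qed.

(** * Realizations of K_{4,6} as solutions of the system *)

Section Vanishing.
Variables (K : fieldType) (H11 H12 H13 H22 H23 H33 s : K).

Let a11 := H22 * H33 - H23 * H23.
Let a22 := H11 * H33 - H13 * H13.
Let a33 := H11 * H22 - H12 * H12.
Let D := H11 * a11 + H12 * (H13 * H23 - H12 * H33) + H13 * (H12 * H23 - H13 * H22).

(* The diagonal entries of the Gram matrix are those of the adjugate of its
   inverse [H] divided by [D = det H]. *)
Lemma generators_vanish p1 p2 p3 h1 h2 h3 c k : D != 0 ->
  D * p1 = a11 -> D * p2 = a22 -> D * p3 = a33 ->
  h1 = H11 * p1 + H12 * p2 + H13 * p3 ->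
  h2 = H12 * p1 + H22 * p2 + H23 * p3 ->
  h3 = H13 * p1 + H23 * p2 + H33 * p3 ->
  c = h1 * p1 + h2 * p2 + h3 * p3 ->
  (k < size generators)%N ->
  @interp (ring_ops K) [:: s * H11; s * H12; s * H13; s * H22; s * H23; s * H33;
    s * h1; s * h2; s * h3; s * c; s] (nth (EVar 0) generators k) = 0.
Proof.
move=> D0 e1 e2 e3 -> -> -> -> hk.
have {e1}-> : p1 = a11 / D by rewrite -e1 mulrC mulKf.
have {e2}-> : p2 = a22 / D by rewrite -e2 mulrC mulKf.
have {e3}-> : p3 = a33 / D by rewrite -e3 mulrC mulKf.
move: D0; rewrite /D /a11 /a22 /a33.
do 10!(case: k hk => [_|k hk]; first by move=> D0 /=; field).
by case: k hk.
Qed.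
End Vanishing.

Lemma symmetric_cramer (R : comNzRingType) (a b c d e f x y z r1 r2 r3 : R) :
  a * x + b * y + c * z = r1 -> b * x + d * y + e * z = r2 -> c * x + e * y + f * z = r3 ->
  let D := a * (d * f - e * e) + b * (c * e - b * f) + c * (b * e - c * d) in
  [/\ D * x = (d * f - e * e) * r1 + (c * e - b * f) * r2 + (b * e - c * d) * r3,
      D * y = (c * e - b * f) * r1 + (a * f - c * c) * r2 + (b * c - a * e) * r3
    & D * z = (b * e - c * d) * r1 + (b * c - a * e) * r2 + (a * d - b * b) * r3].
Proof. by move=> <- <- <-; split; ring. Qed.

Lemma peval_param_env (R : comNzRingType) (w : seq R) (t1 t2 t3 t4 : R) :
  let L k := nth 0 w (5 * k + 0) + nth 0 w (5 * k + 1) * t1 + nth 0 w (5 * k + 2) * t2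
    + nth 0 w (5 * k + 3) * t3 + nth 0 w (5 * k + 4) * t4 in
  let s := nth 0 w 30 in
  [seq peval4 t1 t2 t3 t4 q | q <- param_env (O := ring_ops R) w] =
  [:: L 0%N; L 1%N; L 2%N; L 3%N; L 4%N; L 5%N; s * t1; s * t2; s * t3; s * t4; s].
Proof.
move=> L s; rewrite /L /s /param_env /linear_form /peval4 /=.
do 10!(congr (_ :: _); first by ring).
by congr (_ :: _); ring.
Qed.

Section Realization.
Variables (K : numFieldType) (rho : 'I_4 + 'I_6 -> 'rV[K]_3).

Definition apex (i : nat) : 'rV[K]_3 := rho (inl (inord i)).
Definition node (j : nat) : 'rV[K]_3 := rho (inr (inord j)).
Definition squared_lengths (ij : 'I_4 * 'I_6) : K := sqdist (rho (inl ij.1)) (rho (inr ij.2)).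

Let d := lengths squared_lengths.
Let u (i : nat) := apex i.+1 - apex 0.

Definition frame : 'M[K]_3 := mat3 (u 0%N) (u 1%N) (u 2%N).
Definition inverse_gram : 'M[K]_3 := invmx (frame *m frame^T).

Let p i := dot (u i) (u i).
Let z j := row3 (p 0%N - gap d 0 j) (p 1%N - gap d 1 j) (p 2%N - gap d 2 j).

Hypothesis reg : affine_det d != 0.

Lemma node_dot j i : dot (node j - apex 0) (u i) = (p i - gap d i j) / 2%:R.
Proof.
rewrite polarization /p -sqdistE /gap /d /lengths /squared_lengths /=.
rewrite -/(apex 0) -/(node j) -/(apex i.+1) (sqdistC (node j) (apex i.+1)) (sqdistC (node j)).
by congr (_ / _); ring.
Qed.

Lemma node_frame j : (node j - apex 0) *m frame^T = 2%:R^-1 *: z j.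
Proof.
rewrite [LHS]row3P /z row3Z /frame; apply: row3_eq.
all: rewrite mulrC -node_dot /dot !mxE; apply: eq_bigr => k _; by rewrite !mxE.
Qed.

(** A relation v among the frame vectors is orthogonal to every z_j, which is an affine relation
    between the gaps, excluded by [affine_det]. *)
Lemma frame_unit : frame \in unitmx.
Proof.
rewrite unitmxE unitfE; apply/det0P => -[v v0 hv].
pose e : K := \sum_(i < 3) v 0 i * p i.
have perp j : dot v (z j) = 0.
  have : dot v (2%:R^-1 *: z j) = 0.
    by rewrite -node_frame /dot trmx_mul trmxK mulmxA hv mul0mx mxE.
  by move/eqP; rewrite dotZr mulf_eq0 invr_eq0 pnatr_eq0 /= => /eqP.
move: reg; rewrite /affine_det; set B := \matrix_(j, k) _ => B0.
have uB : B \in unitmx by rewrite unitmxE unitfE.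
(* The default of [nth] supplies the fourth entry, matching the column of ones in [affine_det]. *)
pose q : 'cV[K]_4 := \col_k nth (- e) [:: v 0 i0; v 0 i1; v 0 i2] k.
have Bq : B *m q = 0.
  apply/colP => j; transitivity (- dot v (z j)); last by rewrite perp oppr0 mxE.
  rewrite dot_coord !row3E mxE.
  under eq_bigr do rewrite !mxE.
  have -> : e = v 0 i0 * p 0%N + v 0 i1 * p 1%N + v 0 i2 * p 2%N.
    by rewrite /e !big_ord_recl big_ord0 addr0 addrA.
  rewrite !big_ord_recl big_ord0 /=.
  ring.
case/eqP: v0; rewrite [v]row3P.
have q0 : q = 0 by rewrite -(mulKmx uB q) Bq mulmx0.
have coord (k : 'I_4) : q k 0 = 0 by rewrite q0 mxE.
by rewrite row30; apply: row3_eq; [have := coord (inord 0)|have := coord (inord 1)|have := coord (inord 2)];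
  rewrite !mxE inordK.
Qed.

Lemma gram_unit : frame *m frame^T \in unitmx.
Proof. by rewrite unitmx_mul unitmx_tr frame_unit. Qed.

Lemma inverse_gram_sym i j : inverse_gram i j = inverse_gram j i.
Proof.
have e : inverse_gram^T = inverse_gram by rewrite /inverse_gram trmx_inv trmx_mul trmxK.
by rewrite -{1}e mxE.
Qed.

(** z_j is twice the vector of inner products of the node with the frame F, and F^T (F F^T)^-1 F is
    the identity. *)
Lemma node_inner j k : (z j *m inverse_gram *m (z k)^T) 0 0 =
  4%:R * dot (node j - apex 0) (node k - apex 0).
Proof.
have hz i : z i = 2%:R *: ((node i - apex 0) *m frame^T).
  by rewrite node_frame scalerA mulfV ?scale1r ?pnatr_eq0.
have e : frame^T *m inverse_gram *m frame = 1%:M.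
  by apply: mulmx1C; rewrite mulmxA mulmxV ?gram_unit.
have -> : z j *m inverse_gram *m (z k)^T =
    4%:R *: ((node j - apex 0) *m (node k - apex 0)^T).
  rewrite !hz linearZ /= -!scalemxAl -scalemxAr scalerA -natrM trmx_mul trmxK.
  by rewrite mulmxA -(mulmxA _ frame^T) -(mulmxA _ (frame^T *m _)) e mulmx1.
by rewrite mxE.
Qed.

Lemma node_sqdist j : dot (node j - apex 0) (node j - apex 0) = d 0%N j.
Proof. by rewrite -sqdistE sqdistC. Qed.

(** Twice the coordinates, in the frame, of the circumcentre of the four apexes; [polar_const] is
    four times the squared circumradius. *)
Definition polar (i : 'I_3) : K :=
  inverse_gram i i0 * p 0%N + inverse_gram i i1 * p 1%N + inverse_gram i i2 * p 2%N.

Definition polar_const : K := polar i0 * p 0%N + polar i1 * p 1%N + polar i2 * p 2%N.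

Definition polar_coords : 'rV[K]_4 := \row_k nth polar_const [:: polar i0; polar i1; polar i2] k.

Let H := inverse_gram.

Definition gram_entries : 'cV[K]_6 :=
  \col_k nth 0 [:: H i0 i0; H i0 i1; H i0 i2; H i1 i1; H i1 i2; H i2 i2] k.

Let coords_col : 'cV[K]_5 := \col_k nth 1 [:: 1; polar i0; polar i1; polar i2; polar_const] k.

Let quadric_expand (j : 'I_6) : (z j *m H *m (z j)^T) 0 0 =
  (quadric_mx d *m gram_entries) j 0 - (affine_mx d *m coords_col) j 0 + 4%:R * d 0%N j.
Proof.
rewrite ![in RHS]mxE.
under [X in _ = X - _ + _]eq_bigr do rewrite !mxE.
under [X in _ = _ - X + _]eq_bigr do rewrite !mxE.
rewrite !big_ord_recl !big_ord0 /= !mxE !big_ord_recl !big_ord0 !mxE !big_ord_recl !big_ord0 !row3E /=.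
rewrite -/i0 -/i1 -/i2 /polar_const /polar -/H.
have sym : forall k l, H k l = H l k := inverse_gram_sym.
rewrite (sym i1 i0) (sym i2 i0) (sym i2 i1).
ring.
Qed.

(** The distance from node j to apex 0 gives z_j H z_j^T = 4 d_0j with z_j = p - gap_j; once Hp and
    p^T H p are named, this is linear in the entries of H. *)
Lemma quadric_equation : quadric_mx d *m gram_entries = affine_mx d *m coords_col.
Proof.
apply/colP => j; have := node_inner j j; rewrite quadric_expand node_sqdist.
move/(congr1 (fun x => x - 4%:R * d 0%N j)); rewrite addrK subrr => /eqP.
by rewrite subr_eq0 => /eqP.
Qed.

Lemma inverse_gram_coords : denominator d != 0 ->
  inverse_gram_mx d *m coords_col = denominator d *: gram_entries.
Proof.
move=> s0; set s := denominator d; set Y := interpolation_mx K.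
have e : quadric_mx d *m (s^-1 *: (Y *m \adj (quadric_mx d *m Y))) = 1%:M.
  by rewrite -scalemxAr mulmxA mul_mx_adj -/(denominator d) scale_scalar_mx mulVf.
rewrite /inverse_gram_mx -!mulmxA -quadric_equation !mulmxA -/Y.
have e2 : Y *m \adj (quadric_mx d *m Y) *m quadric_mx d = s%:M.
  by rewrite -(scale1r (Y *m _)) -(mulfV s0) -scalerA -scalemxAl (mulmx1C e) scalemx1.
by rewrite e2 mul_scalar_mx.
Qed.

Lemma gram_relations :
  let D := H i0 i0 * (H i1 i1 * H i2 i2 - H i1 i2 * H i1 i2)
    + H i0 i1 * (H i0 i2 * H i1 i2 - H i0 i1 * H i2 i2)
    + H i0 i2 * (H i0 i1 * H i1 i2 - H i0 i2 * H i1 i1) in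
  [/\ D != 0, D * p 0%N = H i1 i1 * H i2 i2 - H i1 i2 * H i1 i2,
      D * p 1%N = H i0 i0 * H i2 i2 - H i0 i2 * H i0 i2
    & D * p 2%N = H i0 i0 * H i1 i1 - H i0 i1 * H i0 i1].
Proof.
move=> D; have sym : forall k l, H k l = H l k := inverse_gram_sym.
have e (i j : 'I_3) : H i i0 * dot (u 0%N) (u j) + H i i1 * dot (u 1%N) (u j) +
    H i i2 * dot (u 2%N) (u j) = (i == j)%:R.
  transitivity ((H *m (frame *m frame^T)) i j).
    rewrite [RHS]mxE !big_ord_recl big_ord0 !mat3_mul_tr addr0 addrA.
    by case: j => [[|[|[|]]]].
  by rewrite /H mulVmx ?gram_unit // mxE.
split.
- have : \det H != 0 by rewrite -unitfE -unitmxE unitmx_inv gram_unit.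
  have -> : H = mat3 (row i0 H) (row i1 H) (row i2 H).
    by apply/matrixP => -[[|[|[|]]] hi] // j; rewrite !mxE /=; congr (H _ j); apply/val_inj.
  rewrite det_mat3 dot_coord /cross !row3E !mxE (sym i1 i0) (sym i2 i0) (sym i2 i1).
  by congr (_ != 0); rewrite /D; ring.
- move: (e i0 i0) (e i1 i0) (e i2 i0); rewrite (sym i1 i0) (sym i2 i0) (sym i2 i1) => E0 E1 E2.
  by have [-> _ _] := symmetric_cramer E0 E1 E2; rewrite mulr1 !mulr0 !addr0.
- move: (e i0 i1) (e i1 i1) (e i2 i1); rewrite (sym i1 i0) (sym i2 i0) (sym i2 i1) => E0 E1 E2.
  by have [_ -> _] := symmetric_cramer E0 E1 E2; rewrite mulr1 !mulr0 addr0 add0r.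
- move: (e i0 i2) (e i1 i2) (e i2 i2); rewrite (sym i1 i0) (sym i2 i0) (sym i2 i1) => E0 E1 E2.
  by have [_ _ ->] := symmetric_cramer E0 E1 E2; rewrite mulr1 !mulr0 !add0r.
Qed.

Lemma polar_solves : denominator d != 0 ->
  solves (params d) (polar i0) (polar i1) (polar i2) polar_const.
Proof.
move=> s0 k hk; set s := denominator d.
have [D0 e0 e1 e2] := gram_relations.
have sym : forall k l, H k l = H l k := inverse_gram_sym.
have ent r : (r < 6)%N -> let p c := nth 0 (params d) (5 * r + c) in
    p 0%N + p 1%N * polar i0 + p 2%N * polar i1 + p 3%N * polar i2 + p 4%N * polar_const
      = s * nth 0 [:: H i0 i0; H i0 i1; H i0 i2; H i1 i1; H i1 i2; H i2 i2] r.
  move=> hr q; have := congr1 (fun A : 'cV_6 => A (Ordinal hr) 0) (inverse_gram_coords s0).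
  have qE (c : 'I_5) : q c = inverse_gram_mx d (Ordinal hr) c.
    have lt30 : (5 * r + c < 30)%N.
      by rewrite (leq_trans (n := 5 * r + 5)) ?ltn_add2l // -mulnSr -[30%N]/(5 * 6)%N leq_pmul2l.
    rewrite /q nth_cat size_mkseq lt30 nth_mkseq //.
    congr (inverse_gram_mx d _ _); apply/val_inj; rewrite /= inordK.
    - by rewrite mulnC divnMDl // divn_small ?addn0.
    - by rewrite ltn_divLR // mulnC.
    - by rewrite mulnC modnMDl modn_small.
    - by rewrite ltn_pmod.
  rewrite [RHS]mxE [gram_entries _ _]mxE => <-.
  by rewrite mxE !big_ord_recl big_ord0 -!qE !mxE /= mulr1 addr0 !addrA.
have p30 : nth 0 (params d) 30 = s by rewrite nth_cat size_mkseq.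
have h1 : polar i1 = H i0 i1 * p 0%N + H i1 i1 * p 1%N + H i1 i2 * p 2%N by rewrite -(sym i1 i0).
have h2 : polar i2 = H i0 i2 * p 0%N + H i1 i2 * p 1%N + H i2 i2 * p 2%N.
  by rewrite -(sym i2 i0) -(sym i2 i1).
rewrite -[RHS](generators_vanish s D0 e0 e1 e2 erefl h1 h2 erefl hk).
congr interp; rewrite peval_param_env p30; congr [:: _, _, _, _, _, _ & _].
all: exact: ent.
Qed.

Lemma polar_params_value j k : denominator d != 0 -> (j < 6)%N -> (k < 6)%N ->
  linear_val (polar_params d j k) (coords polar_coords) =
  denominator d * (4%:R * dot (node j - apex 0) (node k - apex 0)).
Proof.
move=> s0 hj hk; rewrite -node_inner.
have lin (l : 'I_5 -> K) : l ord0 + \sum_(i < 4) l (lift ord0 i) * nth 0 (coords polar_coords) i =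
    \sum_i l i * coords_col i 0.
  rewrite [RHS]big_ord_recl mxE mulr1; congr (_ + _); apply: eq_bigr => i _; congr (_ * _).
  rewrite nth_mkseq // !mxE inordK //; by case: i => [[|[|[|[|]]]]].
rewrite /linear_val (lin (fun i => nth 0 (polar_params d j k) i)) /polar_params.
under eq_bigr do rewrite nth_mkseq // inord_val mulrDl.
set q := \row_i _; rewrite big_split /=.
have -> : \sum_(i < 5) (q *m inverse_gram_mx d) 0 i * coords_col i 0 =
    denominator d * (q *m gram_entries) 0 0.
  transitivity ((q *m inverse_gram_mx d *m coords_col) 0 0); first by rewrite [RHS]mxE.
  by rewrite -mulmxA inverse_gram_coords // -scalemxAr mxE.
under eq_bigr do rewrite -mulrA.
rewrite -mulr_sumr -mulrDr; congr (_ * _).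
rewrite mxE; under eq_bigr do rewrite !mxE.
rewrite !big_ord_recl !big_ord0 /= !mxE !big_ord_recl !big_ord0 !mxE !big_ord_recl !big_ord0 !row3E /=.
rewrite -/i0 -/i1 -/i2 /polar_const /polar -/H.
have sym : forall k l, H k l = H l k := inverse_gram_sym.
rewrite (sym i1 i0) (sym i2 i0) (sym i2 i1).
ring.
Qed.

End Realization.

Section Congruence.
Variables (K : numFieldType) (rho rho' : 'I_4 + 'I_6 -> 'rV[K]_3).
Hypothesis same_lengths : squared_lengths rho = squared_lengths rho'.
Hypotheses (reg : affine_det (lengths (squared_lengths rho)) != 0)
  (s0 : denominator (lengths (squared_lengths rho)) != 0).
Hypothesis same_coords : polar_coords rho = polar_coords rho'.

Let reg' : affine_det (lengths (squared_lengths rho')) != 0.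
Proof. by rewrite -same_lengths. Qed.

Let s0' : denominator (lengths (squared_lengths rho')) != 0.
Proof. by rewrite -same_lengths. Qed.

Let same_inverse_gram : inverse_gram rho = inverse_gram rho'.
Proof.
have same_entries : gram_entries rho = gram_entries rho'.
  apply: (scalerI s0); rewrite -(inverse_gram_coords reg s0).
  rewrite [in RHS]same_lengths -(inverse_gram_coords reg' s0') same_lengths.
  congr (_ *m _); apply/colP => k; rewrite !mxE.
  have e (j : 'I_4) : polar_coords rho 0 j = polar_coords rho' 0 j by rewrite same_coords.
  move: (e (inord 0)) (e (inord 1)) (e (inord 2)) (e (inord 3)); rewrite !mxE !inordK //=.
  by move=> -> -> -> ->.
have e (k : nat) : (k < 6)%N -> gram_entries rho (inord k) 0 = gram_entries rho' (inord k) 0.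
  by rewrite same_entries.
have sym := inverse_gram_sym rho; have sym' := inverse_gram_sym rho'.
move: (e 0%N isT) (e 1%N isT) (e 2%N isT) (e 3%N isT) (e 4%N isT) (e 5%N isT).
rewrite !mxE !inordK //= => e0 e1 e2 e3 e4 e5.
apply/matrixP => a b; case: (ord3P a) => ->; case: (ord3P b) => -> //.
- by rewrite sym sym'.
- by rewrite sym sym'.
- by rewrite sym sym'.
Qed.

Let same_gram : frame rho *m (frame rho)^T = frame rho' *m (frame rho')^T.
Proof. by rewrite -[LHS]invmxK -[RHS]invmxK -/(inverse_gram rho) same_inverse_gram. Qed.

(** Equal polar coordinates give equal H, hence equal Gram matrices, so the frames differ by an
    orthogonal matrix; each node is determined by its inner products with the frame. *)
Lemma orthogonally_congruent : exists (A : 'M[K]_3) (t : 'rV[K]_3),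
  A *m A^T = 1%:M /\ forall v, rho' v = rho v *m A + t.
Proof.
set F := frame rho; set F' := frame rho'; have uF : F \in unitmx := frame_unit reg.
pose A := invmx F *m F'; have FA : F *m A = F' by rewrite mulmxA mulmxV ?mul1mx.
have hA : A *m A^T = 1%:M.
  rewrite trmx_mul mulmxA -(mulmxA _ F') -same_gram !mulmxA mulVmx // mul1mx.
  by rewrite trmx_inv mulmxV ?unitmx_tr.
exists A, (apex rho' 0 - apex rho 0 *m A); split=> //.
suff main v : rho' v - apex rho' 0 = (rho v - apex rho 0) *m A.
  by move=> v; rewrite addrCA -mulmxBl -main addrC subrK.
have vertex i : (i < 3)%N -> apex rho' i.+1 - apex rho' 0 = (apex rho i.+1 - apex rho 0) *m A.
  move: FA; rewrite /F /F' /frame mat3_mul => e.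
  have e' k := congr1 (fun B : 'M_3 => row k B) e.
  move: (e' i0) (e' i1) (e' i2); rewrite !row_mat3 => E0 E1 E2.
  by case: i => [|[|[|]]].
have p_eq i : (i < 3)%N -> dot (apex rho' i.+1 - apex rho' 0) (apex rho' i.+1 - apex rho' 0) =
    dot (apex rho i.+1 - apex rho 0) (apex rho i.+1 - apex rho 0).
  by move=> /vertex ->; rewrite dot_orthogonal.
case: v => [i|j].
  have e r : r (inl i) = apex r i by rewrite /apex inord_val.
  rewrite !e; case: i {e} => [[|i] /= hi]; last exact: vertex.
  by rewrite !subrr mul0mx.
have := node_frame rho' j; rewrite !p_eq // -same_lengths -node_frame.
rewrite -/F -/F' /node inord_val -FA trmx_mul mulmxA => /(congr1 (fun x => x *m invmx F^T)).
rewrite !mulmxK ?unitmx_tr // => <-.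
by rewrite -mulmxA (mulmx1C hA) mulmx1.
Qed.
End Congruence.

(** * The complete bipartite graph K_{4,6} *)

Definition K46 : {set {set 'I_4 + 'I_6}} :=
  [set [set inl ij.1; inr ij.2] | ij : 'I_4 * 'I_6].

Lemma K46_mem (ij : 'I_4 * 'I_6) : [set inl ij.1; inr ij.2] \in K46.
Proof. exact: imset_f. Qed.

Definition K46_edge (ij : 'I_4 * 'I_6) : edge K46 := mk_edge (K46_mem ij).

Lemma K46_edge_inj : injective K46_edge.
Proof.
move=> [i j] [i' j'] /(congr1 val) /= e.
have := set21 (inl i : 'I_4 + 'I_6) (inr j); rewrite e !inE => /orP [/eqP [->]|/eqP //].
by have := set22 (inl i : 'I_4 + 'I_6) (inr j); rewrite e !inE => /orP [/eqP //|/eqP [->]].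
Qed.

Lemma K46_simple : simple_graph K46.
Proof. by move=> e /imsetP [ij _ ->]; rewrite cards2. Qed.

Lemma compatible_lengths (R : realType) (l : edge K46 -> R[i]) rho :
  compatible l rho -> squared_lengths rho = l \o K46_edge.
Proof. by move=> hrho; apply/funext => ij; apply: hrho. Qed.

(** The two nodes are not adjacent, so their inner product is not a function of the lengths; it is
    the value of a linear form at the solution, and [collinearity] excludes the degenerate value. *)
Lemma K46_nondegenerate (R : realType) :
  nondegenerate_triangle R K46 (inl ord0) (inr ord0) (inr (inord 2)).
Proof.
apply: generic_mono (generic_pull K46_edge_inj (params_generic _)) => l [reg s0 reg' col].
move=> rho /compatible_lengths hrho.
have regr : affine_det (lengths (squared_lengths rho)) != 0 by rewrite hrho.
have s0r : denominator (lengths (squared_lengths rho)) != 0 by rewrite hrho.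
have sol : solution (params (lengths (l \o K46_edge))) (polar_coords rho).
  by have := polar_solves regr s0r; rewrite hrho /solution !mxE !inordK.
have := linear_val_neq0 (size_params _) col sol.
rewrite -hrho polar_params_value // -!node_sqdist /node /apex; apply: contra_neq.
have e0 (n : nat) : inord 0 = ord0 :> 'I_n.+1 by apply/val_inj; rewrite /= inordK.
rewrite !e0 /gram => /eqP; rewrite subr_eq0 => /eqP ->; ring.
Qed.

(** At most 38 polar coordinates occur, each shared by at most two direct classes, mirror images of
    each other. *)
Lemma K46_covers (R : realType) : covers R K46 (2 * 38).
Proof.
apply: generic_mono (generic_pull K46_edge_inj (params_generic _)) => l [reg s0 reg' _].
have [s size_s hs] := solutions_bounded (size_params _) reg'.
have len rho := @compatible_lengths _ l rho.
apply: (@cover_fibres2 _ _ 'I_38 38 _ (fun k rho => polar_coords rho = nth 0 s k)); first exact: card_ord.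
  move=> rho /len hrho; have regr : affine_det (lengths (squared_lengths rho)) != 0 by rewrite hrho.
  have s0r : denominator (lengths (squared_lengths rho)) != 0 by rewrite hrho.
  have := polar_solves regr s0r; rewrite hrho => sol.
  have hin : polar_coords rho \in s by apply: hs; rewrite /solution !mxE !inordK.
  have lt38 : (index (polar_coords rho) s < 38)%N by apply: leq_trans size_s; rewrite index_mem.
  by exists (Ordinal lt38); rewrite nth_index.
move=> k r1 r2 r3 /len l1 /len l2 /len l3 t1 t2 t3.
have iso (r r' : 'I_4 + 'I_6 -> 'rV[R[i]]_3) : squared_lengths r = l \o K46_edge ->
    squared_lengths r' = l \o K46_edge -> polar_coords r = nth 0 s k ->
    polar_coords r' = nth 0 s k ->
    exists A t, [/\ A *m A^T = 1%:M, \det A = 1 \/ \det A = -1 & forall v, r' v = r v *m A + t].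
  move=> hr hr' tr tr'.
  have [|||| A [t [hA h]]] := @orthogonally_congruent _ r r'; rewrite ?hr ?hr' ?tr ?tr' //.
  exists A, t; split=> //.
  have : \det A ^+ 2 = 1 by rewrite expr2 -{2}det_tr -det_mulmx hA det1.
  by move/eqP; rewrite sqrf_eq1 => /orP [] /eqP ->; [left|right].
have [A [t [hA [dA|dA] h]]] := iso _ _ l1 l2 t1 t2; first by apply: Or31; exists A, t.
have [B [u [hB [dB|dB] h']]] := iso _ _ l1 l3 t1 t3; first by apply: Or32; exists B, u.
(* Both other realizations are mirror images of [r1], so the isometry between them has determinant
   1. *)
apply: Or33; exists (A^T *m B), (- t *m A^T *m B + u); split.
- by rewrite trmx_mul trmxK mulmxA -(mulmxA A^T) hB mulmx1 (mulmx1C hA).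
- by rewrite det_mulmx det_tr dA dB mulrNN mulr1.
- move=> v; rewrite h h' mulmxA mulmxDl -(mulmxA (r1 v)) hA mulmx1.
  by rewrite addrA -mulmxDl mulNmx addrK.
Qed.

(** Velocities dual to the edges at p give a square matrix of rates, polynomial in the configuration
    and equal to the identity at p; wherever it is invertible the rates are onto. *)
Lemma independent_of_point (K : numFieldType) (V : finType) (E : {set {set V}})
    (p : V -> 'rV[K]_3) : simple_graph E -> rigidity_onto E p -> independent K E.
Proof.
move=> simpleE onto.
have [ends hends] := edge_ends simpleE.
have /choice [vel hvel] : forall e : edge E, exists v : V -> 'rV[K]_3, forall e' x y,
    val e' = [set x; y] -> dot (p x - p y) (v x - v y) = (e' == e)%:R.
  by move=> e; apply: onto.
pose pair (q : V -> 'rV[K]_3) (v : V -> 'rV[K]_3) e := let ab := ends e in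
  dot (q ab.1 - q ab.2) (v ab.1 - v ab.2).
pose T x : 'M[K]_#|edge E| := \matrix_(i, j)
  pair (realization_of x) (vel (enum_val j)) (enum_val i).
apply: (@generically_polyfun _ _ _ (fun x => \det (T x)) (fun vc => p vc.1 0 vc.2)).
- apply: polyfun_det => i j; pose w := vel (enum_val j) (ends (enum_val i)).1 - vel (enum_val j) (ends (enum_val i)).2.
  apply: (@polyfun_ext _ _ (fun x : V * 'I_3 -> K => \sum_(k < 3)
    (x ((ends (enum_val i)).1, k) - x ((ends (enum_val i)).2, k)) * w 0 k)).
    by move=> x; rewrite mxE /pair /dot mxE; apply: eq_bigr => k _; rewrite !mxE.
  apply: polyfun_sum => k; apply: polyfunM (polyfun_const _ _).
  by apply: polyfunB; apply: polyfun_coord.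
- rewrite (_ : T _ = 1%:M) ?det1 ?oner_eq0 //; apply/matrixP => i j; rewrite !mxE /pair.
  have -> : realization_of (fun vc => p vc.1 0 vc.2) = p.
    by apply/funext => v; apply/rowP => k; rewrite mxE.
  by rewrite (hvel _ _ _ _ (hends _)) (inj_eq enum_val_inj).
- move=> x T0 w; have uT : T x \in unitmx by rewrite unitmxE unitfE.
  pose c := invmx (T x) *m \col_i w (enum_val i).
  exists (fun v => \sum_j c j 0 *: vel (enum_val j) v) => e a b eab.
  have main : pair (realization_of x) (fun v => \sum_j c j 0 *: vel (enum_val j) v) e = w e.
    have <- : (T x *m c) (enum_rank e) 0 = w e by rewrite mulKVmx // mxE enum_rankK.
    rewrite [RHS]mxE /pair -sumrB /dot linear_sum mulmx_sumr summxE.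
    apply: eq_bigr => j _; rewrite [in RHS]mxE enum_rankK mulrC -scalerBr linearZ -scalemxAr mxE.
    by [].
  rewrite -main /pair; have := hends e; rewrite eab => /set2_eq [[-> ->] //|[-> ->]].
  set u := realization_of x _; set v := realization_of x _.
  set s := \sum_j _; set t := \sum_j _.
  by rewrite -(opprB v u) -(opprB t s) !dot_coord !mxE !mulrNN.
Qed.

(* The point [0, e1, e2, e3] and [2 e_i], [e_i + e_k]: with the velocity of the
   origin zero, the six equations at the origin determine an upper triangular
   matrix of velocities of [e1, e2, e3]. *)
Lemma K46_independent (K : numFieldType) : independent K K46.
Proof.
pose a (i : 'I_4) : 'rV[K]_3 := nth 0 [:: 0; row3 1 0 0; row3 0 1 0; row3 0 0 1] i.
pose b (j : 'I_6) : 'rV[K]_3 := nth 0 [:: row3 2%:R 0 0; row3 0 2%:R 0; row3 0 0 2%:R;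
  row3 1 1 0; row3 1 0 1; row3 0 1 1] j.
apply: (@independent_of_point _ _ _ (fun v => match v with inl i => a i | inr j => b j end)).
  exact: K46_simple.
move=> w; pose W (i j : nat) := w (K46_edge (inord i, inord j)).
pose r (j : nat) (x y z : K) := W 0%N j - x * (W 0%N j - W 1%N j) - y * (W 0%N j - W 2%N j) - z * (W 0%N j - W 3%N j).
pose v1 := row3 (- r 0%N 2%:R 0 0 / 2%:R) (- r 3%N 1 1 0) (- r 4%N 1 0 1).
pose v2 := row3 0 (- r 1%N 0 2%:R 0 / 2%:R) (- r 5%N 0 1 1).
pose v3 := row3 0 0 (- r 2%N 0 0 2%:R / 2%:R).
pose va (i : 'I_4) : 'rV[K]_3 := nth 0 [:: 0; v1; v2; v3] i.
pose vb (j : 'I_6) : 'rV[K]_3 := row3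
  (v1 0 i0 - dot (b j) v1 + (W 0%N j - W 1%N j)) (v2 0 i1 - dot (b j) v2 + (W 0%N j - W 2%N j))
  (v3 0 i2 - dot (b j) v3 + (W 0%N j - W 3%N j)).
have main i j : dot (a i - b j) (va i - vb j) = w (K46_edge (i, j)).
  have -> : w (K46_edge (i, j)) = W i j by rewrite /W !inord_val.
  case: i => [[|[|[|[|]]]] hi] //; case: j => [[|[|[|[|[|[|]]]]]] hj] //=;
    rewrite /a /va /= /vb /b /= /v1 /v2 /v3 ?row3E !vecE /r; field; exact: isT.
exists (fun v : 'I_4 + 'I_6 => match v with inl i => va i | inr j => vb j end).
move=> e x y exy.
have [ij _ eij] := imsetP (valP e).
have -> : e = K46_edge (ij.1, ij.2) by apply/val_inj; rewrite [LHS]eij.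
move: exy; rewrite [val e]eij => /set2_eq [[<- <-]|[<- <-]]; rewrite -main //.
by rewrite -(opprB (a _)) -(opprB (va _)) !dot_coord !mxE !mulrNN.
Qed.

(** * The triangle *)

Definition clique (V : finType) : {set {set V}} := [set e : {set V} | #|e| == 2%N].

Lemma clique_simple V : simple_graph (clique V).
Proof. by move=> e; rewrite inE => /eqP. Qed.

Lemma clique_edge (V : finType) (x y : V) : ([set x; y] \in clique V) = (x != y).
Proof. by rewrite inE cards2 eqSS eqb1. Qed.

Lemma triangle_covers (R : realType) : covers R (clique 'I_3) 1.
Proof.
have nd := @nondegenerate_of_edges R _ (clique 'I_3) i0 i1 i2.
apply: generic_mono (nd _ _ _); rewrite ?clique_edge // => l {}nd.
apply: (@cover_fibres _ _ 'I_1 1 _ (fun _ _ => True)) (card_ord 1) _ _.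
  by exists ord0.
move=> _ rho rho' hrho hrho' _ _.
have len x y : sqdist (rho' x) (rho' y) = sqdist (rho x) (rho y).
  have [->|xy] := eqVneq x y; first by rewrite !sqdistE !subrr.
  have exy : [set x; y] \in clique 'I_3 by rewrite clique_edge.
  by rewrite (hrho (mk_edge exy) x y erefl) (hrho' (mk_edge exy) x y erefl).
have same x y z : dot (rho x - rho z) (rho y - rho z) = dot (rho' x - rho' z) (rho' y - rho' z).
  by rewrite !polarization !len.
have [A [hA dA h1 h2]] := orthogonal_transport (same i1 i1 i0) (same i2 i2 i0) (same i1 i2 i0) (nd _ hrho).
exists A, (rho' i0 - rho i0 *m A); split=> // v.
rewrite addrCA -mulmxBl.
by case: (ord3P v) => ->; rewrite ?h1 ?h2 ?subrr ?mul0mx ?addr0 // addrC subrK.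
Qed.

Lemma triangle_independent (K : numFieldType) : independent K (clique 'I_3).
Proof.
pose p (i : 'I_3) : 'rV[K]_3 := nth 0 [:: 0; row3 1 0 0; row3 0 1 0] i.
apply: (@independent_of_point K 'I_3 (clique 'I_3) p (@clique_simple _)) => w.
have e01 : [set i0; i1] \in clique 'I_3 by rewrite clique_edge.
have e02 : [set i0; i2] \in clique 'I_3 by rewrite clique_edge.
have e12 : [set i1; i2] \in clique 'I_3 by rewrite clique_edge.
pose a := w (mk_edge e01); pose b := w (mk_edge e02); pose c := w (mk_edge e12).
pose v (i : 'I_3) : 'rV[K]_3 := nth 0 [:: 0; row3 a 0 0; row3 (a + b - c) b 0] i.
exists v => e x y exy.
have hsym x' y' : dot (p x' - p y') (v x' - v y') = dot (p y' - p x') (v y' - v x').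
  by rewrite -(opprB (p x')) -(opprB (v x')) !dot_coord !mxE !mulrNN.
have main x' y' (exy' : [set x'; y'] \in clique 'I_3) : (x' < y')%N ->
    dot (p x' - p y') (v x' - v y') = w (mk_edge exy').
  move=> lt; have [[? ?]|[? ?]|[? ?]] : [\/ x' = i0 /\ y' = i1, x' = i0 /\ y' = i2 | x' = i1 /\ y' = i2].
    case: (ord3P x') lt => ->; case: (ord3P y') => -> // _;
      by [apply: Or31 | apply: Or32 | apply: Or33].
  - subst; have -> : w (mk_edge exy') = a by congr w; apply/val_inj.
    by rewrite /p /v /= !vecE; ring.
  - subst; have -> : w (mk_edge exy') = b by congr w; apply/val_inj.
    by rewrite /p /v /= !vecE; ring.
  - subst; have -> : w (mk_edge exy') = c by congr w; apply/val_inj.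
    by rewrite /p /v /= !vecE; ring.
have [lt|lt|eq] := ltngtP x y.
- have exy' : [set x; y] \in clique 'I_3 by rewrite -exy (valP e).
  by rewrite (main _ _ exy') //; congr w; apply/val_inj.
- have exy' : [set y; x] \in clique 'I_3 by rewrite setUC -exy (valP e).
  by rewrite hsym (main _ _ exy') //; congr w; apply/val_inj; rewrite /= setUC.
have := valP e; rewrite exy clique_edge; case/eqP.
exact/val_inj.
Qed.

(** * Rooted blocks and their assembly *)

Section ListMap.
Variables (V : finType) (k n : nat) (idx : V -> 'I_k) (inv : 'I_k -> V).
Hypotheses (idxK : cancel idx inv) (invK : cancel inv idx).

Definition list_map (L : seq nat) (v : V) : 'I_n.+1 := inord (nth 0%N L (idx v)).

Lemma list_map_val L v : size L = k -> all (ltn^~ n.+1) L -> list_map L v = nth 0%N L (idx v) :> nat.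
Proof. by move=> sL /(all_nthP 0%N) h; rewrite inordK //; apply: h; rewrite sL. Qed.

Lemma list_map_inj L : size L = k -> all (ltn^~ n.+1) L -> uniq L -> injective (list_map L).
Proof.
move=> sL bL uL u v /(congr1 val) /eqP; rewrite /= !list_map_val // nth_uniq ?sL //.
by move/eqP/val_inj/(can_inj idxK).
Qed.

Lemma list_map_onto L (x : 'I_n.+1) : size L = k -> all (ltn^~ n.+1) L -> (x : nat) \in L ->
  exists v, x = list_map L v.
Proof.
move=> sL bL xL; have hi : (index (x : nat) L < k)%N by rewrite -sL index_mem.
by exists (inv (Ordinal hi)); apply/val_inj; rewrite /= list_map_val // invK nth_index.
Qed.
End ListMap.

(* Vertices 0, 1, 2 span a triangle along which blocks can be glued. *)
Definition rooted_block (R : realType) (m N : nat) : Prop :=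
  exists E : {set {set 'I_m.+3}}, [/\ simple_graph E, independent R E, covers R E N &
    forall a b : 'I_m.+3, (a < 3)%N -> (b < 3)%N -> a != b -> [set a; b] \in E].

(** The lists number the vertices of the two copies. The root triangle consists of x (vertex 0) and
    the two copies of c (vertices 1 and 2), with the bar as its third side. *)
Lemma hinge_double (R : realType) (V : finType) (F : {set {set V}}) (k : nat) (idx : V -> 'I_k)
    (inv : 'I_k -> V) (x y c : V) (N m : nat) (L1 L2 : seq nat) :
  cancel idx inv -> cancel inv idx ->
  simple_graph F -> independent R F -> covers R F N -> nondegenerate_triangle R F x y c ->
  uniq [:: x; y; c] -> [set x; y] \in F -> [set x; c] \in F ->
  [&& size L1 == k, size L2 == k, all (ltn^~ m.+3) L1, all (ltn^~ m.+3) L2, uniq L1 & uniq L2] ->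
  [&& nth 0%N L1 (idx x) == 0%N, nth 0%N L2 (idx x) == 0%N,
      nth 0%N L1 (idx y) == nth 0%N L2 (idx y),
      nth 0%N L1 (idx c) == 1%N & nth 0%N L2 (idx c) == 2%N] ->
  all (fun v => (v \in L1) || (v \in L2)) (iota 0 m.+3) ->
  all (fun i => all (fun j => (nth 0%N L1 i == nth 0%N L2 j) ==>
    ((i == idx x :> nat) && (j == idx x :> nat)) || ((i == idx y :> nat) && (j == idx y :> nat)))
    (iota 0 k)) (iota 0 k) ->
  rooted_block R m (2 * (N * N)).
Proof.
move=> idxK invK simpleF indF covF ndF uxyc exy exc.
case/and5P => /eqP s1 /eqP s2 b1 b2 /andP [u1 u2] /and5P [/eqP x1 /eqP x2 /eqP y12 /eqP c1 /eqP c2].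
move=> /allP cover /allP over.
pose f1 := list_map m.+2 idx L1; pose f2 := list_map m.+2 idx L2.
have f1v v : f1 v = nth 0%N L1 (idx v) :> nat by apply: list_map_val.
have f2v v : f2 v = nth 0%N L2 (idx v) :> nat by apply: list_map_val.
have f1inj : injective f1 by apply: list_map_inj.
have f2inj : injective f2 by apply: list_map_inj.
have fcover v : (exists a, v = f1 a) \/ (exists b, v = f2 b).
  have /cover /orP [h|h] : (v : nat) \in iota 0 m.+3 by rewrite mem_iota add0n ltn_ord.
    by left; apply: (list_map_onto invK).
  by right; apply: (list_map_onto invK).
have overlap a b : f1 a = f2 b -> (a = x /\ b = x) \/ (a = y /\ b = y).
  move=> /(congr1 val); rewrite /= f1v f2v => e.
  have in_iota v : (idx v : nat) \in iota 0 k by rewrite mem_iota add0n ltn_ord.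
  have /allP /(_ _ (in_iota b)) := over _ (in_iota a); rewrite e eqxx /=.
  have inj u v : (idx u == idx v :> nat) -> u = v by move/eqP/val_inj/(can_inj idxK).
  by case/orP => /andP [/inj -> /inj ->]; [left|right].
have fx : f1 x = f2 x by apply/val_inj; rewrite /= f1v f2v x1 x2.
have fy : f1 y = f2 y by apply/val_inj; rewrite /= f1v f2v y12.
eexists; split.
- exact: (hinge_glue_simple f1inj f2inj fx fy overlap uxyc uxyc simpleF simpleF).
- exact: (hinge_glue_independent f1inj f2inj fcover fx fy overlap uxyc uxyc exy exy indF indF).
- exact: (hinge_glue_covers f1inj f2inj fcover fx fy ndF ndF covF covF).
have img1 a b : [set a; b] \in F -> [set f1 a; f1 b] \in graph_image f1 F.
  by move=> h; apply/imsetP; exists [set a; b]; rewrite // imsetU !imset_set1.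
have img2 a b : [set a; b] \in F -> [set f2 a; f2 b] \in graph_image f2 F.
  by move=> h; apply/imsetP; exists [set a; b]; rewrite // imsetU !imset_set1.
have vert (a b : 'I_m.+3) : (a < b)%N -> (b < 3)%N -> [set a; b] \in
    [set f1 c; f2 c] |: (graph_image f1 F :|: graph_image f2 F).
  case: a b => [a ha] [b hb] /=.
  have e0 : f1 x = 0%N :> nat by rewrite f1v x1.
  have e1 : f1 c = 1%N :> nat by rewrite f1v c1.
  have e2 : f2 c = 2%N :> nat by rewrite f2v c2.
  case: b hb => [|[|[|b]]] hb //; case: a ha => [|[|[|a]]] ha // _ _.
  - rewrite (_ : [set _; _] = [set f1 x; f1 c]); last by congr [set _; _]; apply/val_inj.
    by apply/setU1P; right; apply/setUP; left; apply: img1.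
  - rewrite (_ : [set _; _] = [set f2 x; f2 c]); last by rewrite -fx; congr [set _; _]; apply/val_inj.
    by apply/setU1P; right; apply/setUP; right; apply: img2.
  - rewrite (_ : [set _; _] = [set f1 c; f2 c]); last by congr [set _; _]; apply/val_inj.
    by rewrite setU11.
move=> a b ha hb ab; have [lt|lt|eq] := ltngtP a b.
- exact: vert.
- by rewrite setUC; apply: vert.
- by case/eqP: ab; apply/val_inj.
Qed.

Lemma rooted_triangle (R : realType) : rooted_block R 0 1.
Proof.
exists (clique 'I_3); split.
- exact: clique_simple.
- exact: triangle_independent.
- exact: triangle_covers.
- by move=> a b _ _ ab; rewrite clique_edge.
Qed.

Lemma rooted_tetrahedron (R : realType) : rooted_block R 1 2.
Proof.
apply: (@hinge_double R _ (clique 'I_3) 3 id id i0 i1 i2 1 1 [:: 0; 3; 1]%N [:: 0; 3; 2]%N) => //.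
- exact: clique_simple.
- exact: triangle_independent.
- exact: triangle_covers.
- by apply: nondegenerate_of_edges; rewrite clique_edge.
- by rewrite clique_edge.
- by rewrite clique_edge.
Qed.

(** Two copies with ten vertices each share the two hinge vertices, numbered 0 and 3: 18 vertices,
    15 of them outside the root. *)
Lemma rooted_double_K46 (R : realType) : rooted_block R 15 (2 * (76 * 76)).
Proof.
apply: (@hinge_double R _ K46 (4 + 6) (@unsplit 4 6) (@split 4 6) (inl ord0) (inr ord0)
  (inr (inord 2)) 76 15 [:: 0; 4; 5; 6; 3; 7; 1; 8; 9; 10]%N
  [:: 0; 11; 12; 13; 3; 14; 2; 15; 16; 17]%N).
- exact: unsplitK.
- exact: splitK.
- exact: K46_simple.
- exact: K46_independent.
- exact: K46_covers.
- exact: K46_nondegenerate.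
- by rewrite /= !inE /= andbT; apply/eqP => -[/(congr1 val)]; rewrite /= inordK.
- exact: (K46_mem (ord0, ord0)).
- exact: (K46_mem (ord0, inord 2)).
- by [].
- by rewrite /= inordK.
- by [].
- by [].
Qed.

Lemma rooted_glue (R : realType) m1 m2 N1 N2 :
  rooted_block R m1 N1 -> rooted_block R m2 N2 -> rooted_block R (m1 + m2) (N1 * N2).
Proof.
move=> [E1 [s1 i1' c1 r1]] [E2 [s2 i2' c2 r2]].
pose f1 (i : 'I_m1.+3) : 'I_(m1 + m2).+3 := inord i.
(* The root vertices are shared; the others are numbered after those of the first block. *)
pose f2 (i : 'I_m2.+3) : 'I_(m1 + m2).+3 := inord (if (i < 3)%N then (i : nat) else m1 + i)%N.
have f1v i : f1 i = i :> nat.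
  by rewrite inordK // (leq_trans (ltn_ord i)) // !ltnS leq_addr.
have f2v i : f2 i = (if i < 3 then (i : nat) else m1 + i)%N :> nat.
  rewrite inordK //; case: ifP => h; first by rewrite (leq_trans h) // !ltnS.
  by rewrite -!addnS leq_add2l ltn_ord.
have f1inj : injective f1 by move=> a b /(congr1 val) /=; rewrite !f1v => /val_inj.
have f2inj : injective f2.
  move=> a b /(congr1 val) /=; rewrite !f2v; case: ifP => ha; case: ifP => hb.
  - by move/val_inj.
  - by move=> e; move: ha; rewrite e => ha; case/negP: (negbT hb); apply: leq_ltn_trans ha; apply: leq_addl.
  - by move=> e; move: hb; rewrite -e => hb; case/negP: (negbT ha); apply: leq_ltn_trans hb; apply: leq_addl.
  - by move/addnI/val_inj.
have fcover v : (exists a, v = f1 a) \/ (exists b, v = f2 b).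
  have [h|h] := ltnP v m1.+3; first by left; exists (Ordinal h); apply/val_inj; rewrite /= f1v.
  have hv : (v - m1 < m2.+3)%N.
    by rewrite ltn_subLR ?(leq_trans _ h) ?leqW // !addnS ltn_ord.
  right; exists (Ordinal hv); apply/val_inj; rewrite /= f2v /= ifF.
    by rewrite subnKC // (leq_trans _ h) // !leqW.
  by apply/negbTE; rewrite -leqNgt leq_subRL ?addn3 // (leq_trans _ h) // !leqW.
have small1 (k : nat) : (k < 3)%N -> f1 (inord k) = k :> nat by move=> h; rewrite f1v inordK // (leq_trans h).
have small2 (k : nat) : (k < 3)%N -> f2 (inord k) = k :> nat.
  by move=> h; rewrite f2v inordK ?(leq_trans h) // h.
have same k : (k < 3)%N -> f1 (inord k) = f2 (inord k).
  by move=> h; apply/val_inj; rewrite /= small1 // small2.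
have neq m k k' : (k < 3)%N -> (k' < 3)%N -> k != k' -> (inord k : 'I_m.+3) != inord k'.
  by move=> h h'; apply: contra_neq => /(congr1 val) /=; rewrite !inordK // (leq_trans h, leq_trans h').
have overlap a b : f1 a = f2 b -> [\/ a = inord 0 /\ b = inord 0, a = inord 1 /\ b = inord 1
    | a = inord 2 /\ b = inord 2].
  move=> /(congr1 val); rewrite /= f1v f2v; case: ifP => hb e.
    have -> : a = inord b by apply/val_inj; rewrite /= inordK // (leq_trans hb).
    have -> : b = inord b by rewrite inord_val.
    case: (b : nat) hb => [|[|[|]]] // _.
    - by apply: Or31; rewrite inordK.
    - by apply: Or32; rewrite inordK.
    - by apply: Or33; rewrite inordK.
  have lt := ltn_ord a; rewrite e in lt.
  have : (m1 + b < m1 + 3)%N by rewrite addn3.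
  by rewrite ltn_add2l hb.
have edge (m : nat) (E : {set {set 'I_m.+3}}) :
    (forall a b : 'I_m.+3, (a < 3)%N -> (b < 3)%N -> a != b -> [set a; b] \in E) ->
    [&& [set inord 0; inord 1] \in E, [set inord 0; inord 2] \in E & [set inord 1; inord 2] \in E].
  by move=> h; rewrite !h ?inordK ?neq.
exists (graph_image f1 E1 :|: graph_image f2 E2); split.
- exact: (triangle_glue_simple f1inj f2inj s1 s2).
- apply: (triangle_glue_independent f1inj f2inj fcover (same 0%N isT) (same 1%N isT) (same 2%N isT)
    overlap _ (edge _ _ r1) (edge _ _ r2) i1' i2').
  by rewrite /= !inE !negb_or !neq.
- exact: (triangle_glue_covers f1inj f2inj fcover (same 0%N isT) (same 1%N isT) (same 2%N isT)
    (edge _ _ r1) c1 c2).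
move=> a b ha hb ab; apply/setUP; left; apply/imsetP; exists [set inord a; inord b].
  apply: r1; rewrite ?inordK ?(leq_trans ha) ?(leq_trans hb) //.
  by apply: contra_neq ab => /(congr1 val) /=; rewrite !inordK ?(leq_trans ha) ?(leq_trans hb) // => /val_inj.
rewrite imsetU !imset_set1; congr [set _; _]; apply/val_inj; rewrite /= small1 //.
Qed.

Lemma rooted_book (R : realType) r q : rooted_block R (r + 15 * q) (2 ^ r * 11552 ^ q).
Proof.
have pages m N k : rooted_block R m N -> rooted_block R (m * k) (N ^ k).
  move=> h; elim: k => [|k IHk]; first by rewrite muln0; apply: rooted_triangle.
  by rewrite mulnS expnS; apply: rooted_glue.
apply: rooted_glue; first by have := pages _ _ r (rooted_tetrahedron R); rewrite mul1n.
exact: pages (rooted_double_K46 R).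
Qed.

Lemma min_lambda3_exists (R : realType) n : (3 <= n)%N -> exists m,
  is_min_lambda3 R n m /\ (m <= 2 ^ ((n - 3) %% 15) * 11552 ^ ((n - 3) %/ 15))%N.
Proof.
case: n => [|[|[|n]]] // _; rewrite -[n.+3]addn3 addnK addn3; set N := (_ * _)%N.
have := rooted_book R (n %% 15) (n %/ 15); rewrite -/N addnC mulnC -divn_eq => -[E [sE iE cE _]].
have [k [kN rigE lamE]] := minimally_rigid_of_covers sE iE cE.
pose P m := `[< exists E : {set {set 'I_n.+3}}, minimally_rigid R E /\ is_lambda3 R E m >].
have exP : exists m, P m by exists k; apply/asboolP; exists E.
case: (ex_minnP exP) => m /asboolP hm min; exists m; split.
  split=> // E' k' r' l'; apply: min; apply/asboolP; by exists E'.
by apply: leq_trans kN; apply: min; apply/asboolP; exists E.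
Qed.

(** * The growth rate *)

Lemma power15 (A : comNzRingType) (a : A) : a ^+ 15 =
  (a * a * (a * a * a)) * (a * a * (a * a * a)) * (a * a * (a * a * a)).
Proof. ring. Qed.

Section Root.
Variable R : realType.
Let alpha : R := 11552%:R `^ (15%:R^-1).

Lemma root_pow : alpha ^+ 15 = 11552%:R.
Proof.
rewrite -powR_mulrn ?powR_ge0 // -powRrM mulVf ?powRr1 ?ler0n //.
by rewrite pnatr_eq0.
Qed.

Lemma mul_le (a b A B C : R) : 0 <= a -> 0 <= b -> a <= A -> b <= B -> A * B <= C -> a * b <= C.
Proof. by move=> a0 b0 aA bB; apply: le_trans; apply: ler_pM. Qed.

Lemma mul_ge (a b A B C : R) : 0 <= A -> 0 <= B -> A <= a -> B <= b -> C <= A * B -> C <= a * b.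
Proof. by move=> a0 b0 aA bB h; apply: le_trans h _; apply: ler_pM. Qed.

(** The interval is 1.86571 plus or minus 5/10^6. Powers 2, 3 and 5 are rounded outward in turn,
    which keeps the numbers small for [lra]. *)
Lemma root_bounds (a : R) : 0 <= a -> a ^+ 15 = 11552%:R ->
  1865705%:R / 1000000%:R < a < 1865715%:R / 1000000%:R.
Proof.
move=> a0 root; have e := power15 a.
apply/andP; split; rewrite ltNge; apply/negP => h.
- have h2 : a * a <= 348086%:R / 100000%:R by apply: (mul_le a0 a0 h h); lra.
  have h3 : a * a * a <= 649426%:R / 100000%:R.
    by apply: (mul_le (mulr_ge0 a0 a0) a0 h2 h); lra.
  have a2 := mulr_ge0 a0 a0; have a3 := mulr_ge0 a2 a0.
  have h5 : a * a * (a * a * a) <= 226057%:R / 10000%:R by apply: (mul_le a2 a3 h2 h3); lra.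
  have a5 := mulr_ge0 a2 a3.
  have h10 := mul_le a5 a5 h5 h5 (lexx _).
  have := mul_le (mulr_ge0 a5 a5) a5 h10 h5 (lexx _); rewrite -e root.
  lra.
- have h2 : 348089%:R / 100000%:R <= a * a by apply: (mul_ge _ _ h h); lra.
  have h3 : 649434%:R / 100000%:R <= a * a * a by apply: (mul_ge _ _ h2 h); lra.
  have h5 : 226060%:R / 10000%:R <= a * a * (a * a * a) by apply: (mul_ge _ _ h2 h3); lra.
  have c0 : 0 <= 226060%:R / 10000%:R :> R by lra.
  have h10 := mul_ge c0 c0 h5 h5 (lexx _).
  have := mul_ge (mulr_ge0 c0 c0) c0 h10 h5 (lexx _); rewrite -e root.
  lra.
Qed.

Lemma root_approx (a : R) : 0 <= a -> a ^+ 15 = 11552%:R ->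
  1 <= a /\ `|a - 186571%:R / 100000%:R| < 5%:R / 1000000%:R.
Proof.
move=> a0 /(root_bounds a0) /andP [lo hi]; split; first by lra.
rewrite ltr_norml; apply/andP; split.
  lra.
lra.
Qed.

(** The exponent of 2 is below 15, and 15 times the quotient is at most n. *)
Lemma root_growth n m : (3 <= n)%N ->
  (m <= 2 ^ ((n - 3) %% 15) * 11552 ^ ((n - 3) %/ 15))%N ->
  m%:R <= 2 ^+ 15 * alpha ^+ n.
Proof.
move=> hn hm; set r := ((n - 3) %% 15)%N in hm; set q := ((n - 3) %/ 15)%N in hm.
have [a1 _] := root_approx (powR_ge0 _ _) root_pow.
have hm' : m%:R <= (2 ^ r * 11552 ^ q)%:R :> R by rewrite ler_nat.
apply: le_trans hm' _; rewrite natrM !natrX -root_pow -exprM.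
apply: ler_pM; rewrite ?exprn_ge0 ?(le_trans _ a1) //.
  by apply: ler_weXn2l; rewrite ?ler1n // ltnW // ltn_pmod.
apply: ler_weXn2l => //; rewrite mulnC; apply: leq_trans (leq_subr 3 n).
exact: leq_trunc_div.
Qed.

End Root.

Theorem theorem12 (R : realType) :
  exists min_lambda3 : nat -> nat,
    [/\ forall n : nat, (3 <= n)%N -> is_min_lambda3 R n (min_lambda3 n),
        forall n : nat, (3 <= n)%N ->
          (min_lambda3 n
             <= 1 * 2 ^ ((n - 3) %% 15) * 11552 ^ ((n - 3) %/ 15))%N,
        exists c : R, 0 < c /\
          forall n : nat, (3 <= n)%N ->
            (min_lambda3 n)%:R <= c * (11552%:R `^ (15%:R^-1)) ^+ n
      & `|11552%:R `^ (15%:R^-1) - 186571%:R / 100000%:R|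
          < 5%:R / 1000000%:R :> R].
Proof.
have /choice [f hf] : forall n, exists m, (3 <= n)%N -> is_min_lambda3 R n m /\
    (m <= 2 ^ ((n - 3) %% 15) * 11552 ^ ((n - 3) %/ 15))%N.
  (* Below three vertices nothing is claimed, so any value serves. *)
  move=> n; case: (leqP 3 n) => hn; last by exists 0%N.
  by have [m hm] := min_lambda3_exists R hn; exists m.
exists f; split.
- by move=> n /hf [].
- by move=> n /hf []; rewrite mul1n.
- exists (2 ^+ 15); split; first exact: exprn_gt0.
  by move=> n hn; apply: root_growth => //; have [] := hf n hn.
- by have [] := root_approx (powR_ge0 _ _) (root_pow R).
Qed.
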